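(* Let $G$ be a finitely generated inaccessible group. Then $G$ contains an infinite locally finite subgroup.
   Context: For a $G$–tree $T$, an edge $e$ is compressible if $G_e=G_{\iota e}$ and the endpoints $\iota e,\tau e$ lie in different $G$–orbits; $T$ is reduced if it has no compressible edges. A finitely generated group $G$ is inaccessible if there is a sequence $T_1,T_2,\dots$ of reduced simplicial $G$–trees, each with finitely many orbits of edges and all edge stabilizers finite, such that for each $n$ there is a surjective $G$–map $T_n\to T_{n-1}$ obtained by contracting finitely many $G$–orbits of edges, and the number of $G$–orbits of vertices of $T_n$ tends to infinity. A group is locally finite if every finitely generated subgroup is finite. *)

(* Defs.v *)
From Stdlib Require Import List.
Import ListNotations.
Set Implicit Arguments.

Record Group := {
  gcar :> Type;
  gmul : gcar -> gcar -> gcar;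
  gone : gcar;
  ginv : gcar -> gcar;
  gmul_assoc : forall x y z, gmul x (gmul y z) = gmul (gmul x y) z;
  gmul_1l : forall x, gmul gone x = x;
  gmul_Vl : forall x, gmul (ginv x) x = gone
}.

Definition is_subgroup (G : Group) (H : G -> Prop) : Prop :=
  H (gone G) /\ (forall x y, H x -> H y -> H (gmul G x y)) /\
  (forall x, H x -> H (ginv G x)).

Arguments is_subgroup {G}.

Definition generated (G : Group) (S : G -> Prop) (x : G) : Prop :=
  forall H : G -> Prop, is_subgroup H -> (forall y, S y -> H y) -> H x.

Definition finite_set (T : Type) (A : T -> Prop) : Prop :=
  exists l : list T, forall x, A x -> In x l.

Arguments generated {G}.
Arguments finite_set {T}.

Definition finitely_generated (G : Group) : Prop :=
  exists s : list G, forall x : G, generated (fun y => In y s) x.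

Definition locally_finite {G : Group} (H : G -> Prop) : Prop :=
  forall s : list G, (forall y, In y s -> H y) ->
    finite_set (generated (fun y => In y s)).

Record GTree (G : Group) := {
  vert : Type;
  edge : Type;
  orig : edge -> vert;
  rev  : edge -> edge;
  actV : G -> vert -> vert;
  actE : G -> edge -> edge;
  rev_rev : forall e, rev (rev e) = e;
  rev_neq : forall e, rev e <> e;
  actV_1 : forall v, actV (gone G) v = v;
  actV_M : forall g h v, actV (gmul G g h) v = actV g (actV h v);
  actE_1 : forall e, actE (gone G) e = e;
  actE_M : forall g h e, actE (gmul G g h) e = actE g (actE h e);
  orig_act : forall g e, orig (actE g e) = actV g (orig e);
  rev_act : forall g e, rev (actE g e) = actE g (rev e);
  no_inversion : forall g e, actE g e <> rev e;
  is_tree :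
    let term := fun e => orig (rev e) in
    let fix is_path (v : vert) (p : list edge) (w : vert) : Prop :=
      match p with
      | [] => v = w
      | e :: p' => orig e = v /\ is_path (term e) p' w
      end in
    let fix reduced (p : list edge) : Prop :=
      match p with
      | e1 :: ((e2 :: _) as p') => e2 <> rev e1 /\ reduced p'
      | _ => True
      end in
    (forall u v, exists p, is_path u p v) /\
    (forall v p, is_path v p v -> reduced p -> p = [])
}.

Arguments vert {G}. Arguments edge {G}. Arguments orig {G}. Arguments rev {G}.
Arguments actV {G}. Arguments actE {G}.

Definition term {G : Group} {T : GTree G} (e : edge T) : vert T := orig T (rev T e).

Fixpoint path_in {G : Group} {T : GTree G} (C : edge T -> Prop)
    (v : vert T) (p : list (edge T)) (w : vert T) : Prop :=
  match p with
  | [] => v = w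
  | e :: p' => C e /\ orig T e = v /\ path_in C (term e) p' w
  end.

Definition compressible {G : Group} {T : GTree G} (e : edge T) : Prop :=
  (forall g : G, actE T g e = e <-> actV T g (orig T e) = orig T e) /\
  ~ (exists g : G, actV T g (orig T e) = term e).

Definition reduced_tree {G : Group} (T : GTree G) : Prop :=
  forall e : edge T, ~ compressible e.

Definition finitely_many_edge_orbits {G : Group} (T : GTree G) : Prop :=
  exists l : list (edge T), forall e, exists e0 g, In e0 l /\ e = actE T g e0.

Definition finite_edge_stabilizers {G : Group} (T : GTree G) : Prop :=
  forall e : edge T, finite_set (fun g : G => actE T g e = e).

Definition at_least_vertex_orbits {G : Group} (T : GTree G) (n : nat) : Prop :=
  exists l : list (vert T), length l = n /\ NoDup l /\
    forall u v, In u l -> In v l -> forall g : G, actV T g u = v -> u = v.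

(* S is obtained from T by contracting finitely many G-orbits of edges,
   via the G-map (fV, fE): C is a G-invariant, rev-closed set of edges forming
   finitely many G-orbits; fV is a G-map identifying exactly the vertices
   joined by paths in C; fE is a G-equivariant bijection from the edges not in
   C onto the edges of S, compatible with orig and rev. *)
Definition contraction_map {G : Group} (T S : GTree G) : Prop :=
  exists (C : edge T -> Prop) (fV : vert T -> vert S) (fE : edge T -> edge S),
    (exists l : list (edge T), forall e,
        C e <-> exists e0 g, In e0 l /\ C e0 /\ e = actE T g e0) /\
    (forall e, C e -> C (rev T e)) /\
    (forall g e, C e -> C (actE T g e)) /\
    (forall g v, fV (actV T g v) = actV S g (fV v)) /\
    (forall v' : vert S, exists v, fV v = v') /\
    (forall u v, fV u = fV v <-> exists p, path_in C u p v) /\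
    (forall g e, ~ C e -> fE (actE T g e) = actE S g (fE e)) /\
    (forall e, ~ C e -> orig S (fE e) = fV (orig T e)) /\
    (forall e, ~ C e -> rev S (fE e) = fE (rev T e)) /\
    (forall e1 e2, ~ C e1 -> ~ C e2 -> fE e1 = fE e2 -> e1 = e2) /\
    (forall e' : edge S, exists e, ~ C e /\ fE e = e').

Definition inaccessible (G : Group) : Prop :=
  finitely_generated G /\
  exists T : nat -> GTree G,
    (forall n, reduced_tree (T n) /\ finitely_many_edge_orbits (T n) /\
               finite_edge_stabilizers (T n)) /\
    (forall n, contraction_map (T (S n)) (T n)) /\
    (forall N, exists n0, forall n, n0 <= n -> at_least_vertex_orbits (T n) N).

(* Main.v *)
(* Suppose every locally finite subgroup is finite. Then ascending chains of finite
   subgroups stop, so finite subgroups can be compared, up to conjugacy, by a well-founded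
   order, and so can finite multisets of them.

   Consider connected cocompact G-graphs whose vertex groups are elliptic in every T_n, with
   an invariant set of roots reached from every vertex by steps along arcs whose group is the
   whole vertex group. Matching each other vertex with the first arc of such a path leaves a
   multiset L of arc groups. Fix a graph for which L is minimal, and then the number r of root
   orbits maximal. Sliding an arc over a path fixed by its group keeps minimality, and
   coning off an elliptic piece cannot improve it; this forces finite subgroups that stabilize
   a connected piece to fix a vertex of it, in a connected way. Sliding arcs
   towards an equivariant map to T_n then brings the graph to a form that mirrors T_n: the
   fibres over vertices are connected and arcs map to edges or to vertices.
   As T_n is reduced, each fibre must contain a root or touch one of the leftover arcs, so T_n
   has at most r + 2|L| vertex orbits, for every n. *)

From Stdlib Require Import List Classical ClassicalEpsilon FunctionalExtensionality
  PropExtensionality Permutation Arith Lia Reals Lra Wellfounded Relations.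
Require Import Defs.
Import ListNotations.

Notation "x ** y" := (gmul _ x y) (at level 40, left associativity).
Notation iv x := (ginv _ x).
Notation e1 := (gone _).

(** Nothing bounds the orders of the finite groups involved, so sums of inverse orders cannot serve
    as the main measure; the multiset order takes that role, and such a sum, [chi], only drives an
    inner induction. The bound must not depend on [n], hence one minimal graph for all trees, with
    vertex groups elliptic in every one of them. The fixed-vertex property of pieces ([fixconn]) is
    proved by refuting a counterexample with least [chi]. If the stabilizer of the piece is elliptic
    in every tree, the piece is coned off. If it fixes no vertex of some [T n], the components of
    arcs collapsed over [T n] have strictly smaller [chi], so they have the property, and it is
    carried back from a normal form over [T n]. A least [chi] exists because every value is a member
    of a fixed finite set minus a sum of boundedly many unit fractions. Maximality of [r] settles
    the one tie in coning: a single removed arc group is exchanged for an equal arc group at the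
    cone point, which keeps [L] and adds a root. *)

Lemma pred_ext {A : Type} (P Q : A -> Prop) : (forall x, P x <-> Q x) -> P = Q.
Proof.
  intros h. apply functional_extensionality. intros x.
  apply propositional_extensionality. apply h.
Qed.

Lemma least (P : nat -> Prop) : (exists n, P n) -> exists n, P n /\ forall m, P m -> n <= m.
Proof.
  intros [n hn]. induction n as [n IH] using lt_wf_ind.
  destruct (classic (exists m, P m /\ m < n)) as [[m [h1 h2]]|h].
  - exact (IH m h2 h1).
  - exists n. split; [exact hn|]. intros m hm.
    destruct (le_lt_dec n m); [assumption|]. exfalso. apply h. now exists m.
Qed.

Lemma greatest (P : nat -> Prop) b : (exists n, P n) -> (forall n, P n -> n <= b) ->
  exists n, P n /\ forall m, P m -> m <= n.
Proof.
  intros [n hn] hb.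
  destruct (least (fun k => exists m, P m /\ k = b - m)) as [k [[m [h1 h2]] h3]].
  { exists (b - n), n. auto. }
  exists m. split; [exact h1|]. intros m' hm'.
  assert (k <= b - m') by (apply h3; now exists m').
  specialize (hb m' hm'). lia.
Qed.

(** * Groups, conjugates and sizes *)

Section Groups.
Context {G : Group}.
Implicit Types x y z g h : G.

Lemma mulA x y z : x ** y ** z = x ** (y ** z).
Proof. symmetry. apply gmul_assoc. Qed.
Lemma mul1g x : e1 ** x = x. Proof. apply gmul_1l. Qed.
Lemma mulVg x : iv x ** x = e1. Proof. apply gmul_Vl. Qed.
Lemma mulVKg x y : iv x ** (x ** y) = y.
Proof. now rewrite <- mulA, mulVg, mul1g. Qed.
Lemma mulgV x : x ** iv x = e1.
Proof.
  rewrite <- (mul1g (x ** iv x)), <- (mulVg (iv x)), mulA.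
  now rewrite (mulVKg x (iv x)).
Qed.
Lemma mulg1 x : x ** e1 = x.
Proof. now rewrite <- (mulVg x), <- mulA, mulgV, mul1g. Qed.
Lemma mulKVg x y : x ** (iv x ** y) = y.
Proof. now rewrite <- mulA, mulgV, mul1g. Qed.
Lemma mul_cancel x y z : x ** y = x ** z -> y = z.
Proof. intros h. now rewrite <- (mulVKg x y), h, mulVKg. Qed.
Lemma ivK x : iv (iv x) = x.
Proof. apply (mul_cancel (iv x)). now rewrite mulgV, mulVg. Qed.
Lemma iv1 : iv (@gone G) = e1.
Proof. apply (mul_cancel e1). now rewrite mulgV, mul1g. Qed.
Lemma ivM x y : iv (x ** y) = iv y ** iv x.
Proof. apply (mul_cancel (x ** y)). now rewrite mulgV, mulA, mulKVg, mulgV. Qed.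
End Groups.

#[global] Hint Rewrite @mulA @mul1g @mulVg @mulVKg @mulgV @mulg1 @mulKVg @ivK @iv1 @ivM : grp.
Ltac gs := autorewrite with grp.
Tactic Notation "gs" "in" hyp(H) := autorewrite with grp in H.

Definition incl {A : Type} (K L : A -> Prop) : Prop := forall g, K g -> L g.
Notation fin := finite_set.

Section Size.
Context {A : Type}.
Implicit Types K L : A -> Prop.

Lemma fin_list K : fin K -> exists l, NoDup l /\ forall x, In x l <-> K x.
Proof.
  intros [l hl].
  exists (nodup (fun x y => excluded_middle_informative (x = y))
     (filter (fun x => if excluded_middle_informative (K x) then true else false) l)).
  split; [apply NoDup_nodup|].
  intros x. rewrite nodup_In, filter_In. split.
  - intros [_ h]. now destruct (excluded_middle_informative (K x)).
  - intros h. split; [now apply hl|]. now destruct (excluded_middle_informative (K x)).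
Qed.

Definition size_is K n := exists l, NoDup l /\ (forall x, In x l <-> K x) /\ length l = n.

(* [0] when [K] is infinite, so that [/ INR (size K)] is then [0] as well. *)
Definition size K : nat := epsilon (inhabits 0) (fun n => size_is K n \/ (~ fin K /\ n = 0)).

Lemma size_is_fun K n m : size_is K n -> size_is K m -> n = m.
Proof.
  intros (l & a & b & <-) (l' & a' & b' & <-).
  apply Permutation_length, NoDup_Permutation; auto.
  intros x. now rewrite b, b'.
Qed.

Lemma size_spec K : size_is K (size K) \/ (~ fin K /\ size K = 0).
Proof.
  unfold size. apply epsilon_spec.
  destruct (classic (fin K)) as [h|h]; [|exists 0; now right].
  destruct (fin_list K h) as (l & a & b). exists (length l). left. now exists l.
Qed.

Lemma size_fin K : fin K -> size_is K (size K).
Proof. intros h. now destruct (size_spec K) as [?|[? _]]. Qed.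

Lemma size_inf K : ~ fin K -> size K = 0.
Proof.
  intros h. destruct (size_spec K) as [(l & a & b & c)|[_ ?]]; [|assumption].
  exfalso. apply h. exists l. intros x. apply b.
Qed.

Lemma fin_incl K L : incl K L -> fin L -> fin K.
Proof. intros h [l hl]. exists l. intros x hx. apply hl, h, hx. Qed.

Lemma size_le K L : incl K L -> fin L -> size K <= size L.
Proof.
  intros h hL. pose proof (fin_incl K L h hL) as hK.
  destruct (size_fin K hK) as (l & a & b & <-).
  destruct (size_fin L hL) as (l' & a' & b' & <-).
  apply NoDup_incl_length; [assumption|]. intros x hx. apply b', h, b, hx.
Qed.

Lemma size_ge_incl K L : incl K L -> fin L -> size L <= size K -> incl L K.
Proof.
  intros h hL hs. pose proof (fin_incl K L h hL) as hK.
  destruct (size_fin K hK) as (l & a & b & e).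
  destruct (size_fin L hL) as (l' & a' & b' & e').
  intros x hx. apply b. apply (NoDup_length_incl a (l' := l')).
  - lia.
  - intros y hy. apply b', h, b, hy.
  - now apply b'.
Qed.

Lemma size_pos K x : fin K -> K x -> 1 <= size K.
Proof.
  intros hK hx. destruct (size_fin K hK) as (l & a & b & <-).
  apply b in hx. destruct l; [easy|simpl; lia].
Qed.

Lemma fin_ext K L : (forall x, K x <-> L x) -> fin K -> fin L.
Proof. intros h. apply fin_incl. intros x. apply h. Qed.
End Size.

Notation sub := is_subgroup.

Section Conj.
Context {G : Group}.
Implicit Types K L : G -> Prop.

Lemma sub1 K : sub K -> K e1. Proof. now intros [? _]. Qed.
Lemma subM K x y : sub K -> K x -> K y -> K (x ** y). Proof. intros [_ [h _]]. apply h. Qed.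
Lemma subV K x : sub K -> K x -> K (iv x). Proof. intros [_ [_ h]]. apply h. Qed.
Lemma sub_cap K L : sub K -> sub L -> sub (fun g => K g /\ L g).
Proof.
  intros hK hL. repeat split; try (now apply sub1);
    try (apply subM); try (apply subV); intuition.
Qed.

Lemma sub_pos K : sub K -> fin K -> 1 <= size K.
Proof. intros h f. apply (size_pos K e1 f). now apply sub1. Qed.

Definition cj (g : G) K : G -> Prop := fun x => K (iv g ** x ** g).

Lemma cj1 K : cj e1 K = K.
Proof. apply pred_ext. intros x. unfold cj. now gs. Qed.
Lemma cjM g h K : cj (g ** h) K = cj g (cj h K).
Proof. apply pred_ext. intros x. unfold cj. now gs. Qed.
Lemma cjK g K : cj (iv g) (cj g K) = K.
Proof. rewrite <- cjM, mulVg. apply cj1. Qed.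
Lemma cjKV g K : cj g (cj (iv g) K) = K.
Proof. rewrite <- cjM, mulgV. apply cj1. Qed.
Lemma cj_sub g K : sub K -> sub (cj g K).
Proof.
  intros h. unfold cj. repeat split.
  - gs. now apply sub1.
  - intros x y a b. replace (iv g ** (x ** y) ** g) with (iv g ** x ** g ** (iv g ** y ** g))
      by (now gs). now apply subM.
  - intros x a. replace (iv g ** iv x ** g) with (iv (iv g ** x ** g)) by (now gs).
    now apply subV.
Qed.
Lemma cj_incl g K L : incl K L -> incl (cj g K) (cj g L).
Proof. intros h x. apply h. Qed.
Lemma cj_incl_iff g K L : incl (cj g K) L <-> incl K (cj (iv g) L).
Proof.
  split; intros h.
  - rewrite <- (cjK g K). now apply cj_incl.
  - rewrite <- (cjKV g L). now apply cj_incl.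
Qed.
Lemma cj_fin1 g K : fin K -> fin (cj g K).
Proof.
  intros [l hl]. exists (map (fun x => g ** x ** iv g) l).
  intros x hx. apply in_map_iff. exists (iv g ** x ** g). split; [now gs|now apply hl].
Qed.
Lemma cj_fin g K : fin (cj g K) <-> fin K.
Proof. split; [|apply cj_fin1]. intros h. rewrite <- (cjK g K). now apply cj_fin1. Qed.
Lemma cj_size g K : size (cj g K) = size K.
Proof.
  destruct (classic (fin K)) as [h|h].
  - destruct (size_fin K h) as (l & a & b & c).
    apply (size_is_fun (cj g K)); [now apply size_fin, cj_fin|].
    exists (map (fun x => g ** x ** iv g) l). repeat split.
    + apply FinFun.Injective_map_NoDup; [|assumption].
      intros x y e. apply (f_equal (fun z => iv g ** z ** g)) in e. now gs in e.
    + intros hx. apply in_map_iff in hx. destruct hx as (y & <- & hy).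
      unfold cj. gs. now apply b.
    + intros hx. apply in_map_iff. exists (iv g ** x ** g). split; [now gs|now apply b].
    + now rewrite length_map.
  - rewrite !size_inf; auto. now rewrite cj_fin.
Qed.
Lemma fin_cj_eq g K L : fin L -> incl (cj g K) L -> size L <= size K -> cj g K = L.
Proof.
  intros f h s. apply pred_ext. intros x. split; [apply h|].
  apply size_ge_incl; auto. now rewrite cj_size.
Qed.

(** All infinite groups form one class: only finite groups have to be told apart, yet arcs with
    infinite groups may occur in a cost. *)
Definition same K L := (~ fin K /\ ~ fin L) \/ exists g, L = cj g K.

Lemma same_refl K : same K K.
Proof. right. exists e1. now rewrite cj1. Qed.
Lemma same_sym K L : same K L -> same L K.
Proof. intros [[a b]|[g ->]]; [now left|right]. exists (iv g). now rewrite cjK. Qed.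
Lemma same_fin K L : same K L -> fin K -> fin L.
Proof. intros [[a b]|[g ->]]; [easy|]. now rewrite cj_fin. Qed.
Lemma same_trans K L M : same K L -> same L M -> same K M.
Proof.
  intros h1 h2. destruct h1 as [[a b]|[g e]].
  - left. split; [assumption|]. intros f. apply b. apply (same_fin M); [now apply same_sym|assumption].
  - destruct h2 as [[a b]|[g' e']].
    + left. split; [|assumption]. subst L. now rewrite cj_fin in a.
    + right. exists (g' ** g). now rewrite cjM, <- e.
Qed.
Lemma same_size K L : same K L -> size K = size L.
Proof. intros [[a b]|[g ->]]; [|now rewrite cj_size]. now rewrite !size_inf. Qed.

(* [subconj K L]: a conjugate of [K] sits properly in [L], where all infinite
   subgroups count as one top element. *)
Definition subconj K L := sub K /\ sub L /\ fin K /\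
  (~ fin L \/ exists g, incl (cj g K) L /\ size K < size L).

Lemma subconj_same_l K K' L : sub K' -> same K K' -> subconj K L -> subconj K' L.
Proof.
  intros hs hk (a & b & c & d). pose proof (same_fin _ _ hk c) as f.
  repeat split; auto; try apply b; try apply hs.
  destruct d as [d|(g & d1 & d2)]; [now left|right].
  destruct hk as [[? _]|[k ->]]; [easy|].
  exists (g ** iv k). rewrite cjM, cjK, cj_size. auto.
Qed.
Lemma subconj_same_r K L L' : sub L' -> same L L' -> subconj K L -> subconj K L'.
Proof.
  intros hs hl (a & b & c & d). split; [assumption|split; [assumption|split; [assumption|]]].
  destruct hl as [[_ ?]|[k ->]]; [now left|].
  destruct d as [d|(g & d1 & d2)]; [left; now rewrite cj_fin|right].
  exists (k ** g). rewrite cjM, cj_size. split; [now apply cj_incl|assumption].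
Qed.
Lemma subconj_trans K L M : subconj K L -> subconj L M -> subconj K M.
Proof.
  intros (a & b & c & d) (a' & b' & c' & d').
  split; [assumption|split; [assumption|split; [assumption|]]].
  destruct d' as [?|(g & e & f)]; [now left|right].
  destruct d as [?|(k & e' & f')]; [easy|].
  exists (g ** k). split; [|lia]. rewrite cjM. intros x hx. apply e. revert x hx.
  now apply cj_incl.
Qed.
Lemma subconj_not_same K L : subconj K L -> ~ same K L.
Proof.
  intros (a & b & c & d) h. destruct d as [d|(g & e & f)].
  - apply d. now apply (same_fin K).
  - apply same_size in h. lia.
Qed.
Lemma incl_cj_subconj K L g : sub K -> sub L -> fin K -> incl (cj g K) L -> subconj K L \/ L = cj g K.
Proof.
  intros a b c d. destruct (classic (fin L)) as [f|f].
  - destruct (le_lt_dec (size L) (size K)) as [e|e].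
    + right. symmetry. now apply fin_cj_eq.
    + left. unfold subconj. eauto 8.
  - left. unfold subconj. eauto 8.
Qed.
Lemma incl_subconj K L : sub K -> sub L -> fin K -> incl K L -> subconj K L \/ L = K.
Proof.
  intros a b c d. destruct (incl_cj_subconj K L e1 a b c) as [e|e]; rewrite ?cj1 in *; auto.
Qed.
Lemma incl_subconj_l K K' L : sub K -> incl K K' -> subconj K' L -> subconj K L.
Proof.
  intros hk hi (a & b & c & d). assert (fin K) by (now apply (fin_incl _ _ hi)).
  split; [assumption|split; [assumption|split; [assumption|]]].
  destruct d as [?|(g & e & f)]; [now left|right]. exists g. split.
  - intros x hx. apply e. revert x hx. now apply cj_incl.
  - pose proof (size_le _ _ hi c). lia.
Qed.
End Conj.

Local Open Scope R_scope.

(** * Sums over orbits *)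

Definition sm {A : Type} (f : A -> R) (l : list A) : R := fold_right (fun a r => f a + r) 0 l.

Section Sm.
Context {A : Type}.
Implicit Types (f g : A -> R) (l : list A).
Lemma sm_app f l l' : sm f (l ++ l') = sm f l + sm f l'.
Proof. induction l as [|a l IH]; simpl; [lra|]. rewrite IH. lra. Qed.
Lemma sm_map {B} (h : B -> A) f (l : list B) : sm f (map h l) = sm (fun b => f (h b)) l.
Proof. induction l as [|a l IH]; simpl; [lra|]. now rewrite IH. Qed.
Lemma sm_ext f g l : (forall x, In x l -> f x = g x) -> sm f l = sm g l.
Proof.
  intros h. induction l as [|a l IH]; simpl; [lra|].
  rewrite IH, h; simpl; auto. intros x hx. apply h. now right.
Qed.
Lemma sm_le f g l : (forall x, In x l -> f x <= g x) -> sm f l <= sm g l.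
Proof.
  intros h. induction l as [|a l IH]; simpl; [lra|].
  assert (f a <= g a) by (apply h; now left).
  assert (sm f l <= sm g l) by (apply IH; intros x hx; apply h; now right). lra.
Qed.
Lemma sm_lt f g l x : (forall x, In x l -> f x <= g x) -> In x l -> f x < g x ->
  sm f l < sm g l.
Proof.
  intros h hx hlt. apply in_split in hx. destruct hx as (l1 & l2 & ->).
  rewrite !sm_app. simpl.
  assert (sm f l1 <= sm g l1) by (apply sm_le; intros; apply h, in_app_iff; auto).
  assert (sm f l2 <= sm g l2) by (apply sm_le; intros; apply h, in_app_iff; simpl; auto).
  lra.
Qed.
Lemma sm_one l : sm (fun _ => 1) l = INR (length l).
Proof. induction l as [|a l IH]; [reflexivity|]. simpl length. rewrite S_INR. simpl. lra. Qed.
Lemma sm_INR (n : A -> nat) l : exists m, sm (fun a => INR (n a)) l = INR m.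
Proof.
  induction l as [|a l [m IH]]; [now exists 0%nat|].
  exists (n a + m)%nat. rewrite plus_INR. simpl. lra.
Qed.
End Sm.

Section Osum.
Context {A : Type} (Rq : A -> A -> Prop) (RE : equivalence A Rq).
Implicit Types (P Q : A -> Prop) (f g : A -> R).

Definition inv P := forall x y, Rq x y -> P x -> P y.
Definition ofin P := exists l, forall x, P x -> exists y, In y l /\ Rq y x.
Definition finv f := forall x y, Rq x y -> f x = f y.
Definition reps P l := (forall x, In x l -> P x) /\
  (forall x, P x -> exists y, In y l /\ Rq y x) /\ ForallOrdPairs (fun x y => ~ Rq x y) l.

Let Rrefl x : Rq x x. Proof. apply RE. Qed.
Let Rsym x y : Rq x y -> Rq y x. Proof. apply RE. Qed.
Let Rtrans x y z : Rq x y -> Rq y z -> Rq x z. Proof. apply RE. Qed.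

Lemma inv_and P Q : inv P -> inv Q -> inv (fun x => P x /\ Q x).
Proof. intros h k x y e [a b]. split; eauto. Qed.
Lemma inv_not P : inv P -> inv (fun x => ~ P x).
Proof. intros h x y e a b. apply a. eapply h; eauto. Qed.
Lemma ofin_sub P Q : (forall x, P x -> Q x) -> ofin Q -> ofin P.
Proof. intros h [l hl]. exists l. auto. Qed.

Lemma reps_exist P : inv P -> ofin P -> exists l, reps P l.
Proof.
  intros hP [l hl].
  assert (H : exists l', (forall x, In x l' -> P x) /\ ForallOrdPairs (fun x y => ~ Rq x y) l' /\
    forall x, P x -> In x l -> exists y, In y l' /\ Rq y x).
  { clear hl. induction l as [|a l (l' & h1 & h2 & h3)].
    - exists []. split; [easy|split; [constructor|easy]].
    - destruct (classic (P a /\ forall y, In y l' -> ~ Rq a y)) as [[p q]|n].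
      + exists (a :: l'). split; [|split].
        * intros x [<-|hx]; auto.
        * constructor; [now apply Forall_forall|assumption].
        * intros x px [<-|hx]; [exists a; simpl; auto|].
          destruct (h3 x px hx) as (y & ? & ?). exists y. simpl. auto.
      + exists l'. split; [assumption|split; [assumption|]].
        intros x px [<-|hx]; [|auto].
        apply NNPP. intros c. apply n. split; [assumption|]. intros y hy e. apply c.
        exists y. auto. }
  destruct H as (l' & h1 & h2 & h3). exists l'. split; [assumption|split; [|assumption]].
  intros x px. destruct (hl x px) as (y & a & b).
  assert (py : P y) by (apply (hP x); auto).
  destruct (h3 y py a) as (z & c & d). exists z. split; [assumption|]. eauto.
Qed.

Lemma FOP_app l1 l2 (S : A -> A -> Prop) : ForallOrdPairs S l1 -> ForallOrdPairs S l2 ->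
  (forall x y, In x l1 -> In y l2 -> S x y) -> ForallOrdPairs S (l1 ++ l2).
Proof.
  intros a b c. induction a as [|x l h t IH]; simpl; [assumption|].
  constructor.
  - apply Forall_app. split; [assumption|]. apply Forall_forall. intros y hy. apply c; simpl; auto.
  - apply IH. intros; apply c; simpl; auto.
Qed.
Lemma FOP_split l1 x l2 (S : A -> A -> Prop) : ForallOrdPairs S (l1 ++ x :: l2) ->
  ForallOrdPairs S (l1 ++ l2) /\ (forall y, In y (l1 ++ l2) -> S x y \/ S y x).
Proof.
  induction l1 as [|a l1 IH]; simpl; intros h; inversion h as [|? ? h1 h2]; subst.
  - split; [assumption|]. intros y hy. left. rewrite Forall_forall in h1. auto.
  - destruct (IH h2) as [i1 i2]. rewrite Forall_forall in h1. split.
    + constructor; [|assumption]. apply Forall_forall. intros y hy. apply h1.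
      rewrite in_app_iff in *. simpl. tauto.
    + intros y [<-|hy]; [right; apply h1, in_app_iff; simpl; auto|auto].
Qed.

Lemma reps_sum_eq P f l l' : finv f -> reps P l -> reps P l' -> sm f l = sm f l'.
Proof.
  intros hf h h'.
  enough (H : forall l l', ForallOrdPairs (fun x y => ~ Rq x y) l ->
    ForallOrdPairs (fun x y => ~ Rq x y) l' ->
    (forall x, In x l -> exists y, In y l' /\ Rq y x) ->
    (forall x, In x l' -> exists y, In y l /\ Rq y x) -> sm f l = sm f l').
  { destruct h as (a & b & c), h' as (a' & b' & c'). apply H; auto. }
  clear l l' h h'. induction l as [|x l IH]; intros l' a a' b b'.
  - destruct l' as [|y l']; [reflexivity|]. destruct (b' y) as (? & [] & _). now left.
  - destruct (b x (or_introl eq_refl)) as (y & hy & e).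
    apply in_split in hy. destruct hy as (l1 & l2 & ->).
    destruct (FOP_split _ _ _ _ a') as [c1 c2]. inversion a as [|? ? a1 a2]; subst.
    rewrite Forall_forall in a1.
    assert (E : sm f l = sm f (l1 ++ l2)).
    { apply IH; auto.
      - intros z hz. destruct (b z (or_intror hz)) as (u & hu & k). exists u.
        split; [|assumption]. rewrite in_app_iff in *. destruct hu as [?|[<-|?]]; auto.
        exfalso. apply (a1 z hz). eauto.
      - intros z hz. destruct (b' z) as (u & hu & k).
        { rewrite in_app_iff in *. simpl. tauto. }
        destruct hu as [<-|?]; [|eauto]. exfalso.
        destruct (c2 z hz) as [n|n]; apply n; eauto. }
    rewrite sm_app in *. simpl. rewrite (hf y x e), E. lra.
Qed.

(** The transversal is chosen by [epsilon], so that sums over orbits are plain terms; by [osum_reps]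
    the choice does not matter for invariant [f]. *)
Definition osum P f := sm f (epsilon (inhabits []) (reps P)).

Lemma osum_reps P f l : finv f -> reps P l -> osum P f = sm f l.
Proof.
  intros hf hl. apply (reps_sum_eq P); auto. unfold osum. apply epsilon_spec. now exists l.
Qed.
Lemma osum_list P : inv P -> ofin P -> exists l, reps P l /\ forall f, osum P f = sm f l.
Proof.
  intros a b. exists (epsilon (inhabits []) (reps P)). split; [|reflexivity].
  apply epsilon_spec. now apply reps_exist.
Qed.
Lemma osum_ext P Q f g : (forall x, P x <-> Q x) -> inv P -> ofin P ->
  (forall x, P x -> f x = g x) -> osum P f = osum Q g.
Proof.
  intros e h k m. apply pred_ext in e. subst Q.
  destruct (osum_list P h k) as (l & a & b). rewrite !b. apply sm_ext.
  intros x hx. apply m. now apply a.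
Qed.
Lemma osum_split P Q f : finv f -> inv P -> inv Q -> ofin P ->
  osum P f = osum (fun x => P x /\ Q x) f + osum (fun x => P x /\ ~ Q x) f.
Proof.
  intros hf hP hQ o.
  destruct (osum_list (fun x => P x /\ Q x)) as (l1 & (a1 & a2 & a3) & b).
  { now apply inv_and. } { now apply (ofin_sub _ P). }
  destruct (osum_list (fun x => P x /\ ~ Q x)) as (l2 & (a1' & a2' & a3') & b').
  { now apply inv_and, inv_not. } { now apply (ofin_sub _ P). }
  rewrite b, b', <- sm_app. apply osum_reps; [assumption|]. split; [|split].
  - intros x hx. apply in_app_iff in hx. destruct hx as [hx|hx]; [apply a1 in hx|apply a1' in hx]; tauto.
  - intros x px. destruct (classic (Q x)) as [q|q].
    + destruct (a2 x) as (y & ? & ?); [tauto|]. exists y. rewrite in_app_iff. auto.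
    + destruct (a2' x) as (y & ? & ?); [tauto|]. exists y. rewrite in_app_iff. auto.
  - apply FOP_app; auto. intros x y hx hy e. apply a1 in hx. apply a1' in hy.
    apply hy. apply (hQ x); tauto.
Qed.
Lemma osum_one P a f : finv f -> P a -> (forall x, P x -> Rq a x) -> osum P f = f a.
Proof.
  intros hf ha h. rewrite (osum_reps P f [a]); [simpl; lra|assumption|].
  split; [|split].
  - intros x [<-|[]]. assumption.
  - intros x hx. exists a. simpl. auto.
  - repeat constructor.
Qed.
Lemma osum_nil P f : (forall x, ~ P x) -> osum P f = 0.
Proof.
  intros h. unfold osum.
  assert (E : exists l, reps P l).
  { exists []. split; [easy|split; [|constructor]]. intros x hx. now apply h in hx. }
  pose proof (epsilon_spec (inhabits []) _ E) as (a & _).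
  destruct (epsilon (inhabits []) (reps P)) as [|x l]; [reflexivity|].
  exfalso. apply (h x), a. now left.
Qed.
Lemma osum_le P f g : inv P -> ofin P -> (forall x, P x -> f x <= g x) -> osum P f <= osum P g.
Proof.
  intros h k m. destruct (osum_list P h k) as (l & a & b). rewrite !b. apply sm_le.
  intros x hx. apply m. now apply a.
Qed.
Lemma osum_lt P f g x : inv P -> ofin P -> finv f -> finv g ->
  (forall x, P x -> f x <= g x) -> P x -> f x < g x -> osum P f < osum P g.
Proof.
  intros h k hf hg m hx hlt. destruct (osum_list P h k) as (l & a & b). rewrite !b.
  destruct a as (a1 & a2 & a3). destruct (a2 x hx) as (y & hy & e).
  apply (sm_lt f g l y); [intros; apply m, a1; assumption|assumption|].
  now rewrite (hf _ _ e), (hg _ _ e).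
Qed.
Lemma osum_zero P : inv P -> ofin P -> osum P (fun _ => 0) = 0.
Proof.
  intros h k. destruct (osum_list P h k) as (l & a & b). rewrite b.
  clear. induction l; simpl; lra.
Qed.
Lemma osum_ge0 P f : inv P -> ofin P -> (forall x, P x -> 0 <= f x) -> 0 <= osum P f.
Proof. intros h k m. rewrite <- (osum_zero P h k). now apply osum_le. Qed.
End Osum.

(** Change of variables along a map that is bijective on classes. It turns sums over vertices into
    sums over the arcs chosen at them, and compares a graph with its extensions. *)
Lemma osum_map {A B : Type} (Ra : A -> A -> Prop) (Rb : B -> B -> Prop)
    (EA : equivalence A Ra) (EB : equivalence B Rb) (P : A -> Prop) (Q : B -> Prop)
    (phi : A -> B) (F : B -> R) :
  inv Ra P -> ofin Ra P -> finv Rb F ->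
  (forall x y, P x -> P y -> (Ra x y <-> Rb (phi x) (phi y))) ->
  (forall b, Q b <-> exists a, P a /\ Rb (phi a) b) ->
  osum Ra P (fun a => F (phi a)) = osum Rb Q F.
Proof.
  intros hP hf hF h hQ. destruct (osum_list Ra EA P hP hf) as (l & (a1 & a2 & a3) & b).
  rewrite b. rewrite <- (sm_map phi F). symmetry. apply (osum_reps Rb EB); [assumption|].
  split; [|split].
  - intros x hx. apply in_map_iff in hx. destruct hx as (y & <- & hy). apply hQ.
    exists y. split; [auto|]. apply EB.
  - intros x hx. apply hQ in hx. destruct hx as (a & pa & e).
    destruct (a2 a pa) as (y & hy & e'). exists (phi y). split; [now apply in_map|].
    apply (equiv_trans _ _ EB _ (phi a)); [|assumption]. apply h; auto.
  - clear a2 b. induction l as [|x l IH]; simpl; [constructor|].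
    inversion a3 as [|? ? c1 c2]; subst. rewrite Forall_forall in c1. constructor.
    + apply Forall_forall. intros y hy. apply in_map_iff in hy.
      destruct hy as (z & <- & hz). intros e. apply (c1 z hz). apply h; simpl in *; auto.
    + apply IH; simpl in *; auto.
Qed.

(** * The multiset order *)

Section Order.
Context {G : Group}.
Implicit Types (K : G -> Prop) (L M : list (G -> Prop)).

Definition clw (w : (G -> Prop) -> R) := forall K K', same K K' -> w K = w K'.
(** Equality of multisets up to [same], tested by weights; the indicators [class_ind] separate the
    classes. Costs thereby become linear identities in [w]. *)
Definition meq L M := forall w, clw w -> sm w L = sm w M.

Definition class_ind K : (G -> Prop) -> R :=
  fun K' => if excluded_middle_informative (same K K') then 1 else 0.
Lemma ind_clw K : clw (class_ind K).
Proof.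
  intros A B h. unfold class_ind.
  destruct (excluded_middle_informative (same K A)) as [a|a],
    (excluded_middle_informative (same K B)) as [b|b]; auto; exfalso.
  - apply b. now apply (same_trans _ A).
  - apply a. apply (same_trans _ B); [assumption|now apply same_sym].
Qed.
Lemma ind_pos K L : 0 < sm (class_ind K) L -> exists K', In K' L /\ same K K'.
Proof.
  induction L as [|A L IH]; simpl; [lra|]. unfold class_ind at 1.
  destruct (excluded_middle_informative (same K A)) as [a|a].
  - intros _. exists A. auto.
  - intros h. destruct IH as (K' & ? & ?); [lra|]. exists K'. auto.
Qed.
Lemma ind_ge0 K L : 0 <= sm (class_ind K) L.
Proof.
  induction L as [|A L IH]; simpl; [lra|]. unfold class_ind at 1.
  destruct (excluded_middle_informative (same K A)); lra.
Qed.
Lemma ind_self K : class_ind K K = 1.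
Proof.
  unfold class_ind. destruct (excluded_middle_informative (same K K)) as [a|a]; [reflexivity|].
  exfalso. apply a, same_refl.
Qed.
Lemma ind_in K K' L : In K' L -> same K K' -> 0 < sm (class_ind K) L.
Proof.
  intros hi hs. apply in_split in hi. destruct hi as (l1 & l2 & ->).
  rewrite sm_app. simpl. pose proof (ind_ge0 K l1). pose proof (ind_ge0 K l2).
  assert (class_ind K K' = 1); [|lra]. rewrite <- (ind_clw K K K' hs). apply ind_self.
Qed.
Lemma one_clw : clw (fun _ => 1). Proof. now intros A B _. Qed.

Lemma extract K L : 0 < sm (class_ind K) L -> exists L', meq L (K :: L') /\ length L = S (length L').
Proof.
  intros h. destruct (ind_pos _ _ h) as (K' & hi & hs).
  apply in_split in hi. destruct hi as (l1 & l2 & ->). exists (l1 ++ l2). split.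
  - intros w hw. simpl. rewrite !sm_app. simpl. rewrite (hw K K' hs). lra.
  - rewrite !length_app. simpl. lia.
Qed.

(** Descent means passing to larger groups: one group is traded for finitely many strictly above it.
    As [ys] may be empty, dropping a group is a descent too. *)
Definition mstep L' L := exists x ys M,
  meq L (x :: M) /\ meq L' (ys ++ M) /\ forall y, In y ys -> subconj x y.
Definition mless := clos_trans _ mstep.

Hypothesis wf_subconj : well_founded (fun K' K : G -> Prop => subconj K K').

Lemma meq_sym L M : meq L M -> meq M L.
Proof. intros h w hw. symmetry. auto. Qed.
Lemma mstep_meq L L' M : meq L L' -> mstep M L -> mstep M L'.
Proof.
  intros h (x & ys & N & a & b & c). exists x, ys, N. split; [|auto].
  intros w hw. rewrite <- (h w hw). auto.
Qed.
Lemma acc_meq L L' : meq L L' -> Acc mstep L -> Acc mstep L'.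
Proof.
  intros h [a]. constructor. intros N hN. apply a. apply (mstep_meq L'); [now apply meq_sym|assumption].
Qed.

(** Nested induction, on the class of [x] outside and on [M] inside. A step either trades a copy of
    [x], and the new groups are added one at a time by the outer hypothesis, or it trades a member
    of [M] and keeps [x]. *)
Lemma acc_cons x : Acc (fun K' K : G -> Prop => subconj K K') x ->
  forall M, Acc mstep M -> Acc mstep (x :: M).
Proof.
  induction 1 as [x _ IH1]. intros M hM. induction hM as [M hM IH2].
  constructor. intros N (x' & ys & M' & e1 & e2 & hy).
  destruct (classic (same x x')) as [s|s].
  - assert (e3 : meq M M').
    { intros w hw. specialize (e1 w hw). simpl in e1. rewrite (hw _ _ s) in e1. lra. }
    assert (hq : Acc mstep (ys ++ M)).
    { assert (hy' : forall y, In y ys -> forall N, Acc mstep N -> Acc mstep (y :: N)).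
      { intros y h. destruct (classic (sub x)) as [hx|hx].
        - apply IH1. apply (subconj_same_l x'); [assumption|now apply same_sym|auto].
        - specialize (hy y h). exfalso. apply hx. destruct hy as (hs & hs').
          destruct s as [[_ c]|[g eg]].
          + destruct hs' as (_ & hf & _). now destruct (c hf).
          + subst x'. rewrite <- (cjK g x). now apply cj_sub. }
      clear - hy' hM. induction ys as [|y ys IH]; simpl.
      - now constructor.
      - apply hy'; [now left|]. apply IH. intros z hz. apply hy'. now right. }
    apply (acc_meq (ys ++ M)); [|assumption].
    intros w hw. rewrite (e2 w hw), !sm_app. now rewrite (e3 w hw).
  - destruct (extract x M') as (M'' & f & _).
    { pose proof (e1 (class_ind x) (ind_clw x)) as h. simpl in h. rewrite ind_self in h.
      assert (class_ind x x' = 0).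
      { unfold class_ind. now destruct (excluded_middle_informative (same x x')). }
      pose proof (ind_ge0 x M). lra. }
    apply (acc_meq (x :: (ys ++ M''))).
    + intros w hw. rewrite (e2 w hw). simpl. rewrite !sm_app, (f w hw). simpl. lra.
    + apply IH2. exists x', ys, M''. split; [|split; [now intros w|assumption]].
      intros w hw. specialize (e1 w hw). specialize (f w hw). simpl in *. lra.
Qed.

Lemma mless_wf : well_founded mless.
Proof.
  apply wf_clos_trans. intros L. induction L as [|x L IH].
  - constructor. intros N (x & ys & M & h & _). exfalso.
    specialize (h _ one_clw). rewrite !sm_one in h. apply INR_eq in h. easy.
  - apply acc_cons; [apply wf_subconj|assumption].
Qed.

(** The members of [X] are spent one at a time, each for those members of [Y] that lie above it; the
    others are left to the rest of [X]. *)
Lemma mless_split X : forall Y Z L L', X <> [] ->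
  (forall y, In y Y -> exists x, In x X /\ subconj x y) ->
  meq L (X ++ Z) -> meq L' (Y ++ Z) -> mless L' L.
Proof.
  induction X as [|x X IH]; intros Y Z L L' hX hY h h'; [easy|].
  assert (HY : exists Y1 Y2, (forall w : (G->Prop)->R, sm w Y = sm w Y1 + sm w Y2) /\
     (forall y, In y Y1 -> subconj x y) /\ forall y, In y Y2 -> exists x', In x' X /\ subconj x' y).
  { clear - hY. induction Y as [|y Y IH].
    - exists [], []. split; [intros; simpl; lra|easy].
    - destruct IH as (Y1 & Y2 & a & b & c); [intros; apply hY; now right|].
      destruct (hY y (or_introl eq_refl)) as (x' & [<-|hx] & hu).
      + exists (y :: Y1), Y2. split; [intros; simpl; rewrite a; lra|split; [|assumption]].
        intros z [<-|]; auto.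
      + exists Y1, (y :: Y2). split; [intros; simpl; rewrite a; lra|split; [assumption|]].
        intros z [<-|]; eauto. }
  destruct HY as (Y1 & Y2 & a & b & c).
  destruct X as [|x' X].
  - destruct Y2 as [|y Y2]; [|now destruct (c y (or_introl eq_refl)) as (? & [] & _)].
    apply t_step. exists x, Y1, Z. split; [exact h|split; [|assumption]].
    intros w hw. rewrite (h' w hw), !sm_app, a. simpl. lra.
  - apply (t_trans _ _ _ (x' :: X ++ Y1 ++ Z)).
    + apply (IH Y2 (Y1 ++ Z)); [easy|assumption|now intros w|].
      intros w hw. rewrite (h' w hw), !sm_app, a. lra.
    + apply t_step. exists x, Y1, (x' :: X ++ Z). split; [|split; [|assumption]].
      * intros w hw. rewrite (h w hw). reflexivity.
      * intros w hw. simpl. rewrite !sm_app. simpl. rewrite sm_app. lra.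
Qed.

(* Equal members of [X] and [Y] are cancelled first; one that occurs in [Y] lies
   above another member of [X], so [X] never runs empty. *)
Lemma mless_multi n : forall X Y L L', (length X <= n)%nat -> X <> [] ->
  (forall y, In y Y -> exists x, In x X /\ subconj x y) ->
  meq (L' ++ X) (L ++ Y) -> mless L' L.
Proof.
  induction n as [|n IH]; intros X Y L L' hn hX hY h.
  { destruct X; [easy|simpl in hn; lia]. }
  destruct (classic (exists x y, In x X /\ In y Y /\ same x y)) as [(x & y & hx & hy & s)|no].
  - destruct (hY y hy) as (x0 & h0 & u0).
    apply in_split in hx, hy. destruct hx as (X1 & X2 & ->), hy as (Y1 & Y2 & ->).
    assert (sx : same y x) by now apply same_sym.
    apply (IH (X1 ++ X2) (Y1 ++ Y2)).
    + rewrite length_app in *. simpl in hn. lia.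
    + intros e. apply app_eq_nil in e. destruct e as [-> ->].
      destruct h0 as [<-|[]]. apply (subconj_not_same _ _ u0). now apply same_sym.
    + intros z hz. destruct (hY z) as (x' & h1 & u).
      { rewrite in_app_iff in *. simpl. tauto. }
      assert (hc : x' = x \/ In x' (X1 ++ X2)).
      { rewrite in_app_iff in *. simpl in h1. intuition. }
      destruct hc as [->|hc]; [|eauto].
      exists x0. split.
      * apply in_app_iff in h0. simpl in h0. apply in_app_iff.
        destruct h0 as [?|[<-|?]]; auto. exfalso. apply (subconj_not_same _ _ u0 s).
      * apply (subconj_trans _ x); [|assumption]. apply (subconj_same_r _ y); [|assumption..].
        apply u.
    + intros w hw. specialize (h w hw). specialize (hw _ _ s). rewrite !sm_app in *.
      simpl in h. lra.
  - assert (H : exists Z, meq L (X ++ Z)).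
    { clear IH hX hY hn. revert L L' h. induction X as [|x X IHX]; intros L L' h.
      - exists L. now intros w.
      - destruct (extract x L) as (L1 & f & _).
        { specialize (h (class_ind x) (ind_clw x)). rewrite !sm_app in h. simpl in h.
          rewrite ind_self in h. pose proof (ind_ge0 x L'). pose proof (ind_ge0 x X).
          destruct (Rle_lt_dec (sm (class_ind x) L) 0) as [c|c]; [|assumption].
          destruct (ind_pos x Y) as (y & hy & s); [lra|].
          exfalso. apply no. exists x, y. simpl. auto. }
        destruct (IHX) with (L := L1) (L' := L') as (Z & hZ).
        + intros (x1 & y & a & b & c). apply no. exists x1, y. simpl. auto.
        + intros w hw. specialize (h w hw). specialize (f w hw).
          rewrite !sm_app in *. simpl in *. lra.
        + exists Z. intros w hw. rewrite (f w hw). simpl. now rewrite (hZ w hw). }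
    destruct H as (Z & hZ). apply (mless_split X Y Z); auto.
    intros w hw. specialize (h w hw). specialize (hZ w hw). rewrite !sm_app in *. lra.
Qed.

Lemma mless_intro X Y L L' : X <> [] -> (forall y, In y Y -> exists x, In x X /\ subconj x y) ->
  meq (L' ++ X) (L ++ Y) -> mless L' L.
Proof. apply (mless_multi (length X)). lia. Qed.
End Order.

(** * Ascending chains of finite subgroups *)

Section Chains.
Context {G : Group}.

(** A group that is not accessible has a successor of the same kind, hence is finite, and the
    successor can be conjugated so as to contain it. The union of the resulting chain is infinite,
    and finitely many of its elements lie in one finite term. *)
Lemma wf_subconj_of_no_locally_finite :
  ~ (exists H : G -> Prop, is_subgroup H /\ ~ finite_set H /\ locally_finite H) ->
  well_founded (fun K' K : G -> Prop => subconj K K').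
Proof.
  intros no K0. apply NNPP. intros n0.
  set (A := fun K : G -> Prop => Acc (fun K' K : G -> Prop => subconj K K') K) in *.
  assert (nx : forall K, ~ A K -> exists K', subconj K K' /\ ~ A K').
  { intros K hK. apply NNPP. intros c. apply hK. constructor. intros K' hu.
    apply NNPP. intros d. apply c. now exists K'. }
  assert (nx2 : forall K, ~ A K -> sub K /\ fin K /\
    exists K', incl K K' /\ (size K < size K')%nat /\ ~ A K').
  { intros K hK. destruct (nx K hK) as (K' & hu & hK').
    destruct (nx K' hK') as (_ & (_ & _ & f' & _) & _).
    destruct hu as (a & b & c & [d|(g & d & e)]); [easy|].
    split; [assumption|split; [assumption|]]. exists (cj (iv g) K').
    rewrite cj_size. split; [now apply cj_incl_iff|split; [assumption|]].
    intros [h]. apply hK'. constructor. intros L hL. apply h.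
    apply (subconj_same_l K'); [now apply cj_sub| |assumption]. right. now exists (iv g). }
  destruct (choice (fun (K K' : {K | ~ A K}) => incl (proj1_sig K) (proj1_sig K') /\
     (size (proj1_sig K) < size (proj1_sig K'))%nat)) as [nxt hn].
  { intros [K hK]. destruct (nx2 K hK) as (_ & _ & K' & a & b & c). now exists (exist _ K' c). }
  set (s := fix s n := match n with 0%nat => exist _ K0 n0 | S n => nxt (s n) end).
  set (k := fun n => proj1_sig (s n)).
  assert (ks : forall n, sub (k n)) by (intros n; apply (nx2 (k n)), (proj2_sig (s n))).
  assert (kf : forall n, fin (k n)) by (intros n; apply (nx2 (k n)), (proj2_sig (s n))).
  assert (km : forall n m x, (n <= m)%nat -> k n x -> k m x).
  { intros n m x h. induction h as [|m h IH]; [auto|]. intros hx. apply (hn (s m)). now apply IH. }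
  assert (kz : forall n, (n <= size (k n))%nat).
  { induction n as [|n IH]; [lia|]. destruct (hn (s n)) as [_ h]. unfold k in *. simpl. lia. }
  apply no. exists (fun x => exists n, k n x). repeat split.
  - exists 0%nat. apply sub1, ks.
  - intros x y [n a] [m b]. exists (n + m)%nat. apply subM; [apply ks|..];
      [apply (km n)|apply (km m)]; auto; lia.
  - intros x [n a]. exists n. apply subV; [apply ks|assumption].
  - intros f. set (H := fun x => exists n, k n x) in *.
    pose proof (kz (S (size H))) as h1.
    assert (size (k (S (size H))) <= size H)%nat; [|lia].
    apply size_le; [|assumption]. intros x hx. now exists (S (size H)).
  - intros l hl.
    assert (hN : exists N, forall y, In y l -> k N y).
    { induction l as [|y l IH]; [now exists 0%nat|].
      destruct IH as [N hN]; [intros; apply hl; now right|].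
      destruct (hl y (or_introl eq_refl)) as [m hm].
      exists (N + m)%nat. intros z [<-|hz]; [apply (km m)|apply (km N)]; auto; lia. }
    destruct hN as [N hN]. apply (fin_incl _ (k N)); [|apply kf].
    intros x hx. apply hx; [apply ks|assumption].
Qed.
End Chains.

Local Close Scope R_scope.

(** * G-sets and trees *)

Record gset (G : Group) := mkgset {
  car :> Type;
  ac : G -> car -> car;
  ac1 : forall x, ac e1 x = x;
  acM : forall g h x, ac (g ** h) x = ac g (ac h x) }.
Arguments mkgset {G}. Arguments ac {G g0} _ _ : simpl never. Arguments ac1 {G}. Arguments acM {G}.

Section Gsets.
Context {G : Group}.

Section One.
Context {A : gset G}.
Implicit Types (x y : A) (g h : G).
Definition stb x : G -> Prop := fun g => ac g x = x.
Definition vorb x y := exists g, y = ac g x.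

Lemma acK g x : ac (iv g) (ac g x) = x.
Proof. now rewrite <- acM, mulVg, ac1. Qed.
Lemma acKV g x : ac g (ac (iv g) x) = x.
Proof. now rewrite <- acM, mulgV, ac1. Qed.
Lemma ac_inj g x y : ac g x = ac g y -> x = y.
Proof. intros h. now rewrite <- (acK g x), h, acK. Qed.
Lemma ac_eq g x y : ac g x = y <-> x = ac (iv g) y.
Proof. split; [intros <-; now rewrite acK|intros ->; now rewrite acKV]. Qed.
Lemma stb_sub x : sub (stb x).
Proof.
  unfold stb. repeat split.
  - apply ac1.
  - intros g h a b. now rewrite acM, b, a.
  - intros g a. rewrite <- a at 1. apply acK.
Qed.
Lemma stb_ac g x : stb (ac g x) = cj g (stb x).
Proof.
  apply pred_ext. intros h. unfold stb, cj. rewrite !acM. split.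
  - intros e. now rewrite e, acK.
  - intros e. now rewrite <- (acKV g (ac h (ac g x))), e.
Qed.
Lemma vorb_equiv : equivalence A vorb.
Proof.
  split.
  - intros x. exists e1. now rewrite ac1.
  - intros x y z [g ->] [h ->]. exists (h ** g). now rewrite acM.
  - intros x y [g ->]. exists (iv g). now rewrite acK.
Qed.
End One.

Definition equi {A B : gset G} (f : A -> B) := forall g x, f (ac g x) = ac g (f x).

Lemma equi_stb {A B : gset G} (f : A -> B) x : equi f -> incl (stb x) (stb (f x)).
Proof. intros h g hg. unfold stb in *. now rewrite <- h, hg. Qed.
End Gsets.

Section Trees.
Context {G : Group} (T : GTree G).
Definition vgs : gset G := mkgset (vert T) (actV T) (actV_1 T) (actV_M T).
Definition egs : gset G := mkgset (edge T) (actE T) (actE_1 T) (actE_M T).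
Implicit Types (u v w t : vgs) (q e : egs) (p : list egs).
Definition og (e : egs) : vgs := orig T e.
Definition tm (e : egs) : vgs := orig T (Defs.rev T e).
Definition rv (e : egs) : egs := Defs.rev T e.

Arguments og : simpl never. Arguments tm : simpl never. Arguments rv : simpl never.
Lemma rvK e : rv (rv e) = e. Proof. apply rev_rev. Qed.
Lemma og_rv e : og (rv e) = tm e. Proof. reflexivity. Qed.
Lemma tm_rv e : tm (rv e) = og e. Proof. unfold tm, rv. now rewrite rev_rev. Qed.
Lemma og_ac (g : G) e : og (ac g e) = ac g (og e). Proof. apply orig_act. Qed.
Lemma rv_ac (g : G) e : rv (ac g e) = ac g (rv e). Proof. apply rev_act. Qed.
Lemma tm_ac (g : G) e : tm (ac g e) = ac g (tm e).
Proof. rewrite <- og_rv, rv_ac, og_ac. reflexivity. Qed.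
Lemma noinv (g : G) e : ac g e <> rv e. Proof. apply no_inversion. Qed.

Fixpoint tpath u p v : Prop :=
  match p with [] => u = v | e :: p' => og e = u /\ tpath (tm e) p' v end.
Fixpoint tred p : Prop :=
  match p with e :: ((e' :: _) as p') => e' <> rv e /\ tred p' | _ => True end.

Lemma t_conn u v : exists p, tpath u p v.
Proof. exact (proj1 (is_tree T) u v). Qed.
Lemma t_acyc v p : tpath v p v -> tred p -> p = [].
Proof. exact (proj2 (is_tree T) v p). Qed.

Lemma tred_tl e p : tred (e :: p) -> tred p.
Proof. destruct p; simpl; tauto. Qed.
Lemma tred_cons e p : tred p -> (forall p', p <> rv e :: p') -> tred (e :: p).
Proof. destruct p as [|e' p]; simpl; auto. intros h n. split; [|assumption]. intros ->. now apply (n p). Qed.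
Lemma tpath_app u p v p' w : tpath u p v -> tpath v p' w -> tpath u (p ++ p') w.
Proof. revert u. induction p as [|e p IH]; simpl; [now intros u ->|]. intros u [a b] c. auto. Qed.
Lemma tred_join p x y p' : tred (p ++ [x]) -> tred (y :: p') -> y <> rv x ->
  tred (p ++ x :: y :: p').
Proof.
  induction p as [|e p IH]; intros a b c; [split; auto|].
  destruct p as [|e' p]; simpl in *; [tauto|]. split; [tauto|]. apply IH; tauto.
Qed.
Lemma t_conn_red u v : exists p, tpath u p v /\ tred p.
Proof.
  destruct (t_conn u v) as [p hp]. revert u hp. induction p as [|e p IH]; intros u hp.
  - now exists [].
  - destruct hp as [h1 h2]. destruct (IH _ h2) as (p' & a & b).
    destruct p' as [|e' p']; [exists [e]; simpl; auto|].
    destruct (classic (e' = rv e)) as [->|n].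
    + exists p'. simpl in a. rewrite tm_rv, h1 in a. split; [apply a|now apply tred_tl in b].
    + exists (e :: e' :: p'). simpl in *. auto.
Qed.

Definition rpath p := map rv (List.rev p).
Lemma rpath_cons e p : rpath (e :: p) = rpath p ++ [rv e].
Proof. unfold rpath. simpl. now rewrite map_app. Qed.
Lemma rpath_path u p v : tpath u p v -> tpath v (rpath p) u.
Proof.
  revert u. induction p as [|e p IH]; simpl; intros u; [now intros ->|].
  intros [a b]. rewrite rpath_cons. apply (tpath_app _ _ (tm e)); [auto|].
  simpl. rewrite tm_rv. auto.
Qed.
Lemma rpath_red p : tred p -> tred (rpath p).
Proof.
  induction p as [|e p IH]; [easy|]. intros h. rewrite rpath_cons.
  pose proof (IH (tred_tl _ _ h)) as k. destruct p as [|e' p]; [easy|].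
  rewrite rpath_cons in *. rewrite <- app_assoc. apply tred_join; simpl; auto.
  destruct h as [h _]. rewrite rvK. intros c. apply h. now rewrite c.
Qed.
Lemma length_rpath p : length (rpath p) = length p.
Proof. unfold rpath. now rewrite length_map, length_rev. Qed.

Lemma tred_uniq p : forall u v p', tpath u p v -> tpath u p' v -> tred p -> tred p' -> p = p'.
Proof.
  induction p as [|e p IH]; intros u v p' a a' b b'.
  - simpl in a. subst v. symmetry. eapply t_acyc; eauto.
  - destruct p' as [|e' p'].
    + simpl in a'. subst v. eapply t_acyc; eauto.
    + destruct (classic (e = e')) as [<-|n].
      * f_equal. destruct a, a'. apply (IH (tm e) v); auto; eapply tred_tl; eauto.
      * exfalso. assert (c : rpath (e :: p) ++ e' :: p' = []).
        { apply (t_acyc v).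
          - apply (tpath_app _ _ u); [now apply rpath_path|assumption].
          - apply rpath_red in b. rewrite rpath_cons in *. rewrite <- app_assoc.
            apply tred_join; auto. rewrite rvK. congruence. }
        apply app_eq_nil in c. now destruct c.
Qed.

Definition gp u v : list egs := epsilon (inhabits []) (fun p => tpath u p v /\ tred p).
Lemma gp_spec u v : tpath u (gp u v) v /\ tred (gp u v).
Proof. unfold gp. apply epsilon_spec, t_conn_red. Qed.
Lemma gp_uniq u p v : tpath u p v -> tred p -> gp u v = p.
Proof. intros a b. destruct (gp_spec u v). eapply tred_uniq; eauto. Qed.

Lemma gp_refl u : gp u u = []. Proof. now apply gp_uniq. Qed.
Lemma gp_nil u v : gp u v = [] <-> u = v.
Proof.
  split; [|intros ->; apply gp_refl]. intros h. destruct (gp_spec u v) as [a _].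
  now rewrite h in a.
Qed.
Lemma gp_rev u v : gp v u = rpath (gp u v).
Proof. destruct (gp_spec u v). apply gp_uniq; [now apply rpath_path|now apply rpath_red]. Qed.
Lemma gp_ac (g : G) u v : gp (ac g u) (ac g v) = map (ac g) (gp u v).
Proof.
  destruct (gp_spec u v) as [a b]. generalize dependent (gp u v). intros p a b. apply gp_uniq.
  - revert u a b. induction p as [|e p IH]; simpl; intros w a b; [now subst|].
    rewrite og_ac, tm_ac. destruct a as [-> a]. split; [reflexivity|].
    apply IH; [assumption|now apply tred_tl in b].
  - clear a. induction p as [|e p IH]; simpl; [easy|].
    specialize (IH (tred_tl _ _ b)). destruct p as [|e' p]; simpl in *; [easy|].
    split; [|assumption]. rewrite rv_ac. intros c. apply (ac_inj (A := egs)) in c. now apply b.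
Qed.
Lemma gp_cons u v q p : gp u v = q :: p -> og q = u /\ gp (tm q) v = p.
Proof.
  intros h. destruct (gp_spec u v) as [a b]. rewrite h in *. destruct a as [a c].
  split; [assumption|]. apply gp_uniq; [assumption|now apply tred_tl in b].
Qed.
Lemma gp_edge q : gp (og q) (tm q) = [q].
Proof. apply gp_uniq; simpl; auto. Qed.
Lemma map_fix {A} (f : A -> A) l : map f l = l -> forall x, In x l -> f x = x.
Proof.
  induction l as [|a l IH]; simpl; [easy|]. intros h. injection h as h1 h2.
  intros x [<-|hx]; auto.
Qed.
Lemma gp_fix (g : G) u v q : ac g u = u -> ac g v = v -> In q (gp u v) -> ac g q = q.
Proof. intros a b. apply map_fix. now rewrite <- gp_ac, a, b. Qed.
Lemma edge_fix (g : G) q : ac g q = q -> ac g (og q) = og q /\ ac g (tm q) = tm q.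
Proof. intros h. now rewrite <- og_ac, <- tm_ac, h. Qed.

Definition tdist u v := length (gp u v).
Definition tconvex (C : vgs -> Prop) := forall u v q, C u -> C v -> In q (gp u v) -> C (tm q).

(** Convexity of the distance to [t]. If the reduced path from [tm q] to [t] starts back along
    [rv q], it extends the path coming from [v] without backtracking; if not, it extends the edge
    [q] coming from [u]. *)
Lemma tdist_lt u v q q' p t : gp u v = q :: q' :: p ->
  tdist (tm q) t < tdist u t \/ tdist (tm q) t < tdist v t.
Proof.
  intros h. destruct (gp_spec u v) as [hp hr]. rewrite h in hp, hr.
  destruct (gp_cons _ _ _ _ h) as [hq h']. destruct (gp_cons _ _ _ _ h') as [_ h''].
  destruct (gp_spec (tm q) t) as [kp kr].
  destruct (classic (exists p', gp (tm q) t = rv q :: p')) as [[p' e]|n].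
  - right. unfold tdist.
    assert (E : gp v t = rpath (q' :: p) ++ gp (tm q) t).
    { apply gp_uniq.
      - apply (tpath_app _ _ (tm q)); [|assumption]. apply rpath_path. apply hp.
      - rewrite rpath_cons, e, <- app_assoc. simpl.
        apply tred_join.
        + rewrite <- rpath_cons. apply rpath_red. now apply tred_tl in hr.
        + now rewrite <- e.
        + rewrite rvK. intros c. destruct hr as [hr _]. now apply hr. }
    rewrite E, length_app, length_rpath. simpl. lia.
  - left. unfold tdist. assert (E : gp u t = q :: gp (tm q) t).
    { apply gp_uniq; [split; assumption|]. apply tred_cons; [assumption|].
      intros p' c. apply n. now exists p'. }
    rewrite E. simpl. lia.
Qed.

(* Minimisers in [C] of the largest distance to a fixed [B]-orbit are at distance at
   most one from each other, so without inversions they are fixed by [B]. *)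
Lemma finite_fixes (B : G -> Prop) (C : vgs -> Prop) :
  sub B -> fin B -> (exists u, C u) -> tconvex C ->
  (forall b u, B b -> C u -> C (ac b u)) -> exists u, C u /\ incl B (stb u).
Proof.
  intros hB [l hl] [s0 hs0] hC hBC.
  set (M := fun n s => C s /\ forall b, B b -> tdist s (ac b s0) <= n).
  destruct (least (fun n => exists s, M n s)) as (n & (s & hs) & hmin).
  { assert (H : exists n, forall b, In b l -> tdist s0 (ac b s0) <= n).
    { clear hl. induction l as [|a l [n IH]]; [now exists 0|].
      exists (tdist s0 (ac a s0) + n). intros b [<-|hb]; [lia|]. specialize (IH b hb). lia. }
    destruct H as [n H]. exists n, s0. split; auto. }
  assert (hM : forall b u, B b -> M n u -> M n (ac b u)).
  { intros b u hb [h1 h2]. split; [auto|]. intros b' hb'.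
    unfold tdist. rewrite <- (acKV b (ac b' s0)), gp_ac, length_map, <- acM.
    apply h2. apply subM; auto. now apply subV. }
  assert (hd : forall u v, M n u -> M n v -> tdist u v <= 1).
  { intros u v [u1 u2] [v1 v2]. unfold tdist. destruct (gp u v) as [|q [|q' p]] eqn:e; simpl; auto.
    exfalso. assert (h : M (n - 1) (tm q)).
    { split.
      - apply (hC u v); auto. rewrite e. now left.
      - intros b hb. specialize (u2 b hb). specialize (v2 b hb).
        destruct (tdist_lt _ _ _ _ _ (ac b s0) e); lia. }
    assert (n <= n - 1) by (apply hmin; now exists (tm q)).
    specialize (u2 e1 (sub1 _ hB)). specialize (v2 e1 (sub1 _ hB)).
    destruct (tdist_lt _ _ _ _ _ (ac e1 s0) e); lia. }
  (* If [b] moved [s], it would be across one edge [q]. Since [b] does not send [q] to its reverse,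
     [q] followed by [ac b q] is reduced, so applying [b] twice moves [s] by two, against [hd]. *)
  exists s. split; [apply hs|]. intros b hb. unfold stb. apply NNPP. intros ne.
  pose proof (hd _ _ hs (hM b s hb hs)) as h1.
  pose proof (hd _ _ hs (hM b _ hb (hM b s hb hs))) as h2.
  unfold tdist in *. destruct (gp s (ac b s)) as [|q [|q' p]] eqn:e; simpl in h1; try lia.
  { apply gp_nil in e. congruence. }
  destruct (gp_spec s (ac b s)) as [hp _]. rewrite e in hp. destruct hp as [hp1 hp2].
  simpl in hp2.
  assert (E : gp s (ac b (ac b s)) = [q; ac b q]).
  { apply gp_uniq; simpl.
    - rewrite og_ac, tm_ac, hp1, hp2. auto.
    - split; [apply noinv|exact I]. }
  rewrite E in h2. simpl in h2. lia.
Qed.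
End Trees.

(** * Walks, arcs and parent choices *)

Inductive wk {A : Type} (R : A -> A -> Prop) : A -> A -> Prop :=
| wk0 x : wk R x x
| wkS x y z : R x y -> wk R y z -> wk R x z.
Arguments wk0 {A R} x. Arguments wkS {A R} x y z.

Definition rs {A : Type} (R : A -> A -> Prop) (P : A -> Prop) (a b : A) := R a b /\ P a /\ P b.

Lemma wk_trans {A} (R : A -> A -> Prop) x y z : wk R x y -> wk R y z -> wk R x z.
Proof. induction 1; [auto|]. intros k. apply (wkS x y z); auto. Qed.

Section Walks.
Context {A : Type}.
Implicit Types (R S : A -> A -> Prop) (P : A -> Prop).
Lemma wk1 R x y : R x y -> wk R x y.
Proof. intros h. apply (wkS x y y h), wk0. Qed.
Lemma wk_map {B} R (S : B -> B -> Prop) (f : A -> B) x y :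
  (forall a b, R a b -> wk S (f a) (f b)) -> wk R x y -> wk S (f x) (f y).
Proof. intros h. induction 1 as [|x y z a _ IH]; [apply wk0|]. apply (wk_trans _ _ (f y)); auto. Qed.
Lemma wk_mono R S x y : (forall a b, R a b -> S a b) -> wk R x y -> wk S x y.
Proof. intros h. apply (wk_map R S (fun a => a)). intros; apply wk1; auto. Qed.
Lemma wk_sym R x y : (forall a b, R a b -> R b a) -> wk R x y -> wk R y x.
Proof. intros h. induction 1 as [|x y z a _ IH]; [apply wk0|]. apply (wk_trans _ _ y); [assumption|]. apply wk1; auto. Qed.
Lemma wk_pres R P x y : (forall a b, R a b -> P a -> P b) -> wk R x y -> P x -> P y.
Proof. intros h. induction 1; eauto. Qed.
Lemma wk_rs_sym R P x y : (forall a b, R a b -> R b a) -> wk (rs R P) x y -> wk (rs R P) y x.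
Proof. intros h. apply wk_sym. intros a b (p & q & r). split; [auto|now split]. Qed.
Lemma wk_cases R x z : wk R x z -> x = z \/ exists y, R x y /\ wk R y z.
Proof. destruct 1; eauto. Qed.
Lemma wk_in R P x y : wk (rs R P) x y -> P x -> P y.
Proof. apply wk_pres. now intros a b (_ & _ & h). Qed.

Fixpoint wkn R n x z : Prop :=
  match n with 0 => x = z | S n => exists y, R x y /\ wkn R n y z end.
Lemma wk_wkn R x z : wk R x z -> exists n, wkn R n x z.
Proof.
  induction 1 as [x|x y z h _ [n IH]]; [now exists 0|]. exists (S n). simpl. eauto.
Qed.
End Walks.

Definition cap {A : Type} (K L : A -> Prop) : A -> Prop := fun g => K g /\ L g.

Lemma cap_comm {A} (K L : A -> Prop) : cap K L = cap L K.
Proof. apply pred_ext. unfold cap. tauto. Qed.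
Lemma cap_l {A} (K L : A -> Prop) : incl K L -> cap K L = K.
Proof. intros h. apply pred_ext. unfold cap. intros x. split; [tauto|auto]. Qed.

Section Arcs.
Context {G : Group} {A : gset G}.
Implicit Types (x y a b : A) (g h : G).

Definition ar x y a b := exists g, (a = ac g x /\ b = ac g y) \/ (a = ac g y /\ b = ac g x).
Definition aorb (e e' : A * A) := ar (fst e) (snd e) (fst e') (snd e').
(** The pointwise stabilizer of an arc: elements exchanging its ends are left out, so inverted arcs
    need no separate treatment. *)
Definition est (e : A * A) : G -> Prop := cap (stb (fst e)) (stb (snd e)).

Lemma ar_refl x y : ar x y x y.
Proof. exists e1. rewrite !ac1. auto. Qed.
Lemma ar_flip x y a b : ar x y a b -> ar x y b a.
Proof. intros [g [[]|[]]]; exists g; auto. Qed.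
Lemma ar_ac g x y a b : ar x y a b -> ar x y (ac g a) (ac g b).
Proof. intros [h [[-> ->]|[-> ->]]]; exists (g ** h); rewrite !acM; auto. Qed.
Lemma ar_sym x y a b : ar x y a b -> ar a b x y.
Proof. intros [g [[-> ->]|[-> ->]]]; exists (iv g); rewrite !acK; auto. Qed.
Lemma ar_trans x y a b c d : ar x y a b -> ar a b c d -> ar x y c d.
Proof.
  intros h [g [[-> ->]|[-> ->]]].
  - now apply ar_ac.
  - now apply ar_ac, ar_flip.
Qed.
Lemma aorb_equiv : equivalence (A * A) aorb.
Proof.
  split.
  - intros [x y]. apply ar_refl.
  - intros [x y] [z t] [u v]. apply ar_trans.
  - intros [x y] [z t]. apply ar_sym.
Qed.
Lemma est_sub e : sub (est e).
Proof. apply sub_cap; apply stb_sub. Qed.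
Lemma est_ac g x y : est (ac g x, ac g y) = cj g (est (x, y)).
Proof. unfold est. simpl. now rewrite !stb_ac. Qed.
Lemma est_flip x y : est (x, y) = est (y, x).
Proof. apply cap_comm. Qed.
Lemma ar_same x y a b : ar x y a b -> exists g, est (a, b) = cj g (est (x, y)).
Proof.
  intros [g [[-> ->]|[-> ->]]]; exists g; [|rewrite (est_flip x y)]; apply est_ac.
Qed.
Lemma est_finv w : clw w -> finv aorb (fun e => w (est e)).
Proof.
  intros hw [x y] [a b] h. destruct (ar_same _ _ _ _ h) as [g e]. apply hw. right. now exists g.
Qed.
Lemma stb_finv w : clw w -> finv (@vorb G A) (fun x => w (stb x)).
Proof. intros hw x y [g ->]. apply hw. right. exists g. apply stb_ac. Qed.
Lemma inv_ac (P : A -> Prop) : (forall g x, P x -> P (ac g x)) -> inv vorb P.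
Proof. intros h x y [g ->]. apply h. Qed.
Lemma inv_aorb (P : A -> A -> Prop) : (forall g x y, P x y -> P (ac g x) (ac g y)) ->
  (forall x y, P x y -> P y x) -> inv aorb (fun e => P (fst e) (snd e)).
Proof. intros h k [x y] [a b] [g [[e e']|[e e']]]; simpl in *; subst; auto. Qed.
End Arcs.

Lemma orbit_rep {G : Group} (A : gset G) : exists (rp : A -> A) (mv : A -> G),
  (forall x, x = ac (mv x) (rp x)) /\ forall g x, rp (ac g x) = rp x.
Proof.
  set (rp := fun x : A => epsilon (inhabits x) (fun y => vorb x y)).
  destruct (choice (fun (x : A) g => x = ac g (rp x))) as [mv hmv].
  { intros x. destruct (epsilon_spec (inhabits x) (fun y => vorb x y)) as [g hg].
    - exists x. apply vorb_equiv.
    - exists (iv g). unfold rp. now rewrite hg, acK. }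
  exists rp, mv. split; [assumption|]. intros g x. unfold rp.
  assert (E : (fun y => vorb (ac g x) y) = (fun y => vorb x y)).
  { apply pred_ext. intros y. pose proof (@vorb_equiv G A) as [e1 e2 e3].
    assert (v : vorb x (ac g x)) by now exists g.
    split; intros k; [apply (e2 _ _ _ v k)|apply (e2 _ x); auto]. }
  rewrite E. f_equal. apply proof_irrelevance.
Qed.

(* Choosing a neighbour one step closer to [Z] for every point of [dom]: the arcs
   [(x, sg x)] lie in pairwise different orbits for [x] in different orbits. *)
Section Select.
Context {G : Group} {A : gset G} (D : A -> A -> Prop) (dom Z : A -> Prop).
Hypothesis Dac : forall g x y, D x y -> D (ac g x) (ac g y).
Hypothesis domac : forall g x, dom x -> dom (ac g x).
Hypothesis Zac : forall g x, Z x -> Z (ac g x).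
Hypothesis reach : forall x, dom x -> exists z, Z z /\ wk (fun a b => D a b /\ dom b) x z.

(** [ht] counts the steps left to [Z]. The stabilizer of [x] may move the chosen neighbour, so [sg]
    can only be equivariant up to an element [k] with the same effect on [x]; this suffices to make
    the orbit of the arc [(x, sg x)] depend on that of [x] alone. *)
Definition selects (sg : A -> A) (ht : A -> nat) :=
  (forall x, dom x -> ~ Z x -> D x (sg x) /\ dom (sg x) /\ ht x = S (ht (sg x))) /\
  (forall g x, ht (ac g x) = ht x) /\
  (forall g x, exists k, ac k x = ac g x /\ sg (ac g x) = ac k (sg x)).

Lemma select : exists sg ht, selects sg ht.
Proof.
  set (S1 := fun a b => D a b /\ dom b).
  set (P := fun x n => exists z, Z z /\ wkn S1 n x z).
  assert (Sac : forall g n x z, wkn S1 n x z -> wkn S1 n (ac g x) (ac g z)).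
  { intros g n. induction n as [|n IH]; simpl; intros x z; [now intros ->|].
    intros (y & [a b] & c). exists (ac g y). split; [|auto]. split; auto. }
  assert (Pac : forall g x, P (ac g x) = P x).
  { assert (h : forall g x n, P x n -> P (ac g x) n).
    { intros g x n (z & a & b). exists (ac g z). auto. }
    intros g x. apply pred_ext. intros n. split; [|apply h].
    intros k. apply (h (iv g)) in k. now rewrite acK in k. }
  set (ht := fun x => epsilon (inhabits 0) (fun n => P x n /\ forall m, P x m -> n <= m)).
  assert (hts : forall x, dom x -> P x (ht x) /\ forall m, P x m -> ht x <= m).
  { intros x hx. apply epsilon_spec, least. destruct (reach x hx) as (z & a & b).
    destruct (wk_wkn _ _ _ b) as [n hn]. exists n, z. auto. }
  assert (nxt : forall x, dom x -> ~ Z x -> exists y, D x y /\ dom y /\ ht x = S (ht y)).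
  { intros x hx hz. destruct (hts x hx) as ((z & a & b) & c).
    destruct (ht x) as [|n] eqn:e; [simpl in b; now subst|].
    destruct b as (y & [d1 d2] & d3). exists y. split; [assumption|split; [assumption|]].
    f_equal. destruct (hts y d2) as ((z' & a' & b') & c').
    assert (ht y <= n) by (apply c'; now exists z).
    assert (S n <= S (ht y)); [|lia]. apply c. exists z'. split; [assumption|]. simpl. exists y. split; [split|]; auto. }
  destruct (orbit_rep A) as (rp & mv & hmv & rpac).
  assert (rps : forall x, rp x = ac (iv (mv x)) x).
  { intros x. apply ac_eq. symmetry. apply hmv. }
  set (sg0 := fun y => epsilon (inhabits y) (fun z => D y z /\ dom z /\ ht y = S (ht z))).
  assert (htac : forall g x, ht (ac g x) = ht x) by (intros; unfold ht; now rewrite Pac).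
  exists (fun x => ac (mv x) (sg0 (rp x))), ht. split; [|split; [assumption|]].
  - intros x hx hz. assert (hr : dom (rp x)) by (rewrite rps; auto).
    assert (hr' : ~ Z (rp x)).
    { intros c. apply hz. rewrite (hmv x). auto. }
    destruct (epsilon_spec (inhabits (rp x)) _ (nxt _ hr hr')) as (a & b & c).
    fold (sg0 (rp x)) in a, b, c. rewrite htac. split; [|split; [auto|]].
    + rewrite (hmv x) at 1. auto.
    + rewrite <- c, <- (htac (mv x) (rp x)). now rewrite <- hmv.
  - intros g x. exists (mv (ac g x) ** iv (mv x)). rewrite !acM. split.
    + rewrite <- rps, <- (rpac g x). symmetry. apply hmv.
    + now rewrite acK, rpac.
Qed.
End Select.

Section Selected.
Context {G : Group} {A : gset G} (D : A -> A -> Prop) (dom Z : A -> Prop).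
Hypothesis domac : forall g x, dom x -> dom (ac g x).
Hypothesis Zac : forall g x, Z x -> Z (ac g x).
Context (sg : A -> A) (ht : A -> nat) (HS : selects D dom Z sg ht).

Definition tarc (e : A * A) := exists x, dom x /\ ~ Z x /\ ar x (sg x) (fst e) (snd e).

Lemma tarc_flip a b : tarc (a, b) -> tarc (b, a).
Proof. intros (z & p & q & r). exists z. repeat split; auto. now apply ar_flip. Qed.
Lemma tarc_inv : inv aorb tarc.
Proof.
  intros e e' h (x & p & q & r). exists x. split; [assumption|split; [assumption|]].
  exact (ar_trans _ _ _ _ _ _ r h).
Qed.

Lemma notZac g x : ~ Z x -> ~ Z (ac g x).
Proof. intros h k. apply h. rewrite <- (acK g x). auto. Qed.

Lemma tarc_char a b : tarc (a, b) ->
  (dom a /\ ~ Z a /\ exists k, ac k a = a /\ b = ac k (sg a)) \/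
  (dom b /\ ~ Z b /\ exists k, ac k b = b /\ a = ac k (sg b)).
Proof.
  assert (H : forall g x, exists k, ac k (ac g x) = ac g x /\ ac g (sg x) = ac k (sg (ac g x))).
  { intros g x. destruct HS as (_ & _ & h). destruct (h g x) as (k & e & e').
    exists (g ** iv k). rewrite e', <- e, !acM, !acK. auto. }
  intros (x & hx & hz & g & [[ha hb]|[ha hb]]); simpl in *; subst.
  - left. split; [auto|split; [now apply notZac|]]. apply H.
  - right. split; [auto|split; [now apply notZac|]]. apply H.
Qed.

(** No arc is chosen from both of its ends, because the invariant height drops by one along every
    choice. *)
Lemma sel_vorb x y : dom x -> ~ Z x -> dom y -> ~ Z y ->
  (vorb x y <-> aorb (x, sg x) (y, sg y)).
Proof.
  intros hx zx hy zy. destruct HS as (h1 & h2 & h3). split.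
  - intros [g ->]. destruct (h3 g x) as (k & e & ->). exists k. left. simpl. auto.
  - intros [g [[e _]|[e e']]]; simpl in *; [now exists g|]. exfalso.
    destruct (h1 x hx zx) as (_ & _ & a). destruct (h1 y hy zy) as (_ & _ & b).
    rewrite e', e, !h2 in b. lia.
Qed.

Lemma tarc_sum F : finv aorb F -> ofin (@vorb G A) (fun _ => True) ->
  osum aorb tarc F = osum vorb (fun x => dom x /\ ~ Z x) (fun x => F (x, sg x)).
Proof.
  intros hF hf. symmetry.
  apply (osum_map vorb aorb vorb_equiv aorb_equiv _ _ (fun x => (x, sg x))); auto.
  - apply inv_ac. intros g x [a b]. split; [auto|now apply notZac].
  - now apply (ofin_sub vorb _ (fun _ => True)).
  - intros x y [a b] [c d]. now apply sel_vorb.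
  - intros e. split.
    + intros (x & a & b & c). exists x. auto.
    + intros (x & [a b] & c). exists x. auto.
Qed.

Hypothesis dead : forall x, dom x -> ~ Z x -> incl (stb x) (stb (sg x)).

(** Once [stb x] fixes the chosen neighbour, the ambiguity [k] in [selects] has no effect. *)
Lemma sg_ac g x : dom x -> ~ Z x -> sg (ac g x) = ac g (sg x).
Proof.
  intros hx hz. destruct HS as (_ & _ & h3). destruct (h3 g x) as (k & e & ->).
  assert (h : stb x (iv g ** k)) by (unfold stb; now rewrite acM, e, acK).
  apply (dead x hx hz) in h. unfold stb in h. rewrite acM in h.
  symmetry in h. apply (proj2 (ac_eq g _ _)) in h. now symmetry.
Qed.

Lemma tarc_dead a b : tarc (a, b) ->
  (dom a /\ ~ Z a /\ b = sg a) \/ (dom b /\ ~ Z b /\ a = sg b).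
Proof.
  intros h. destruct (tarc_char _ _ h) as [(p & q & k & e & ->)|(p & q & k & e & ->)];
    [left|right]; (split; [assumption|split; [assumption|]]).
  - apply (dead a p q) in e. apply e.
  - apply (dead b p q) in e. apply e.
Qed.
End Selected.

(** * Graphs and their cost *)

(* [rt] is the set of roots; arcs are pairs [(x, y)] up to translation and reversal
   ([aorb]), may have infinite stabilizers, and may be inverted. *)
Record gr (G : Group) := mkgr {
  gX :> gset G;
  adj : gX -> gX -> Prop;
  rt : gX -> Prop;
  adj_sym : forall x y, adj x y -> adj y x;
  adj_irr : forall x, ~ adj x x;
  adj_ac : forall g x y, adj x y -> adj (ac g x) (ac g y);
  rt_ac : forall g x, rt x -> rt (ac g x);
  vfin : ofin (@vorb G gX) (fun _ => True);
  efin : ofin (@aorb G gX) (fun e => adj (fst e) (snd e));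
  ginh : inhabited gX }.
Arguments mkgr {G}. Arguments adj {G g0}. Arguments rt {G g0}.

Section Graphs.
Context {G : Group}.
(* In the end, [KK K] says that [K] is elliptic in every tree. *)
Context (KK : (G -> Prop) -> Prop).
Implicit Types Y : gr G.

Definition dead {Y} (x y : Y) := adj x y /\ incl (stb x) (stb y).
Definition toroot {Y} (x : Y) := exists z, rt z /\ wk dead x z.
Definition good Y := (forall x y : Y, wk adj x y) /\ (forall x : Y, toroot x) /\
  forall x : Y, KK (stb x).

Definition adjE Y : Y * Y -> Prop := fun e => adj (fst e) (snd e).
Definition esum Y (P : Y * Y -> Prop) w := osum aorb P (fun e => w (est e)).
Definition vsum Y (P : Y -> Prop) w := osum vorb P (fun x => w (stb x)).
Definition nroots Y := osum vorb (@rt G Y) (fun _ => 1%R).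

(* [L] is what remains of the arc groups once the group of each nonroot vertex is cancelled
   with that of its first dead arc, counted up to [same]. *)
Definition costeq Y (L : list (G -> Prop)) := forall w, clw w ->
  (esum Y (adjE Y) w = vsum Y (fun x => ~ rt x) w + sm w L)%R.

Lemma dead_ac Y g (x y : Y) : dead x y -> dead (ac g x) (ac g y).
Proof. intros [a b]. split; [now apply adj_ac|]. rewrite !stb_ac. now apply cj_incl. Qed.
Lemma nrt_ac Y g (x : Y) : ~ rt x -> ~ rt (ac g x).
Proof. intros h k. apply h. rewrite <- (acK g x). now apply rt_ac. Qed.
Lemma vfin_sub Y (P : Y -> Prop) : ofin vorb P.
Proof. now apply (ofin_sub vorb _ (fun _ => True)), vfin. Qed.
Lemma efin_sub Y (P : Y * Y -> Prop) : (forall e, P e -> adjE Y e) -> ofin aorb P.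
Proof. intros h. apply (ofin_sub aorb _ (adjE Y) h), efin. Qed.
Lemma adjE_inv Y : inv aorb (adjE Y).
Proof. apply inv_aorb; [apply adj_ac|apply adj_sym]. Qed.

Lemma parents Y : good Y -> exists sg ht,
  selects (@dead Y) (fun _ => True) rt sg ht.
Proof.
  intros (_ & h & _). apply select; [apply dead_ac|auto|apply rt_ac|].
  intros x _. destruct (h x) as (z & a & b). exists z. split; [assumption|].
  apply (wk_mono dead); auto.
Qed.

(** Each orbit of nonroots owns one orbit of parent arcs, and a parent arc, being dead, has the
    whole vertex group; these terms cancel and the unmatched arcs are left. *)
Lemma parents_links Y sg ht : selects (@dead Y) (fun _ => True) rt sg ht ->
  forall w, clw w -> (esum Y (adjE Y) w = vsum Y (fun x => ~ rt x) w +
    esum Y (fun e => adjE Y e /\ ~ tarc (fun _ => True) rt sg e) w)%R.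
Proof.
  intros HS w hw. unfold esum at 1.
  pose proof (tarc_inv (fun _ : Y => True) rt sg) as ti.
  rewrite (osum_split aorb aorb_equiv (adjE Y) (tarc (fun _ => True) rt sg));
    [|now apply est_finv|apply adjE_inv|exact ti|now apply efin_sub].
  f_equal.
  transitivity (osum aorb (tarc (fun _ => True) rt sg) (fun e => w (est e))).
  - apply osum_ext; [apply aorb_equiv| | |now apply efin_sub|auto].
    + intros e. split; [tauto|]. intros h. split; [|assumption].
      destruct h as (x & _ & hz & hx). destruct HS as (h1 & _). destruct (h1 x I hz) as ([k _] & _).
      apply (adjE_inv Y (x, sg x) e hx k).
    + apply inv_and; [apply adjE_inv|assumption].
  - rewrite (tarc_sum dead) with (ht := ht); auto; [|apply rt_ac|now apply est_finv|apply vfin].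
    apply osum_ext; [apply vorb_equiv|tauto| |apply vfin_sub|].
    + apply inv_ac. intros g x [_ h]. split; [auto|now apply nrt_ac].
    + intros x [_ h]. unfold est. simpl. f_equal. apply cap_l.
      destruct HS as (h1 & _). apply (h1 x I h).
Qed.
End Graphs.

Section Costs.
Context {G : Group} (KK : (G -> Prop) -> Prop).
Implicit Types Y : gr G.
Local Notation good := (good KK).

Lemma links_list Y sg ht : selects (@dead G Y) (fun _ => True) rt sg ht ->
  exists l, reps aorb (fun e => adjE Y e /\ ~ tarc (fun _ => True) rt sg e) l /\
    costeq Y (map est l).
Proof.
  intros HS.
  destruct (osum_list aorb aorb_equiv (fun e => adjE Y e /\ ~ tarc (fun _ => True) rt sg e))
    as (l & a & b).
  - apply inv_and; [apply adjE_inv|].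
    apply (inv_not _ aorb_equiv), tarc_inv.
  - apply efin_sub. tauto.
  - exists l. split; [assumption|]. intros w hw. rewrite (parents_links _ _ _ HS w hw).
    unfold esum at 1. now rewrite b, sm_map.
Qed.

Lemma cost_ex Y : good Y -> exists L, costeq Y L.
Proof.
  intros h. destruct (parents KK Y h) as (sg & ht & hs).
  destruct (links_list _ _ _ hs) as (l & _ & e). eauto.
Qed.

Section SetAdj.
Context (Y : gr G) (a' : Y -> Y -> Prop).
Hypothesis hs : forall a b, a' a b -> a' b a.
Hypothesis hi : forall a, ~ a' a a.
Hypothesis ha : forall g a b, a' a b -> a' (ac g a) (ac g b).
Hypothesis hf : ofin (@aorb G Y) (fun e => a' (fst e) (snd e)).
Definition setadj : gr G := mkgr Y a' rt hs hi ha (rt_ac G Y) (vfin G Y) hf (ginh G Y).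

Context (x y : Y).
Hypothesis hO : forall a b, adj a b -> ~ ar x y a b -> a' a b.

Lemma setadj_conn : wk a' x y -> forall u v, wk adj u v -> wk a' u v.
Proof.
  intros h u v. apply (wk_map _ _ (fun a : Y => a)). intros a b hab.
  destruct (classic (ar x y a b)) as [[g hg]|n]; [|apply wk1; auto].
  assert (k : wk a' (ac g x) (ac g y)).
  { apply (wk_map a' _ (ac g)); [|assumption]. intros; apply wk1; auto. }
  destruct hg as [[-> ->]|[-> ->]]; [assumption|]. now apply wk_sym.
Qed.

Hypothesis wf_subconj : well_founded (fun K' K : G -> Prop => subconj K K').

(* Downward induction on the stabilizer: along a path fixed by [K], a vertex with
   stabilizer [K] can take a dead step, the others are covered by induction. *)
Lemma dead_replace : fin (est (x, y)) ->
  wk (rs a' (fun v => incl (est (x, y)) (stb v))) x y ->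
  (forall v : Y, toroot v) -> forall v : setadj, toroot v.
Proof.
  intros hfin hw hr.
  enough (H : forall K : G -> Prop, sub K -> forall v : setadj, stb v = K -> toroot v).
  { intros v. apply (H (stb v)); [apply stb_sub|reflexivity]. }
  intros K. induction (wf_subconj K) as [K _ IH]. intros sK.
  assert (H : forall u : setadj, subconj K (stb u) -> toroot u).
  { intros u hu. apply (IH (stb u) hu); [apply stb_sub|reflexivity]. }
  clear IH.
  assert (back : forall F, sub F -> fin F -> incl K F -> forall u z : setadj,
    wk (rs a' (fun u : Y => incl F (stb u))) u z -> toroot z -> toroot u).
  { intros F sF fF hK u z. induction 1 as [u|u u' z (p & q & r) _ IH]; [auto|].
    intros hz. specialize (IH hz).
    destruct (incl_subconj F (stb u) sF (stb_sub u) fF q) as [hu|hu].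
    - apply H. now apply (incl_subconj_l K F).
    - destruct IH as (t & ht & wt). exists t. split; [assumption|].
      apply (wkS _ u'); [|assumption]. split; [assumption|].
      intros g hg. apply r. rewrite <- hu. exact hg. }
  assert (HH : forall v z : Y, wk dead v z -> rt z -> incl K (stb v) -> @toroot G setadj v).
  { induction 1 as [z|v v1 z [hd hi1] hw1 IH]; intros hz hK; [exists z; split; [assumption|apply wk0]|].
    assert (h1 : @toroot G setadj v1) by (apply IH; auto; intros g hg; auto).
    destruct (classic (ar x y v v1)) as [hO1|n].
    - assert (hv : stb v = est (v, v1)) by (symmetry; now apply cap_l).
      destruct (ar_same _ _ _ _ hO1) as [g0 e0].
      apply (back (stb v) (stb_sub v)) with (z := v1); auto.
      + rewrite hv, e0. now apply cj_fin.
      + assert (hx : forall g, stb v = cj g (est (x, y)) ->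
          wk (rs a' (fun u => incl (stb v) (stb u))) (ac g x) (ac g y)).
        { intros g eg. apply (wk_map (rs a' (fun u => incl (est (x, y)) (stb u))) _ (ac g)); [|assumption].
          intros a b (p & q & r). apply wk1. split; [auto|]. rewrite eg, !stb_ac.
          split; now apply cj_incl. }
        destruct hO1 as [g [[e e']|[e e']]]; rewrite e, e' in *.
        * apply hx. now rewrite hv, est_ac.
        * apply wk_sym; [intros a b (p & q & r); split; [auto|split; assumption]|].
          apply hx. rewrite hv, est_ac, est_flip. reflexivity.
    - destruct h1 as (t & ht & wt). exists t. split; [assumption|].
      apply (wkS _ v1); [|assumption]. split; [exact (hO v v1 hd n)|exact hi1]. }
  intros v e. destruct (hr v) as (z & hz & hwz). apply (HH v z); auto. rewrite <- e. now intros g.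
Qed.
End SetAdj.
End Costs.

(** * Deleting and sliding arcs in minimal graphs *)

Section Slide.
Context {G : Group} (Y : gr G) (x y x' : Y).

Definition drop (a b : Y) := adj a b /\ ~ ar x y a b.
Definition sladj (a b : Y) := drop a b \/ ar x' y a b.

Lemma drop_sym a b : drop a b -> drop b a.
Proof. intros [h k]. split; [now apply adj_sym|]. intros c. now apply k, ar_flip. Qed.
Lemma drop_ac g a b : drop a b -> drop (ac g a) (ac g b).
Proof.
  intros [h k]. split; [now apply adj_ac|]. intros c. apply k.
  apply (ar_ac (iv g)) in c. now rewrite !acK in c.
Qed.
Lemma drop_irr a : ~ drop a a.
Proof. intros [h _]. now apply adj_irr in h. Qed.
Lemma drop_fin : ofin (@aorb G Y) (fun e => drop (fst e) (snd e)).
Proof. apply efin_sub. now intros e [h _]. Qed.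
Definition dropgr : gr G := setadj Y drop drop_sym drop_irr drop_ac drop_fin.

Lemma sladj_sym a b : sladj a b -> sladj b a.
Proof. intros [h|h]; [left; now apply drop_sym|right; now apply ar_flip]. Qed.
Lemma sladj_ac g a b : sladj a b -> sladj (ac g a) (ac g b).
Proof. intros [h|h]; [left; now apply drop_ac|right; now apply ar_ac]. Qed.
Hypothesis hne : x' <> y.
Lemma sladj_irr a : ~ sladj a a.
Proof.
  intros [h|[g [[h k]|[h k]]]]; [now apply drop_irr in h|apply hne..];
    apply (ac_inj g); congruence.
Qed.
Lemma sladj_fin : ofin (@aorb G Y) (fun e => sladj (fst e) (snd e)).
Proof.
  destruct drop_fin as [l hl]. exists ((x', y) :: l). intros e [h|h].
  - destruct (hl e h) as (e' & a & b). exists e'. simpl. auto.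
  - exists (x', y). simpl. auto.
Qed.
Definition slide : gr G := setadj Y sladj sladj_sym sladj_irr sladj_ac sladj_fin.
End Slide.

Section Minimal.
Context {G : Group} (KK : (G -> Prop) -> Prop) (L0 : list (G -> Prop)) (r0 : R).
Implicit Types Y : gr G.
Local Notation good := (good KK).
Hypothesis wf_subconj : well_founded (fun K' K : G -> Prop => subconj K K').
Hypothesis minL : forall Y L, good Y -> costeq Y L -> ~ mless L L0.
Hypothesis minr : forall Y, good Y -> costeq Y L0 -> (nroots Y <= r0)%R.

Definition minimal Y := good Y /\ costeq Y L0 /\ nroots Y = r0.

(** By the identity, the cost of [Y] arises from [L0] by trading [X] for groups above members of
    [X], which would be a descent below the minimum. *)
Lemma minimal_no_gain Y X Yl : good Y -> X <> [] -> (forall y, In y Yl -> exists x, In x X /\ subconj x y) ->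
  (forall w, clw w -> (esum Y (adjE Y) w + sm w X =
     vsum Y (fun x => ~ rt x) w + sm w L0 + sm w Yl)%R) -> False.
Proof.
  intros hg hX hu h. destruct (cost_ex KK Y hg) as [L hL].
  apply (minL Y L hg hL). apply (mless_intro X Yl); auto.
  intros w hw. specialize (h w hw). specialize (hL w hw). rewrite !sm_app. lra.
Qed.

Lemma fixed_wk {A} (R : A -> A -> Prop) P x y : wk (rs R P) x y -> wk R x y.
Proof. apply wk_mono. now intros a b [h _]. Qed.

Section Arc.
Context (Y : gr G) (x y : Y) (hY : minimal Y) (hxy : adj x y) (hf : fin (est (x, y))).
Local Notation E := (est (x, y)).

Lemma osum_drop (P : Y -> Y -> Prop) F : finv aorb F -> P x y ->
  inv aorb (fun e => P (fst e) (snd e)) ->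
  (osum aorb (fun e => adjE Y e /\ P (fst e) (snd e)) F =
   F (x, y) + osum aorb (fun e => drop Y x y (fst e) (snd e) /\ P (fst e) (snd e)) F)%R.
Proof.
  intros hF hP iP. assert (ia : inv aorb (aorb (x, y))).
  { intros e e' h k. apply (equiv_trans _ _ aorb_equiv _ e); assumption. }
  assert (ib : inv aorb (fun e => adjE Y e /\ P (fst e) (snd e))).
  { apply inv_and; [apply adjE_inv|assumption]. }
  rewrite (osum_split aorb aorb_equiv _ (aorb (x, y))); auto; [|apply efin_sub; tauto].
  f_equal.
  - apply (osum_one aorb aorb_equiv _ (x, y)); [assumption| |tauto].
    split; [split; assumption|apply ar_refl].
  - apply osum_ext; [apply aorb_equiv|unfold drop, adjE, aorb; tauto| |apply efin_sub; tauto|auto].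
    apply inv_and; [assumption|]. now apply (inv_not _ aorb_equiv).
Qed.

Lemma sum_drop w : clw w -> (esum Y (adjE Y) w =
  w E + esum Y (fun e => drop Y x y (fst e) (snd e)) w)%R.
Proof.
  intros hw. pose proof (osum_drop (fun _ _ => True) _ (est_finv w hw) I) as h.
  unfold esum. replace (adjE Y) with (fun e => adjE Y e /\ True) by (apply pred_ext; tauto).
  rewrite h; [|now intros ? ? ? ?]. do 2 f_equal. apply pred_ext. tauto.
Qed.

(** Such an arc could be deleted: the path restores connectivity and, through [dead_replace], the
    dead paths, while [E] disappears from the cost. *)
Lemma no_redundant : wk (rs (drop Y x y) (fun v => incl E (stb v))) x y -> False.
Proof.
  intros h. destruct hY as ((h1 & h2 & h3) & h4 & h5).
  assert (hO : forall a b : Y, adj a b -> ~ ar x y a b -> drop Y x y a b) by (now split).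
  apply (minimal_no_gain (dropgr Y x y) [E] []); [|easy|easy|].
  - split; [|split].
    + intros u v. apply (setadj_conn Y _ (drop_sym Y x y) (drop_ac Y x y) x y); auto.
      now apply fixed_wk in h.
    + apply (dead_replace Y _ (drop_sym Y x y) (drop_irr Y x y) (drop_ac Y x y)
        (drop_fin Y x y) x y); auto.
    + exact h3.
  - intros w hw. specialize (h4 w hw). rewrite (sum_drop w hw) in h4. simpl sm.
    unfold esum, vsum in *. simpl. unfold adjE. simpl. lra.
Qed.

Context (x' : Y) (hw : wk (rs (drop Y x y) (fun v => incl E (stb v))) x x')
  (hn : ~ ar x y x' y).

Lemma slide_fix : incl E (stb x').
Proof. apply (wk_in _ _ _ _ hw). now intros g [h _]. Qed.

Lemma slide_ne : x' <> y.
Proof. intros e. pose proof hw as h. rewrite e in h. exact (no_redundant h). Qed.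
(** This keeps the slid arc from merging with an existing orbit, which would spoil the cost
    identity: if [x'] and [y] were already joined, the arc from [x] to [y] would be redundant. *)
Lemma slide_nadj : ~ adj x' y.
Proof.
  intros h. apply no_redundant. apply (wk_trans _ _ x'); [assumption|]. apply wk1.
  split; [split; assumption|split; [apply slide_fix|now intros g [_ k]]].
Qed.

Definition slid : gr G := slide Y x y x' slide_ne.

Lemma slid_good : good slid.
Proof.
  destruct hY as ((h1 & h2 & h3) & h4 & h5).
  assert (hO : forall a b : Y, adj a b -> ~ ar x y a b -> sladj Y x y x' a b).
  { intros a b h k. left. now split. }
  assert (h : wk (rs (sladj Y x y x') (fun v => incl E (stb v))) x y).
  { apply (wk_trans _ _ x').
    - apply (wk_mono (rs (drop Y x y) (fun v => incl E (stb v)))); [|assumption].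
      intros a b [p q]. split; [now left|assumption].
    - apply wk1. split; [right; apply ar_refl|split; [apply slide_fix|now intros g [_ k]]]. }
  split; [|split].
  - intros u v. apply (setadj_conn Y _ (sladj_sym Y x y x') (sladj_ac Y x y x') x y); auto.
    now apply fixed_wk in h.
  - apply (dead_replace Y _ (sladj_sym Y x y x') (sladj_irr Y x y x' slide_ne)
      (sladj_ac Y x y x') (sladj_fin Y x y x') x y); auto.
  - exact h3.
Qed.

Lemma osum_slid (P : Y -> Y -> Prop) F : finv aorb F -> P x' y ->
  inv aorb (fun e => P (fst e) (snd e)) ->
  (osum aorb (fun e => adjE slid e /\ P (fst e) (snd e)) F =
   F (x', y) + osum aorb (fun e => drop Y x y (fst e) (snd e) /\ P (fst e) (snd e)) F)%R.
Proof.
  intros hF hP iP. assert (ia : inv aorb (aorb (x', y))).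
  { intros e e' h k. apply (equiv_trans _ _ aorb_equiv _ e); assumption. }
  assert (ib : inv aorb (fun e => adjE slid e /\ P (fst e) (snd e))).
  { apply inv_and; [apply (adjE_inv slid)|assumption]. }
  rewrite (osum_split aorb aorb_equiv _ (aorb (x', y))); auto;
    [|apply (efin_sub slid); tauto].
  f_equal.
  - apply (osum_one aorb aorb_equiv _ (x', y)); [assumption| |tauto].
    split; [split; [right; apply ar_refl|assumption]|apply ar_refl].
  - apply osum_ext; [apply aorb_equiv| | |apply (efin_sub slid); tauto|auto].
    + intros e. split; [intros [[[h|h] k'] k]; tauto|]. intros [h k]. split; [split; [now left|assumption]|].
      intros k'. apply slide_nadj. destruct h as [h _].
      apply (adjE_inv Y e (x', y)); [|assumption]. now apply (equiv_sym _ _ aorb_equiv).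
    + apply inv_and; [assumption|]. now apply (inv_not _ aorb_equiv).
Qed.

Lemma sum_slid w : clw w -> (esum slid (adjE slid) w =
  w (est (x', y)) + esum Y (fun e => drop Y x y (fst e) (snd e)) w)%R.
Proof.
  intros hc. pose proof (osum_slid (fun _ _ => True) _ (est_finv w hc) I) as h.
  unfold esum. replace (adjE slid) with (fun e => adjE slid e /\ True) by (apply pred_ext; tauto).
  rewrite h; [|now intros ? ? ? ?]. do 2 f_equal. apply pred_ext. tauto.
Qed.

(** The slid arc is fixed by [E]; were its group strictly larger, the slide would trade [E] for a
    group above it and lower the cost. *)
Lemma slid_est : est (x', y) = E.
Proof.
  assert (hi : incl E (est (x', y))).
  { intros g k. split; [now apply slide_fix|apply k]. }
  destruct (incl_subconj E (est (x', y)) (est_sub _) (est_sub _) hf hi) as [h|h]; [|assumption].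
  exfalso. apply (minimal_no_gain slid [E] [est (x', y)]); [apply slid_good|easy| |].
  - intros k [<-|[]]. exists E. simpl. auto.
  - intros w hc. rewrite (sum_slid w hc). destruct hY as (_ & h4 & _).
    specialize (h4 w hc). rewrite (sum_drop w hc) in h4. simpl sm.
    unfold vsum in *. simpl. lra.
Qed.

Lemma slid_minimal : minimal slid.
Proof.
  destruct hY as (_ & h4 & h5). split; [apply slid_good|split; [|exact h5]].
  intros w hc. rewrite (sum_slid w hc), slid_est. specialize (h4 w hc).
  rewrite (sum_drop w hc) in h4. exact h4.
Qed.
End Arc.
End Minimal.

(** * Regions, fixed connectivity and the weight [chi] *)

Section Regions.
Context {G : Group}.

Section One.
Context (Y : gr G) (Ga : Y -> Prop).

(** A connected block: its translates are equal or disjoint. It is closed under arcs with infinite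
    groups, because these have weight zero and would escape estimates by [chi]; the closure also
    keeps a dead path inside as long as its vertex groups are infinite. *)
Definition region := (exists x, Ga x) /\
  (forall x x', Ga x -> Ga x' -> wk (rs adj Ga) x x') /\
  (forall g x, Ga x -> Ga (ac g x) -> forall u, Ga u -> Ga (ac g u)) /\
  (forall x y, Ga x -> adj x y -> ~ fin (est (x, y)) -> Ga y).
Definition setstab : G -> Prop := fun g => forall u, Ga u <-> Ga (ac g u).
Definition spread (x : Y) := exists g, Ga (ac g x).
(** The same [g] serves both points: an arc between two different translates of [Ga] has both ends
    in [spread] without being inside. *)
Definition inside (a b : Y) := exists g, Ga (ac g a) /\ Ga (ac g b).
Definition arcs_in (e : Y * Y) := adjE Y e /\ inside (fst e) (snd e).

Lemma setstab_sub : sub setstab.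
Proof.
  unfold setstab. split; [|split].
  - intros u. now rewrite ac1.
  - intros g h a b u. rewrite acM, <- a. apply b.
  - intros g a u. rewrite (a (ac (iv g) u)), acKV. tauto.
Qed.
Lemma region_setstab g x : region -> Ga x -> Ga (ac g x) -> setstab g.
Proof.
  intros (_ & _ & h & _) hx hg u. split; [eauto|]. intros hu. rewrite <- (acK g u).
  apply (h (iv g) (ac g x)); auto. now rewrite acK.
Qed.
Lemma stb_setstab x : region -> Ga x -> incl (stb x) setstab.
Proof. intros h hx g hg. apply (region_setstab g x h hx). unfold stb in hg. now rewrite hg. Qed.
Lemma spread_ac g x : spread x -> spread (ac g x).
Proof. intros [h k]. exists (h ** iv g). now rewrite acM, acK. Qed.
Lemma spread_in x : Ga x -> spread x.
Proof. exists e1. now rewrite ac1. Qed.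
Lemma inside_ac g a b : inside a b -> inside (ac g a) (ac g b).
Proof. intros [h k]. exists (h ** iv g). now rewrite !acM, !acK. Qed.
Lemma inside_sym a b : inside a b -> inside b a.
Proof. intros [h k]. exists h. tauto. Qed.
Lemma inside_in a b : Ga a -> Ga b -> inside a b.
Proof. exists e1. now rewrite !ac1. Qed.
Lemma inside_r a b : region -> inside a b -> Ga a -> Ga b.
Proof.
  intros hr (g & h & k) ha. apply (region_setstab g a hr ha h). assumption.
Qed.
Lemma spread_inv : inv vorb spread.
Proof. apply inv_ac, spread_ac. Qed.
Lemma inside_inv : inv aorb (fun e => inside (fst e) (snd e)).
Proof. apply inv_aorb; [apply inside_ac|apply inside_sym]. Qed.
Lemma arcs_in_inv : inv aorb arcs_in.
Proof. apply inv_and; [apply adjE_inv|apply inside_inv]. Qed.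
Lemma arcs_in_fin : ofin aorb arcs_in.
Proof. apply efin_sub. now intros e []. Qed.

(* The clause on [E] is what allows an arc with group [E] to be slid to the vertex [z]. *)
Definition fixconn := forall B, sub B -> fin B -> incl B setstab ->
  exists z, Ga z /\ incl B (stb z) /\ forall x E, Ga x -> sub E -> incl E B ->
    incl E (stb x) -> wk (rs adj (fun v => Ga v /\ incl E (stb v))) x z.

Definition wt (K : G -> Prop) : R := (/ INR (size K))%R.
Lemma wt_clw : clw wt.
Proof. intros K K' h. unfold wt. now rewrite (same_size _ _ h). Qed.
Lemma wt_inf K : ~ fin K -> wt K = 0%R.
Proof. intros h. unfold wt. rewrite size_inf by assumption. simpl. apply Rinv_0. Qed.
Lemma wt_pos K : sub K -> fin K -> (0 < wt K)%R.
Proof.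
  intros h k. apply Rinv_0_lt_compat. apply lt_0_INR. pose proof (sub_pos _ h k). lia.
Qed.
Lemma wt_ge0 K : sub K -> (0 <= wt K)%R.
Proof.
  intros h. destruct (classic (fin K)) as [f|f]; [pose proof (wt_pos K h f); lra|].
  rewrite wt_inf; [lra|assumption].
Qed.
Lemma wt_le K L : sub K -> sub L -> incl K L -> (wt L <= wt K)%R.
Proof.
  intros hK hL hi. destruct (classic (fin L)) as [f|f].
  - apply Rinv_le_contravar.
    + apply lt_0_INR. pose proof (sub_pos _ hK (fin_incl _ _ hi f)). lia.
    + apply le_INR. now apply size_le.
  - rewrite (wt_inf L f). now apply wt_ge0.
Qed.
(* An Euler characteristic with opposite sign; infinite stabilizers contribute [0]. *)
Definition chi : R := (esum Y arcs_in wt - vsum Y spread wt)%R.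
End One.

Section SlideRegion.
Context (KK : (G -> Prop) -> Prop) (L0 : list (G -> Prop)) (r0 : R).
Hypothesis wf_subconj : well_founded (fun K' K : G -> Prop => subconj K K').
Hypothesis minL : forall Y L, good KK Y -> costeq Y L -> ~ mless L L0.
Context (Y : gr G) (x y : Y) (hY : minimal KK L0 r0 Y) (hxy : adj x y) (hf : fin (est (x, y))).
Local Notation E := (est (x, y)).
Context (x' : Y) (Ga : Y -> Prop) (hr : region Y Ga) (hx : Ga x) (hy : Ga y).
Context (hw : wk (rs (drop Y x y) (fun v => incl E (stb v) /\ Ga v)) x x')
  (hn : ~ ar x y x' y).

Lemma slid_hw : wk (rs (drop Y x y) (fun v => incl E (stb v))) x x'.
Proof. generalize hw. apply wk_mono. intros a b (p & [q _] & [r _]). repeat split; auto; apply p. Qed.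
Definition slidr := slid KK L0 r0 wf_subconj minL Y x y hY hxy hf x' slid_hw.

Lemma slid_in : Ga x'.
Proof. apply (wk_in _ _ _ _ hw). split; [now intros g [h _]|assumption]. Qed.

Lemma slid_region : region slidr Ga.
Proof.
  destruct hr as (h1 & h2 & h3 & h4). split; [assumption|split; [|split; [assumption|]]].
  - intros a b ha hb. specialize (h2 a b ha hb). revert h2.
    apply (wk_map _ _ (fun a : Y => a)). intros u v (p & q & r).
    destruct (classic (ar x y u v)) as [[g hg]|n].
    + assert (hh : setstab Y Ga g).
      { destruct hg as [[e e']|[e e']]; subst; now apply (region_setstab Y Ga g x hr hx). }
      assert (k : wk (rs (sladj Y x y x') Ga) (ac g x) (ac g y)).
      { apply (wk_map (rs (sladj Y x y x') Ga) _ (ac g)).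
        - intros c d (i & j & l). apply wk1. split; [now apply sladj_ac|].
          split; now apply (proj1 (hh _)).
        - apply (wk_trans _ _ x').
          + generalize hw. apply wk_mono. intros c d (i & [_ j] & [_ l]). split; [now left|tauto].
          + apply wk1. split; [right; apply ar_refl|split; [apply slid_in|assumption]]. }
      destruct hg as [[-> ->]|[-> ->]]; [assumption|]. apply wk_rs_sym; [apply sladj_sym|assumption].
    + apply wk1. split; [left; now split|tauto].
  - intros u v hu [[p _]|p] hi; [now apply (h4 u v)|]. exfalso. apply hi.
    destruct (ar_same _ _ _ _ p) as [g e]. simpl in e. apply (fin_ext (cj g E)).
    { intros k. rewrite <- (slid_est KK L0 r0 wf_subconj minL Y x y hY hxy hf x' slid_hw hn), <- e. reflexivity. }
    now apply cj_fin.
Qed.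

Lemma osum_slid_region F : finv aorb F ->
  (osum aorb (arcs_in slidr Ga) F + F (x, y) = osum aorb (arcs_in Y Ga) F + F (x', y))%R.
Proof.
  intros hF. pose proof (inside_inv Y Ga) as hI.
  pose proof (osum_slid KK L0 r0 wf_subconj minL Y x y hY hxy hf x' slid_hw hn (inside Y Ga) F hF
    (inside_in Y Ga _ _ slid_in hy) hI) as h1.
  pose proof (osum_drop Y x y hxy (inside Y Ga) F hF (inside_in Y Ga _ _ hx hy) hI) as h2.
  unfold arcs_in. change (inside slidr Ga) with (inside Y Ga). rewrite h2.
  unfold slidr. rewrite h1. lra.
Qed.

Lemma slid_chi : chi slidr Ga = chi Y Ga.
Proof.
  unfold chi. pose proof (osum_slid_region _ (est_finv wt wt_clw)) as h. simpl in h.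
  rewrite (slid_est KK L0 r0 wf_subconj minL Y x y hY hxy hf x' slid_hw hn) in h.
  unfold esum, vsum. change (vorb (A := slidr)) with (vorb (A := Y)).
  change (spread slidr Ga) with (spread Y Ga). simpl in *. lra.
Qed.

(** A step over the slid arc is replaced by the sliding path run backwards followed by the old arc.
    A group fixing the slid arc lies in the corresponding conjugate of [E], so it fixes this
    detour. *)
Lemma slid_fixconn : fixconn slidr Ga -> fixconn Y Ga.
Proof.
  intros h B sB fB hB. destruct (h B sB fB hB) as (z & hz & hBz & hp).
  exists z. split; [assumption|split; [assumption|]].
  intros u E0 hu sE hE hEu. specialize (hp u E0 hu sE hE hEu). revert hp.
  apply (wk_map _ _ (fun a : Y => a)). intros a b (p & [q q'] & [r r']).
  destruct p as [[p _]|[g hg]]; [apply wk1; now repeat split|].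
  assert (hh : setstab Y Ga g).
  { destruct hg as [[e e']|[e e']]; subst; now apply (region_setstab Y Ga g y hr hy). }
  assert (hE0 : incl E0 (cj g E)).
  { rewrite <- (slid_est KK L0 r0 wf_subconj minL Y x y hY hxy hf x' slid_hw hn), <- est_ac.
    destruct hg as [[e e']|[e e']]; subst; intros k hk; split; simpl; auto. }
  assert (k : wk (rs adj (fun v => Ga v /\ incl E0 (stb v))) (ac g x') (ac g y)).
  { apply (wk_map (rs adj (fun v => incl E (stb v) /\ Ga v)) _ (ac g)).
    - intros c d (i & [j j'] & [l l']). apply wk1. split; [now apply adj_ac|].
      rewrite !stb_ac. split; (split; [now apply (proj1 (hh _))|]); intros m hm; apply hE0 in hm;
        revert m hm; now apply cj_incl.
    - apply (wk_trans _ _ x).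
      + apply wk_rs_sym; [apply adj_sym|].
        generalize hw. apply wk_mono. intros c d ([i _] & j & l). now split.
      + apply wk1. split; [assumption|]. unfold est, cap. simpl.
        split; (split; [intros m [? ?]|]; assumption). }
  destruct hg as [[-> ->]|[-> ->]]; [assumption|]. apply wk_rs_sym; [apply adj_sym|assumption].
Qed.
End SlideRegion.
End Regions.

(** * New orbits and pendant vertices *)

Section Cosets.
Context {G : Group} (S : G -> Prop) (hS : sub S).
Definition lc (g : G) : G -> Prop := fun x => S (iv g ** x).
(** Cosets are predicates on the group, so extensionality makes equal cosets equal and no quotient
    has to be formed. *)
Definition cos := {c : G -> Prop | exists g, c = lc g}.
Lemma lc_ac h g : (fun x => lc g (iv h ** x)) = lc (h ** g).
Proof. apply pred_ext. intros x. unfold lc. now gs. Qed.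
Lemma cos_ex h (c : cos) : exists g, (fun x => proj1_sig c (iv h ** x)) = lc g.
Proof. destruct c as [c [g ->]]. exists (h ** g). apply lc_ac. Qed.
Definition cac (h : G) (c : cos) : cos := exist _ _ (cos_ex h c).
Lemma cos_eq (c d : cos) : proj1_sig c = proj1_sig d -> c = d.
Proof.
  destruct c as [c p], d as [d q]. simpl. intros <-. f_equal. apply proof_irrelevance.
Qed.
Lemma cac1 c : cac e1 c = c.
Proof. apply cos_eq. simpl. apply pred_ext. intros x. now gs. Qed.
Lemma cacM g h c : cac (g ** h) c = cac g (cac h c).
Proof. apply cos_eq. simpl. apply pred_ext. intros x. now gs. Qed.
Definition cgs : gset G := mkgset cos cac cac1 cacM.
Definition coset (g : G) : cgs := exist _ (lc g) (ex_intro _ g eq_refl).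
Lemma coset_ac h g : ac h (coset g) = coset (h ** g).
Proof. apply cos_eq. simpl. apply lc_ac. Qed.
Lemma coset_all (c : cgs) : exists g, c = coset g.
Proof. destruct c as [c [g e]]. exists g. apply cos_eq. exact e. Qed.
Lemma coset_eq g h : coset g = coset h <-> S (iv g ** h).
Proof.
  split.
  - intros e. apply (f_equal (fun c : cgs => proj1_sig c h)) in e. simpl in e.
    unfold lc in e. rewrite e, mulVg. now apply sub1.
  - intros e. apply cos_eq. simpl. apply pred_ext. intros x. unfold lc. split; intros k.
    + replace (iv h ** x) with (iv (iv g ** h) ** (iv g ** x)) by (now gs).
      apply subM; auto. now apply subV.
    + replace (iv g ** x) with (iv g ** h ** (iv h ** x)) by (now gs).
      now apply subM.
Qed.
Lemma coset_stb g : stb (coset g) = cj g S.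
Proof.
  apply pred_ext. intros x. unfold stb, cj. rewrite coset_ac.
  split; intros h.
  - symmetry in h. apply coset_eq in h. now rewrite mulA.
  - symmetry. apply coset_eq. now rewrite <- mulA.
Qed.
End Cosets.

Section SumSet.
Context {G : Group} (A B : gset G).
Definition sac (g : G) (x : A + B) : A + B :=
  match x with inl a => inl (ac g a) | inr b => inr (ac g b) end.
Lemma sac1 x : sac e1 x = x. Proof. destruct x; simpl; now rewrite ac1. Qed.
Lemma sacM g h x : sac (g ** h) x = sac g (sac h x).
Proof. destruct x; simpl; now rewrite acM. Qed.
Definition sgs : gset G := mkgset (A + B) sac sac1 sacM.
Definition il (a : A) : sgs := inl a.
Definition ir (b : B) : sgs := inr b.
Lemma ac_il g a : ac g (il a) = il (ac g a). Proof. reflexivity. Qed.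
Lemma ac_ir g b : ac g (ir b) = ir (ac g b). Proof. reflexivity. Qed.
Lemma il_inj a a' : il a = il a' -> a = a'. Proof. now injection 1. Qed.
Lemma ir_inj a a' : ir a = ir a' -> a = a'. Proof. now injection 1. Qed.
Lemma stb_il a : stb (il a) = stb a.
Proof.
  apply pred_ext. intros g. unfold stb. rewrite ac_il. split; [apply il_inj|now intros ->].
Qed.
Lemma stb_ir a : stb (ir a) = stb a.
Proof.
  apply pred_ext. intros g. unfold stb. rewrite ac_ir. split; [apply ir_inj|now intros ->].
Qed.
End SumSet.
Arguments il {G A B}. Arguments ir {G A B}.

(* [Y] with some arcs removed and one new orbit of vertices [G/S], joined to the
   vertices in [N] and their translates. *)
Section Ext.
Context {G : Group} (Y : gr G) (S : G -> Prop) (hS : sub S).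
Context (keep : Y -> Y -> Prop) (N : list Y) (rl : Y -> Prop) (rr : Prop).
Hypothesis ks : forall a b, keep a b -> keep b a.
Hypothesis ka : forall a b, keep a b -> adj a b.
Hypothesis kac : forall g a b, keep a b -> keep (ac g a) (ac g b).
Hypothesis rac : forall g a, rl a -> rl (ac g a).

Local Notation eX := (sgs Y (cgs S)).
Definition hub : eX := ir (coset S e1).
Definition link (a : Y) (c : cgs S) := exists n g, In n N /\ a = ac g n /\ c = coset S g.
Definition eadj (u v : eX) : Prop :=
  match u, v with
  | inl a, inl b => keep a b
  | inl a, inr c => link a c
  | inr c, inl a => link a c
  | inr _, inr _ => False
  end.
Definition ert (u : eX) : Prop := match u with inl a => rl a | inr _ => rr end.

Lemma eadj_sym u v : eadj u v -> eadj v u.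
Proof. destruct u, v; simpl; auto. Qed.
Lemma eadj_irr u : ~ eadj u u.
Proof. destruct u; simpl; auto. intros h. apply ka in h. now apply adj_irr in h. Qed.
Lemma link_ac g a c : link a c -> link (ac g a) (ac g c).
Proof.
  intros (n & h & i & -> & ->). exists n, (g ** h). rewrite acM, coset_ac. auto.
Qed.
Lemma eadj_ac g u v : eadj u v -> eadj (ac g u) (ac g v).
Proof.
  destruct u as [a|c], v as [b|d]; simpl; auto; apply link_ac.
Qed.
Lemma ert_ac g u : ert u -> ert (ac g u).
Proof. destruct u; simpl; auto. Qed.
Lemma hub_ac g : ac g hub = ir (coset S g).
Proof. unfold hub. now rewrite ac_ir, coset_ac, mulg1. Qed.
Lemma ir_hub (c : cgs S) : exists g, ir c = ac g hub.
Proof. destruct (coset_all S c) as [g ->]. exists g. now rewrite hub_ac. Qed.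
Lemma vorb_il a b : vorb (il a : eX) (il b) <-> vorb a b.
Proof.
  split; intros [g e]; exists g; [|now rewrite e].
  rewrite ac_il in e. now apply (il_inj Y (cgs S)) in e.
Qed.
Lemma evfin : ofin (@vorb G eX) (fun _ => True).
Proof.
  destruct (vfin G Y) as [l hl]. exists (hub :: map il l). intros [a|c] _.
  - destruct (hl a I) as (b & h & k). exists (il b). split; [right; now apply in_map|].
    now apply vorb_il.
  - exists hub. split; [now left|]. destruct (ir_hub c) as [g e]. now exists g.
Qed.
Lemma link_orb a c : link a c -> exists n, In n N /\ aorb (il n : eX, hub) (il a, ir c).
Proof.
  intros (n & g & i & -> & ->). exists n. split; [assumption|]. exists g. left. simpl.
  now rewrite hub_ac.
Qed.
Lemma aorb_il a b c d : aorb (il a : eX, il b) (il c, il d) <-> aorb (a, b) (c, d).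
Proof.
  split; intros [g e]; exists g; simpl in *; rewrite !ac_il in *.
  - destruct e as [[e e']|[e e']]; apply (il_inj Y (cgs S)) in e, e'; auto.
  - destruct e as [[-> ->]|[-> ->]]; auto.
Qed.
Lemma eefin : ofin (@aorb G eX) (fun e => eadj (fst e) (snd e)).
Proof.
  destruct (efin G Y) as [l hl].
  exists (map (fun n => (il n, hub)) N ++ map (fun e => (il (fst e), il (snd e))) l).
  intros [[a|c] [b|d]] h; simpl in h; try easy.
  - destruct (hl (a, b) (ka _ _ h)) as ([a' b'] & p & q). exists (il a', il b'). split.
    + apply in_app_iff. right. now apply (in_map (fun e => (il (fst e), il (snd e))) l (a', b')).
    + now apply aorb_il.
  - destruct (link_orb _ _ h) as (n & p & q). exists (il n, hub). split; [|assumption].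
    apply in_app_iff. left. now apply (in_map (fun n => (il n, hub))).
  - destruct (link_orb _ _ h) as (n & p & q). exists (il n, hub). split.
    + apply in_app_iff. left. now apply (in_map (fun n => (il n, hub))).
    + now apply ar_flip.
Qed.
Definition ext : gr G := mkgr eX eadj ert eadj_sym eadj_irr eadj_ac ert_ac evfin eefin (inhabits hub).

Lemma stb_hub g : stb (ac g hub) = cj g S.
Proof. rewrite hub_ac, stb_ir. now apply coset_stb. Qed.

Lemma osum_ext_v (P : eX -> Prop) F : finv vorb F -> inv vorb P ->
  osum vorb P F = (osum vorb (fun a => P (il a)) (fun a => F (il a)) +
    osum vorb (fun u => P u /\ vorb hub u) F)%R.
Proof.
  intros hF hP. assert (hv : inv vorb (vorb hub)).
  { intros a b h k. apply (equiv_trans _ _ vorb_equiv _ a); assumption. }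
  assert (fa : forall Q : eX -> Prop, ofin vorb Q) by (intros; now apply (vfin_sub ext)).
  assert (ia : inv vorb (fun a : Y => P (il a))).
  { intros a b h. apply hP. now apply vorb_il. }
  rewrite (osum_split vorb vorb_equiv P (vorb hub)); auto.
  rewrite Rplus_comm. f_equal. symmetry.
  apply (osum_map vorb vorb vorb_equiv vorb_equiv _ _ il); auto; [apply vfin_sub| |].
  - intros a b _ _. symmetry. apply vorb_il.
  - intros u. split.
    + intros [p q]. destruct u as [a|c].
      * exists a. split; [assumption|]. apply vorb_equiv.
      * exfalso. apply q. destruct (ir_hub c) as [g e]. now exists g.
    + intros (a & p & [g e]). subst u. rewrite ac_il. split.
      * apply (hP (il a)); [|assumption]. now exists g.
      * intros [h k]. rewrite hub_ac in k. easy.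
Qed.
Lemma osum_hub (P : eX -> Prop) F : finv vorb F -> inv vorb P -> P hub ->
  osum vorb P F = (osum vorb (fun a => P (il a)) (fun a => F (il a)) + F hub)%R.
Proof.
  intros hF hP ph. rewrite (osum_ext_v P F hF hP). f_equal.
  apply (osum_one vorb vorb_equiv); auto; [|tauto]. split; [assumption|apply vorb_equiv].
Qed.
Lemma osum_nohub (P : eX -> Prop) F : finv vorb F -> inv vorb P -> ~ P hub ->
  osum vorb P F = osum vorb (fun a => P (il a)) (fun a => F (il a)).
Proof.
  intros hF hP ph. rewrite (osum_ext_v P F hF hP), (osum_nil vorb (fun u => P u /\ vorb hub u)); [lra|].
  intros u [p [g e]]. apply ph. apply (hP u); [|assumption]. exists (iv g). now rewrite e, acK.
Qed.

Hypothesis Nind : ForallOrdPairs (fun n n' => forall s, S s -> ac s n <> n') N.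

(** By [Nind] the members of [N] are inequivalent under the group of the hub, so each contributes
    its own orbit of new arcs. *)
Lemma osum_ext_e (P : eX -> eX -> Prop) F : finv aorb F ->
  inv aorb (fun e => P (fst e) (snd e)) -> (forall n, In n N -> P (il n) hub) ->
  (osum aorb (fun e => adjE ext e /\ P (fst e) (snd e)) F =
   osum aorb (fun e => keep (fst e) (snd e) /\ P (il (fst e)) (il (snd e)))
     (fun e => F (il (fst e), il (snd e))) + sm (fun n => F (il n, hub)) N)%R.
Proof.
  intros hF hP hN.
  set (mix := fun e => exists n, In n N /\ aorb (il n : eX, hub) e).
  assert (im : inv aorb mix).
  { intros e e' h (n & a & b). exists n. split; [assumption|].
    apply (equiv_trans _ _ aorb_equiv _ e); assumption. }
  assert (ip : inv aorb (fun e => adjE ext e /\ P (fst e) (snd e))).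
  { apply inv_and; [apply (adjE_inv ext)|assumption]. }
  rewrite (osum_split aorb aorb_equiv _ mix); auto; [|apply (efin_sub ext); tauto].
  rewrite Rplus_comm. f_equal.
  - symmetry. apply (osum_map aorb aorb aorb_equiv aorb_equiv _ _
      (fun e : Y * Y => (il (fst e), il (snd e)))).
    + apply inv_and.
      * apply (inv_aorb keep); auto.
      * intros [a b] [c d] h. apply (hP (il a, il b) (il c, il d)). now apply aorb_il.
    + apply efin_sub. intros e [h _]. now apply ka.
    + assumption.
    + intros [a b] [c d] _ _. symmetry. apply aorb_il.
    + intros e. split.
      * intros [[p q] r]. destruct e as [[a|c] [b|d]]; simpl in p; try easy.
        -- exists (a, b). split; [split; assumption|]. apply ar_refl.
        -- exfalso. apply r. destruct (link_orb _ _ p) as (n & i & j). now exists n.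
        -- exfalso. apply r. destruct (link_orb _ _ p) as (n & i & j). exists n.
           split; [assumption|]. now apply ar_flip.
      * intros ([a b] & [p q] & r). split.
        -- apply (ip (il a, il b) e r). split; assumption.
        -- intros (n & i & j). apply (equiv_sym _ _ aorb_equiv) in r.
           apply (equiv_trans _ _ aorb_equiv _ _ _ j) in r.
           destruct r as [g [[e1' e2']|[e1' e2']]]; simpl in *; rewrite hub_ac in *; easy.
  - rewrite <- (sm_map (fun n => (il n, hub)) F).
    apply (osum_reps aorb aorb_equiv); [assumption|]. split; [|split].
    + intros e he. apply in_map_iff in he. destruct he as (n & <- & i). split; [split|].
      * exists n, e1. rewrite ac1. auto.
      * now apply hN.
      * exists n. split; [assumption|apply ar_refl].
    + intros e [_ (n & i & j)]. exists (il n, hub). split; [|assumption].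
      now apply (in_map (fun n => (il n, hub))).
    + clear - Nind hS. induction Nind as [|n l h t IH]; simpl; constructor; auto.
      apply Forall_forall. intros e he. apply in_map_iff in he. destruct he as (n' & <- & i).
      rewrite Forall_forall in h. intros [g [[a b]|[a b]]]; simpl in *; rewrite hub_ac in *;
        [|easy]. apply (ir_inj Y (cgs S)) in b. apply (h n' i g).
      * apply coset_eq in b; [|assumption]. now rewrite iv1, mul1g in b.
      * apply (il_inj Y (cgs S)) in a. now symmetry.
Qed.
End Ext.

Section Pendant.
Context {G : Group} (KK : (G -> Prop) -> Prop) (L0 : list (G -> Prop)) (r0 : R).
Hypothesis KKfin : forall K, sub K -> fin K -> KK K.
Context (Y : gr G) (z : Y) (B : G -> Prop) (hB : sub B) (fB : fin B) (hz : incl B (stb z)).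

(** A pendant vertex adds one nonroot and one dead arc, both with group [B], so the cost does not
    change. It provides a vertex whose image in a tree can be prescribed, onto which arcs are then
    slid. *)
Definition pend : gr G := ext Y B adj [z] rt False (adj_sym G Y) (fun a b h => h)
  (adj_ac G Y) (rt_ac G Y).
Local Notation PX := (sgs Y (cgs B)).
Local Notation hb := (hub Y B).

Lemma pend_adj g : @adj G pend (il (ac g z)) (ac g hb).
Proof. rewrite hub_ac. exists z, g. simpl. auto. Qed.
Lemma pend_stb_hub g : stb (ac g hb) = cj g B.
Proof. now apply stb_hub. Qed.
Lemma pend_hub_le g : incl (stb (ac g hb)) (stb (il (ac g z) : PX)).
Proof. rewrite pend_stb_hub, stb_il, stb_ac. now apply cj_incl. Qed.
Lemma pend_case (u : pend) : (exists a, u = il a) \/ exists g, u = ac g hb.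
Proof. destruct u as [a|c]; [left; now exists a|right; apply (ir_hub Y B c)]. Qed.

Lemma osum_pend (P : PX -> PX -> Prop) F : finv aorb F ->
  inv aorb (fun e => P (fst e) (snd e)) -> P (il z) hb ->
  (osum aorb (fun e => adjE pend e /\ P (fst e) (snd e)) F =
   osum aorb (fun e => adjE Y e /\ P (il (fst e)) (il (snd e)))
     (fun e => F (il (fst e), il (snd e))) + F (il z, hb))%R.
Proof.
  intros hF hP hp. unfold pend. rewrite osum_ext_e; auto.
  - simpl. unfold adjE. lra.
  - repeat constructor.
  - now intros n [<-|[]].
Qed.

Lemma osum_pend_v (P : pend -> Prop) F : finv vorb F -> inv vorb P -> P hb ->
  osum vorb P F = (osum vorb (fun a => P (il a)) (fun a => F (il a)) + F hb)%R.
Proof.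
  exact (osum_hub Y B adj [z] rt False (adj_sym G Y) (fun a b h => h) (adj_ac G Y) (rt_ac G Y) P F).
Qed.
Lemma osum_pend_nv (P : pend -> Prop) F : finv vorb F -> inv vorb P -> ~ P hb ->
  osum vorb P F = osum vorb (fun a => P (il a)) (fun a => F (il a)).
Proof.
  exact (osum_nohub Y B adj [z] rt False (adj_sym G Y) (fun a b h => h) (adj_ac G Y) (rt_ac G Y) P F).
Qed.

Lemma est_pend_il (a b : Y) : @est G pend (il a, il b) = est (a, b).
Proof. unfold est. simpl. now rewrite !(stb_il Y (cgs B)). Qed.
Lemma est_pend_hub : @est G pend (il z, hb) = B.
Proof.
  unfold est. simpl. rewrite cap_comm. rewrite <- (ac1 _ hb), pend_stb_hub, cj1, (stb_il Y (cgs B)).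
  now apply cap_l.
Qed.

Lemma pend_good : good KK Y -> good KK pend.
Proof.
  intros (h1 & h2 & h3).
  assert (hil : forall a b : Y, wk (@adj G pend) (il a) (il b)).
  { intros a b. apply (wk_map (@adj G Y) _ il); [intros; now apply wk1|apply h1]. }
  assert (hall : forall u : pend, exists a, wk (@adj G pend) u (il a)).
  { intros u. destruct (pend_case u) as [[a ->]|[g ->]]; [exists a; apply wk0|].
    exists (ac g z). apply wk1, adj_sym, pend_adj. }
  assert (hr : forall a, @toroot G pend (il a)).
  { intros a. destruct (h2 a) as (t & ht & wt'). exists (il t). split; [assumption|].
    apply (wk_map dead _ (il : Y -> pend)); [|assumption]. intros b c [p q]. apply wk1.
    split; [assumption|]. now rewrite !(stb_il Y (cgs B)). }
  split; [|split].
  - intros u v. destruct (hall u) as [a ha], (hall v) as [b hb'].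
    apply (wk_trans _ _ (il a)); [assumption|]. apply (wk_trans _ _ (il b)); [apply hil|].
    apply wk_sym; [apply (adj_sym G pend)|assumption].
  - intros u. destruct (pend_case u) as [[a ->]|[g ->]]; [apply hr|].
    destruct (hr (ac g z)) as (t & ht & wt'). exists t. split; [assumption|].
    apply (wkS _ (il (ac g z))); [|assumption]. split; [apply (adj_sym G pend), pend_adj|apply pend_hub_le].
  - intros u. destruct (pend_case u) as [[a ->]|[g ->]].
    + rewrite (stb_il Y (cgs B)). apply h3.
    + rewrite pend_stb_hub. apply KKfin; [now apply cj_sub|now apply cj_fin].
Qed.

Lemma pend_minimal : minimal KK L0 r0 Y -> minimal KK L0 r0 pend.
Proof.
  intros (h1 & h2 & h3). split; [now apply pend_good|split].
  - intros w hw. specialize (h2 w hw).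
    assert (e1 : esum pend (adjE pend) w = (esum Y (adjE Y) w + w B)%R).
    { pose proof (osum_pend (fun _ _ => True) _ (est_finv (A := pend) w hw)) as h.
      cbv beta in h. rewrite est_pend_hub in h. unfold esum.
      replace (adjE pend) with (fun e => adjE pend e /\ True) by (apply pred_ext; tauto).
      replace (adjE Y) with (fun e => adjE Y e /\ True) by (apply pred_ext; tauto).
      refine (eq_trans (h _ I) _); [now intros ? ? ? ?|]. f_equal.
      apply osum_ext; [apply aorb_equiv|tauto| |apply efin_sub; tauto|].
      - apply inv_and; [apply adjE_inv|now intros ? ? ? ?].
      - intros [a b] _. simpl. now rewrite est_pend_il. }
    assert (e2 : vsum pend (fun x => ~ rt x) w = (vsum Y (fun x => ~ rt x) w + w B)%R).
    { unfold vsum. rewrite osum_pend_v; [|now apply stb_finv| |simpl; tauto].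
      - f_equal; [|now rewrite <- (ac1 _ hb), pend_stb_hub, cj1].
        apply osum_ext; [apply vorb_equiv|tauto| |apply vfin_sub|].
        + apply inv_ac. intros g x. apply (nrt_ac Y).
        + intros a _. now rewrite (stb_il Y (cgs B)).
      - apply inv_ac. intros g x. apply (nrt_ac pend). }
    lra.
  - rewrite <- h3. unfold nroots. rewrite osum_pend_nv; [|now intros ? ? ?| |simpl; tauto].
    + reflexivity.
    + apply inv_ac. apply (rt_ac G pend).
Qed.

Context (Ga : Y -> Prop) (hr : region Y Ga) (hGz : Ga z).

Definition pGa (u : pend) : Prop :=
  match u with inl a => Ga a | inr c => exists g, c = coset B g /\ Ga (ac g z) end.

Lemma pGa_il a : pGa (il a) <-> Ga a. Proof. reflexivity. Qed.
Lemma pGa_hub g : pGa (ac g hb) <-> Ga (ac g z).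
Proof.
  rewrite hub_ac. split.
  - intros (h & e & k). apply coset_eq in e; [|assumption]. apply hz in e.
    unfold stb in e. rewrite acM in e. symmetry in e. apply (proj2 (ac_eq g _ _)) in e.
    now rewrite e.
  - intros h. exists g. auto.
Qed.
Lemma pGa_ac g u : setstab Y Ga g -> (pGa u <-> pGa (ac g u)).
Proof.
  intros h. destruct (pend_case u) as [[a ->]|[k ->]].
  - apply (h a).
  - rewrite <- acM, !pGa_hub, acM. apply h.
Qed.
Lemma pend_setstab g : setstab Y Ga g -> setstab pend pGa g.
Proof. intros h u. now apply pGa_ac. Qed.
Lemma pend_region : region pend pGa.
Proof.
  destruct hr as (h1 & h2 & h3 & h4).
  assert (hil : forall a b, Ga a -> Ga b -> wk (rs (@adj G pend) pGa) (il a) (il b)).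
  { intros a b ha hb'. apply (wk_map (rs adj Ga) _ (il : Y -> pend)); [|auto].
    intros c d h. now apply wk1. }
  assert (hall : forall u, pGa u -> exists a, Ga a /\ wk (rs (@adj G pend) pGa) u (il a)).
  { intros u hu. destruct (pend_case u) as [[a ->]|[g ->]]; [exists a; split; [assumption|apply wk0]|].
    apply pGa_hub in hu. exists (ac g z). split; [assumption|].
    apply wk1. split; [apply (adj_sym G pend), pend_adj|split; [now apply pGa_hub|assumption]]. }
  split; [|split; [|split]].
  - destruct h1 as [a ha]. now exists (il a).
  - intros u v hu hv. destruct (hall u hu) as (a & ha & wa), (hall v hv) as (b & hb' & wb).
    apply (wk_trans _ _ (il a)); [assumption|]. apply (wk_trans _ _ (il b)); [now apply hil|].
    apply wk_sym; [|assumption]. intros c d (p & q & r). split; [now apply (adj_sym G pend)|tauto].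
  - intros g u hu hgu v hv. apply (pGa_ac g v); [|assumption].
    destruct (pend_case u) as [[a ->]|[k ->]].
    + apply (region_setstab Y Ga g a hr); assumption.
    + rewrite <- acM in hgu. apply pGa_hub in hu, hgu. rewrite acM in hgu.
      now apply (region_setstab Y Ga g (ac k z)).
  - intros u v hu ha hi.
    assert (hf : forall g v, fin (est (ac g hb, v)) /\ fin (est (v, ac g hb))).
    { intros g v'. split; [|rewrite est_flip];
        (apply (fin_incl _ (cj g B)); [rewrite <- pend_stb_hub; now intros k []|now apply cj_fin]). }
    destruct (pend_case u) as [[a ->]|[g ->]]; [|exfalso; apply hi, hf].
    destruct (pend_case v) as [[b ->]|[g ->]]; [|exfalso; apply hi, hf].
    apply pGa_il. apply (h4 a b); auto. now rewrite <- est_pend_il.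
Qed.

Lemma osum_pend_region F : finv aorb F ->
  (osum aorb (arcs_in pend pGa) F =
   osum aorb (arcs_in Y Ga) (fun e => F (il (fst e), il (snd e))) + F (il z, hb))%R.
Proof.
  intros hF. unfold arcs_in. rewrite (osum_pend (inside pend pGa)); auto.
  - apply (inside_inv pend).
  - apply (inside_in pend); [assumption|]. rewrite <- (ac1 _ hb). apply pGa_hub. now rewrite ac1.
Qed.

Lemma pend_chi : chi pend pGa = chi Y Ga.
Proof.
  unfold chi, esum, vsum. rewrite (osum_pend_region _ (est_finv wt wt_clw)), est_pend_hub.
  rewrite osum_pend_v; [|apply stb_finv, wt_clw|apply (spread_inv pend)|].
  - rewrite <- (ac1 _ hb) at 1. rewrite pend_stb_hub, cj1.
    replace (osum aorb (arcs_in Y Ga) (fun e => wt (@est G pend (il (fst e), il (snd e)))))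
      with (osum aorb (arcs_in Y Ga) (fun e => wt (est e))).
    + replace (osum vorb (fun a => spread pend pGa (il a)) (fun a => wt (@stb G pend (il a))))
        with (osum vorb (spread Y Ga) (fun a => wt (stb a))); [unfold pend; lra|].
      apply osum_ext; [apply vorb_equiv|tauto|apply spread_inv|apply vfin_sub|].
      intros a _. now rewrite (stb_il Y (cgs B)).
    + apply osum_ext; [apply aorb_equiv|tauto|apply arcs_in_inv|apply arcs_in_fin|].
      intros [a b] _. simpl. now rewrite est_pend_il.
  - exists e1. apply pGa_hub. now rewrite ac1.
Qed.

(** The retraction [rho] moves every pendant vertex to its point of attachment. It collapses the new
    arcs and never shrinks a stabilizer, so fixed paths are carried to fixed paths. *)
Lemma pend_fixconn : fixconn pend pGa -> fixconn Y Ga.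
Proof.
  intros h C sC fC hC. destruct (h C sC fC) as (u & hu & hCu & hp).
  { intros g hg. now apply pend_setstab, hC. }
  assert (exists rho : pend -> Y, (forall a, rho (il a) = a) /\
    forall g, rho (ac g hb) = ac g z) as (rho & r1 & r2).
  { destruct (choice (fun (u : pend) a => u = il a \/ exists g, u = ac g hb /\ a = ac g z)) as [rho hrho].
    - intros v. destruct (pend_case v) as [[a ->]|[g ->]]; [exists a; auto|exists (ac g z); eauto].
    - exists rho. split.
      + intros a. destruct (hrho (il a)) as [e|(g & e & _)].
        * now apply (il_inj Y (cgs B)) in e.
        * rewrite hub_ac in e. easy.
      + intros g. destruct (hrho (ac g hb)) as [e|(k & e & ->)].
        * rewrite hub_ac in e. easy.
        * rewrite !hub_ac in e. apply (ir_inj Y (cgs B)) in e.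
          apply coset_eq in e; [|assumption]. apply hz in e. unfold stb in e.
          rewrite acM in e. symmetry in e. now apply (proj2 (ac_eq g _ _)) in e. }
  assert (rG : forall v, pGa v -> Ga (rho v)).
  { intros v hv. destruct (pend_case v) as [[a ->]|[g ->]]; [now rewrite r1|].
    rewrite r2. now apply pGa_hub. }
  assert (rS : forall v : pend, incl (stb v) (stb (rho v))).
  { intros v. destruct (pend_case v) as [[a ->]|[g ->]].
    - rewrite r1, (stb_il Y (cgs B)). now intros k.
    - rewrite r2, pend_stb_hub, stb_ac. now apply cj_incl. }
  exists (rho u). split; [auto|split; [intros k hk; now apply rS, hCu|]].
  intros x E hx sE hE hEx. specialize (hp (il x) E).
  rewrite (stb_il Y (cgs B)) in hp. specialize (hp hx sE hE hEx).
  rewrite <- (r1 x). revert hp. apply wk_map.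
  intros a b (p & [q q'] & [r r']).
  assert (done : adj (rho a) (rho b) -> wk (rs adj (fun v => Ga v /\ incl E (stb v))) (rho a) (rho b)).
  { intros k. apply wk1. split; [assumption|]. repeat split; auto; intros m hm; now apply rS; auto. }
  assert (hl : forall a g, @adj G pend (il a) (ac g hb) -> a = ac g z).
  { intros c g l. rewrite hub_ac in l. destruct l as (n & k & [<-|[]] & -> & e).
    apply coset_eq in e; [|assumption]. apply hz in e. unfold stb in e.
    rewrite acM in e. symmetry in e. apply (proj2 (ac_eq g _ _)) in e. now symmetry. }
  destruct (pend_case a) as [[c ->]|[g ->]], (pend_case b) as [[d ->]|[k ->]].
  - apply done. now rewrite !r1.
  - rewrite r1, r2, (hl c k p). apply wk0.
  - rewrite r1, r2, (hl d g (adj_sym G pend _ _ p)). apply wk0.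
  - rewrite !hub_ac in p. easy.
Qed.

Lemma pend_map {V : gset G} (f : Y -> V) (v : V) : equi f -> incl B (stb v) ->
  exists f' : pend -> V, equi f' /\ (forall a, f' (il a) = f a) /\ f' hb = v.
Proof.
  intros hf hv.
  destruct (choice (fun (u : pend) a => (exists x, u = il x /\ a = f x) \/
    exists g, u = ac g hb /\ a = ac g v)) as [f' hf'].
  { intros u. destruct (pend_case u) as [[a ->]|[g ->]]; [exists (f a)|exists (ac g v)]; eauto. }
  assert (h1 : forall a, f' (il a) = f a).
  { intros a. destruct (hf' (il a)) as [(x & e & ->)|(g & e & _)].
    - apply (il_inj Y (cgs B)) in e. now subst.
    - rewrite hub_ac in e. easy. }
  assert (h2 : forall g, f' (ac g hb) = ac g v).
  { intros g. destruct (hf' (ac g hb)) as [(x & e & _)|(k & e & ->)].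
    - rewrite hub_ac in e. easy.
    - rewrite !hub_ac in e. apply (ir_inj Y (cgs B)) in e. apply coset_eq in e; [|assumption].
      apply hv in e. unfold stb in e. rewrite acM in e. symmetry in e.
      now apply (proj2 (ac_eq g _ _)) in e. }
  exists f'. split; [|split; [assumption|]].
  - intros g u. destruct (pend_case u) as [[a ->]|[k ->]].
    + change (f' (il (ac g a)) = ac g (f' (il a))). rewrite !h1. apply hf.
    + now rewrite <- acM, !h2, acM.
  - rewrite <- (ac1 _ hb), h2. apply ac1.
Qed.
End Pendant.

(** * Coning off an elliptic region *)

Lemma wk_exit {A} (R : A -> A -> Prop) (P : A -> Prop) x y : wk R x y -> P x -> ~ P y ->
  exists a b, R a b /\ P a /\ ~ P b.
Proof.
  induction 1 as [x|x y z h _ IH]; [easy|]. intros px pz.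
  destruct (classic (P y)) as [py|py]; [auto|]. now exists x, y.
Qed.

Lemma FOP_intro {A} (R : A -> A -> Prop) l :
  (forall l1 x l2, l = l1 ++ x :: l2 -> forall y, In y l2 -> R x y) -> ForallOrdPairs R l.
Proof.
  induction l as [|a l IH]; intros h; constructor.
  - apply Forall_forall. now apply (h [] a l).
  - apply IH. intros l1 x l2 e. apply (h (a :: l1)). now rewrite e.
Qed.
Lemma FOP_filter {A} (R : A -> A -> Prop) p l : ForallOrdPairs R l ->
  ForallOrdPairs R (filter p l).
Proof.
  induction 1 as [|a l h _ IH]; simpl; [constructor|]. destruct (p a); [|assumption].
  constructor; [|assumption]. rewrite Forall_forall in *. intros x hx.
  apply filter_In in hx. now apply h.
Qed.
Lemma FOP_impl {A} (R R' : A -> A -> Prop) l : (forall x y, In x l -> In y l -> R x y -> R' x y) ->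
  ForallOrdPairs R l -> ForallOrdPairs R' l.
Proof.
  intros h k. induction k as [|a l h' k IH]; constructor.
  - rewrite Forall_forall in *. intros x hx. apply h; simpl; auto.
  - apply IH. intros x y hx hy. apply h; simpl; auto.
Qed.

Definition dec {A} (P : A -> Prop) (x : A) : bool :=
  if excluded_middle_informative (P x) then true else false.
Lemma dec_true {A} (P : A -> Prop) x : dec P x = true <-> P x.
Proof. unfold dec. now destruct (excluded_middle_informative (P x)). Qed.
Lemma filter_dec {A} (P : A -> Prop) l x : In x (filter (dec P) l) <-> In x l /\ P x.
Proof. now rewrite filter_In, dec_true. Qed.
Lemma sm_filter {A} (P : A -> Prop) f l :
  sm f l = (sm f (filter (dec P) l) + sm f (filter (dec (fun x => ~ P x)) l))%R.
Proof.
  induction l as [|a l IH]; simpl; [lra|].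
  destruct (classic (P a)) as [h|h].
  - rewrite (proj2 (dec_true P a) h).
    destruct (dec (fun x => ~ P x) a) eqn:e; [now apply (proj1 (dec_true _ _)) in e|]. simpl. lra.
  - rewrite (proj2 (dec_true (fun x => ~ P x) a) h).
    destruct (dec P a) eqn:e; [now apply (proj1 (dec_true _ _)) in e|]. simpl. lra.
Qed.

Section Chain.
Context {G : Group} {A : gset G} (D : A -> A -> Prop) (dom Z : A -> Prop).
Context (sg : A -> A) (ht : A -> nat) (HS : selects D dom Z sg ht).
Definition cstep (a b : A) := dom a /\ ~ Z a /\ b = sg a.
Lemma chain_ex x : dom x -> exists z, dom z /\ Z z /\ wk cstep x z.
Proof.
  remember (ht x) as n eqn:e. revert x e. induction n as [n IH] using lt_wf_ind.
  intros x e hx. destruct (classic (Z x)) as [hz|hz].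
  - exists x. split; [assumption|split; [assumption|apply wk0]].
  - destruct HS as (h1 & _). destruct (h1 x hx hz) as (_ & a & b).
    destruct (IH (ht (sg x))) with (x := sg x) as (z & c & d & k); [lia|reflexivity|assumption|].
    exists z. split; [assumption|split; [assumption|]]. apply (wkS _ (sg x)); [|assumption].
    now repeat split.
Qed.
Lemma chain_hd x z : wk cstep x z -> Z z -> ~ Z x -> wk cstep (sg x) z.
Proof. intros h. destruct h as [x|x y z (_ & _ & ->) h]; [easy|auto]. Qed.
Lemma chain_Z x z : wk cstep x z -> Z x -> z = x.
Proof. intros h. destruct h as [x|x y z (_ & h & _) _]; easy. Qed.
End Chain.

(* [tops] lists receive all dead paths of [Ga]; for a shortest one, [RT], the region is coned
   off by a new root with group [setstab Ga], and the arcs that are not needed to flow to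
   [RT] are removed. *)
Section HubRegion.
Context {G : Group} (KK : (G -> Prop) -> Prop) (L0 : list (G -> Prop)) (r0 : R).
Hypothesis KKcj : forall g K, KK K -> KK (cj g K).
Hypothesis wf_subconj : well_founded (fun K' K : G -> Prop => subconj K K').
Hypothesis minL : forall Y L, good KK Y -> costeq Y L -> ~ mless L L0.
Hypothesis minr : forall Y, good KK Y -> costeq Y L0 -> (nroots Y <= r0)%R.
Context (Y : gr G) (Ga : Y -> Prop) (hY : minimal KK L0 r0 Y) (hr : region Y Ga).
Local Notation H := (setstab Y Ga).
Local Notation dG := (rs (@dead G Y) Ga).

Definition tops (l : list Y) := (forall t, In t l -> Ga t) /\
  forall x, Ga x -> exists t h, In t l /\ H h /\ wk dG x (ac h t).

Lemma dG_ac h x y : H h -> wk dG x y -> wk dG (ac h x) (ac h y).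
Proof.
  intros hh. apply wk_map. intros a b (p & q & r). apply wk1. split; [now apply dead_ac|].
  split; now apply (proj1 (hh _)).
Qed.
Lemma dG_adj x y : wk dG x y -> incl (stb x) (stb y).
Proof.
  induction 1 as [x|x y z ([_ p] & _) _ IH]; [now intros g|]. intros g hg. auto.
Qed.

(** A dead path to a root that starts with an infinite group crosses only arcs with infinite groups,
    hence stays in the region; so a top with infinite group can be moved to a root without
    lengthening the list. *)
Lemma tops_exist : exists l, tops l /\ (forall l', tops l' -> length l <= length l') /\
  forall t, In t l -> ~ fin (stb t) -> rt t.
Proof.
  destruct (least (fun n => exists l, tops l /\ length l = n)) as (n & (l & hl & e) & hmin).
  { destruct (reps_exist vorb vorb_equiv (spread Y Ga) (spread_inv Y Ga) (vfin_sub Y _)) as (l & a1 & a2 & _).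
    destruct (choice (fun t u : Y => spread Y Ga t -> Ga u /\ vorb t u)) as [c hc].
    { intros t. destruct (classic (spread Y Ga t)) as [[g hg]|n]; [|exists t; easy].
      exists (ac g t). intros _. split; [assumption|]. now exists g. }
    exists (length (map c l)), (map c l). split; [|reflexivity]. split.
    - intros t ht. apply in_map_iff in ht. destruct ht as (u & <- & hu). now apply hc, a1.
    - intros x hx. destruct (a2 x (spread_in Y Ga x hx)) as (t & ht & [g hg]).
      destruct (hc t (a1 t ht)) as [h1 [k h2]]. exists (c t), (g ** iv k).
      assert (e : x = ac (g ** iv k) (c t)) by (rewrite h2, acM, acK; assumption).
      split; [now apply in_map|split].
      + apply (region_setstab Y Ga _ (c t) hr h1). now rewrite <- e.
      + rewrite <- e. apply wk0. }
  assert (hc : forall t, exists u, Ga t -> Ga u /\ wk dG t u /\ (~ fin (stb t) -> rt u) /\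
      (~ fin (stb u) -> rt u)).
  { intros t. destruct (classic (fin (stb t))) as [f|f].
    - exists t. intros ht. split; [assumption|split; [apply wk0|split; easy]].
    - destruct hY as ((_ & h2 & _) & _). destruct (h2 t) as (z & hz & w). exists z. intros ht.
      assert (HH : Ga z /\ wk dG t z).
      { clear hz. induction w as [t|t u z [p q] _ IH]; [split; [assumption|apply wk0]|].
        assert (hu : Ga u).
        { destruct hr as (_ & _ & _ & h4). apply (h4 t u); auto. unfold est. simpl.
          now rewrite cap_l. }
        destruct IH as [i j]; [|assumption|].
        { intros f'. apply f. now apply (fin_incl _ _ q). }
        split; [assumption|]. apply (wkS _ u); [|assumption]. now repeat split. }
      split; [apply HH|split; [apply HH|split; auto]]. }
  destruct (choice _ hc) as [c hc']. exists (map c l).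
  assert (hin : forall t, In t l -> Ga t) by apply hl.
  split; [split|split].
  - intros t ht. apply in_map_iff in ht. destruct ht as (u & <- & hu). now apply hc', hin.
  - intros x hx. destruct hl as [_ hl]. destruct (hl x hx) as (t & h & i & j & k).
    exists (c t), h. split; [now apply in_map|split; [assumption|]].
    apply (wk_trans _ _ (ac h t)); [assumption|]. apply dG_ac; [assumption|]. now apply hc', hin.
  - intros l' hl'. rewrite length_map, e. apply hmin. now exists l'.
  - intros t ht. apply in_map_iff in ht. destruct ht as (u & <- & hu). now apply hc', hin.
Qed.

Context (RT : list Y) (hRT : tops RT) (RTmin : forall l', tops l' -> length RT <= length l')
  (RTinf : forall t, In t RT -> ~ fin (stb t) -> rt t).

(** Otherwise whatever flows to [t] would flow on to [t'], and [t] could be dropped from a shortest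
    list. *)
Lemma RT_ind l1 t l2 t' h : RT = l1 ++ t :: l2 -> In t' (l1 ++ l2) -> H h -> ~ wk dG t (ac h t').
Proof.
  intros e hi hh w. assert (hl : tops (l1 ++ l2)).
  { destruct hRT as [a b]. split.
    - intros u hu. apply a. rewrite e. rewrite in_app_iff in *. simpl. tauto.
    - intros x hx. destruct (b x hx) as (u & k & i & j & m). rewrite e in i.
      destruct (classic (In u (l1 ++ l2))) as [c|c]; [now exists u, k|].
      assert (u = t) as -> by (rewrite in_app_iff in *; simpl in i; intuition).
      exists t', (k ** h). split; [assumption|split].
      + apply subM; auto. apply setstab_sub.
      + rewrite acM. apply (wk_trans _ _ (ac k t)); [assumption|]. now apply dG_ac. }
  apply RTmin in hl. rewrite e, !length_app in hl. simpl in hl. lia.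
Qed.
Lemma RT_uniq t t' h : In t RT -> In t' RT -> H h -> wk dG t (ac h t') -> t' = t.
Proof.
  intros a b c d. destruct (in_split _ _ a) as (l1 & l2 & e).
  destruct (classic (In t' (l1 ++ l2))) as [i|i].
  - exfalso. apply (RT_ind l1 t l2 t' h e i c d).
  - rewrite e in b. rewrite in_app_iff in *. simpl in b. intuition.
Qed.
Lemma RT_fop : ForallOrdPairs (fun n n' => forall s, H s -> ac s n <> n') RT.
Proof.
  apply FOP_intro. intros l1 x l2 e y hy s hs <-.
  apply (RT_ind l1 x l2 (ac s x) (iv s) e).
  - apply in_app_iff. auto.
  - apply subV; auto. apply setstab_sub.
  - rewrite acK. apply wk0.
Qed.

Definition Zt (x : Y) := exists t g, In t RT /\ x = ac g t.
Definition dI (a b : Y) := dead a b /\ inside Y Ga a b.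
Lemma Zt_ac g x : Zt x -> Zt (ac g x).
Proof. intros (t & h & a & ->). exists t, (g ** h). now rewrite acM. Qed.
Lemma Zt_in x : Ga x -> Zt x -> exists t h, In t RT /\ H h /\ x = ac h t.
Proof.
  intros hx (t & h & a & ->). exists t, h. split; [assumption|split; [|reflexivity]].
  apply (region_setstab Y Ga h t hr); [|assumption]. now apply hRT.
Qed.

Lemma hub_select : exists sg ht, selects dI (spread Y Ga) Zt sg ht.
Proof.
  apply select.
  - intros g x y [a b]. split; [now apply dead_ac|now apply inside_ac].
  - apply spread_ac.
  - apply Zt_ac.
  - intros x [g hg]. destruct hRT as [_ b]. destruct (b _ hg) as (t & h & i & j & k).
    exists (ac (iv g) (ac h t)). split; [apply Zt_ac; now exists t, h|].
    rewrite <- (acK g x). revert k. apply wk_map. intros c d (p & q & r). apply wk1.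
    split; [split; [now apply dead_ac|]|].
    + now apply inside_ac, inside_in.
    + now apply spread_ac, spread_in.
Qed.

Context (sg : Y -> Y) (ht : Y -> nat) (HS : selects dI (spread Y Ga) Zt sg ht).
Local Notation ch := (wk (cstep (spread Y Ga) Zt sg)).
Local Notation ta := (tarc (spread Y Ga) Zt sg).

Lemma sg_dead x : spread Y Ga x -> ~ Zt x -> incl (stb x) (stb (sg x)).
Proof. intros a b. destruct HS as (h & _). now destruct (h x a b) as ([[_ k] _] & _). Qed.
Lemma sg_D x : spread Y Ga x -> ~ Zt x -> dI x (sg x).
Proof. intros a b. destruct HS as (h & _). now destruct (h x a b). Qed.
Lemma ch_dG x z : Ga x -> ch x z -> Ga z /\ wk dG x z.
Proof.
  intros hx w. induction w as [x|x y z (p & q & ->) _ IH]; [split; [assumption|apply wk0]|].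
  destruct (sg_D x p q) as [d i]. assert (hs : Ga (sg x)) by (now apply (inside_r Y Ga x)).
  destruct (IH hs) as [j k]. split; [assumption|]. apply (wkS _ (sg x)); [|assumption].
  split; [assumption|now split].
Qed.
(** When the group does not grow along a chain, every arc of the chain is dead in both
    directions. *)
Lemma ch_back x z : Ga x -> ch x z -> incl (stb z) (stb x) -> wk dG z x.
Proof.
  intros hx w. induction w as [x|x y z (p & q & ->) w IH]; intros hi; [apply wk0|].
  destruct (sg_D x p q) as [[d d'] i]. assert (hs : Ga (sg x)) by (now apply (inside_r Y Ga x)).
  destruct (ch_dG _ _ hs w) as [_ w']. apply dG_adj in w'.
  apply (wk_trans _ _ (sg x)).
  - apply IH; [assumption|]. intros g hg. auto.
  - apply wk1. split; [split; [now apply adj_sym|]|now split]. intros g hg. auto.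
Qed.
Lemma ta_inv : inv aorb ta. Proof. apply tarc_inv. Qed.
Lemma ta_char a b : ta (a, b) -> cstep (spread Y Ga) Zt sg a b \/ cstep (spread Y Ga) Zt sg b a.
Proof. exact (tarc_dead dI (spread Y Ga) Zt (spread_ac Y Ga) Zt_ac sg ht HS sg_dead a b). Qed.

Definition rem (a b : Y) := adj a b /\ inside Y Ga a b /\ ~ ta (a, b).
Definition keep (a b : Y) := adj a b /\ ~ (inside Y Ga a b /\ ~ ta (a, b)).
Lemma ta_ac g a b : ta (a, b) -> ta (ac g a, ac g b).
Proof. intros h. apply (ta_inv (a, b)); [exists g; left; auto|exact h]. Qed.
Lemma keep_sym a b : keep a b -> keep b a.
Proof.
  intros [p q]. split; [now apply adj_sym|]. intros [i j]. apply q. split; [now apply inside_sym|].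
  intros k. now apply j, tarc_flip.
Qed.
Lemma keep_ac g a b : keep a b -> keep (ac g a) (ac g b).
Proof.
  intros [p q]. split; [now apply adj_ac|]. intros [i j]. apply q. split.
  - apply (inside_ac Y Ga (iv g)) in i. now rewrite !acK in i.
  - intros k. now apply j, ta_ac.
Qed.
(** Roots in the coned region are demoted, since everything there now flows to the hub. *)
Definition rlT (a : Y) := rt a /\ ~ spread Y Ga a.
Lemma rlT_ac g a : rlT a -> rlT (ac g a).
Proof.
  intros [p q]. split; [now apply rt_ac|]. intros k. apply q.
  apply (spread_ac Y Ga (iv g)) in k. now rewrite acK in k.
Qed.
Definition star : gr G := ext Y H keep RT rlT True keep_sym (fun a b h => proj1 h) keep_ac rlT_ac.
Local Notation hb := (hub Y H).

Lemma star_case (u : star) : (exists a, u = il a) \/ exists g, u = ac g hb.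
Proof. destruct u as [a|c]; [left; now exists a|right; apply (ir_hub Y H c)]. Qed.
Lemma star_stb g : @stb G star (ac g hb) = cj g H.
Proof. apply stb_hub, setstab_sub. Qed.
Lemma star_stb_il a : @stb G star (il a) = stb a.
Proof. apply (stb_il Y (cgs H)). Qed.
Lemma star_adj t g : In t RT -> @adj G star (il (ac g t)) (ac g hb).
Proof. intros h. rewrite hub_ac. exists t, g. auto. Qed.
Lemma star_dead t g : In t RT -> @dead G star (il (ac g t)) (ac g hb).
Proof.
  intros h. split; [now apply star_adj|]. rewrite star_stb_il, star_stb, stb_ac.
  apply cj_incl, stb_setstab; [assumption|]. now apply hRT.
Qed.

Lemma star_toroot x : spread Y Ga x -> exists g, Ga (ac (iv g) x) /\ wk (@dead G star) (il x) (ac g hb).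
Proof.
  intros hx. assert (hw : forall x, Ga x -> wk (@dead G star) (il x) hb).
  { clear x hx. intros x hx. destruct (chain_ex _ _ _ sg ht HS x (spread_in Y Ga x hx)) as (z & hz & zz & w).
    apply (wk_trans _ _ (il z)).
    - assert (w' : wk (@dead G star) (il x) (il z)); [|exact w'].
      apply (wk_map (cstep (spread Y Ga) Zt sg) (@dead G star) (il : Y -> star)); [|assumption].
      intros a b (p & q & ->). apply wk1. destruct (sg_D a p q) as [[d d'] i]. split.
      + split; [assumption|]. intros [_ k]. apply k. exists a. split; [assumption|split; [assumption|]].
        apply ar_refl.
      + now rewrite !star_stb_il.
    - destruct (Zt_in z) as (t & h & i & j & ->); [now apply (ch_dG x)|assumption|].
      apply wk1. replace hb with (ac h hb); [now apply star_dead|].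
      unfold stb. assert (k : @stb G star (ac e1 hb) h); [|now rewrite ac1 in k].
      now rewrite star_stb, cj1. }
  destruct hx as [g hg]. exists (iv g). rewrite ivK. split; [assumption|].
  specialize (hw _ hg). apply (wk_map _ (@dead G star) (ac (iv g))) in hw.
  - change (ac (iv g) (il (ac g x) : star)) with (il (ac (iv g) (ac g x)) : star) in hw.
    now rewrite acK in hw.
  - intros a b d. now apply wk1, dead_ac.
Qed.

(** Both ends of a removed arc flow to the same hub, so connectivity survives. A dead path from
    outside either keeps its arcs or enters the region, and from there it is continued to the
    hub. *)
Lemma star_good : KK H -> good KK star.
Proof.
  intros hK. destruct hY as ((h1 & h2 & h3) & _).
  assert (hin : forall x g, Ga (ac (iv g) x) -> wk (@adj G star) (il x) (ac g hb)).
  { intros x g hx. destruct (star_toroot x) as (k & hk & w); [now exists (iv g)|].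
    assert (w' : wk (@adj G star) (il x) (ac k hb)) by (revert w; apply wk_mono; now intros a b []).
    assert (e : ac k hb = ac g hb); [|now rewrite <- e].
    rewrite !hub_ac. f_equal. apply coset_eq; [apply setstab_sub|].
    assert (q : H (iv g ** k)).
    { apply (region_setstab Y Ga _ (ac (iv k) x) hr hk). now rewrite acM, acKV. }
    apply (subV _ _ (setstab_sub Y Ga)) in q. now rewrite ivM, ivK in q. }
  assert (hil : forall a b : Y, wk adj a b -> wk (@adj G star) (il a) (il b)).
  { intros a b. apply (wk_map _ _ (il : Y -> star)). clear a b. intros a b h.
    destruct (classic (keep a b)) as [k|k]; [now apply wk1|].
    assert (i : inside Y Ga a b).
    { apply NNPP. intros n. apply k. split; [assumption|tauto]. }
    destruct i as (g & ga & gb). apply (wk_trans _ _ (ac (iv g) hb)).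
    - apply hin. now rewrite ivK.
    - apply wk_sym; [apply (adj_sym G star)|]. apply hin. now rewrite ivK. }
  assert (hne : exists t, In t RT).
  { destruct hr as ([x hx] & _). destruct hRT as [_ b]. destruct (b x hx) as (t & _ & i & _).
    now exists t. }
  assert (hall : forall u : star, exists a, wk (@adj G star) u (il a)).
  { intros u. destruct (star_case u) as [[a ->]|[g ->]]; [exists a; apply wk0|].
    destruct hne as [t i]. exists (ac g t). apply wk1, (adj_sym G star). now apply star_adj. }
  split; [|split].
  - intros u v. destruct (hall u) as [a wa], (hall v) as [b wb].
    apply (wk_trans _ _ (il a)); [assumption|]. apply (wk_trans _ _ (il b)); [now apply hil|].
    apply wk_sym; [apply (adj_sym G star)|assumption].
  - assert (hroot : forall g, @rt G star (ac g hb)) by (intros g; now apply (rt_ac G star)).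
    assert (htr : forall x, spread Y Ga x -> @toroot G star (il x)).
    { intros x hx. destruct (star_toroot x hx) as (g & _ & w). now exists (ac g hb). }
    intros u. destruct (star_case u) as [[a ->]|[g ->]]; [|exists (ac g hb); split; [apply hroot|apply wk0]].
    destruct (h2 a) as (z & hz & w). revert hz. induction w as [a|a b z [p q] _ IH]; intros hz.
    + destruct (classic (spread Y Ga a)) as [ta0|ta0]; [auto|]. exists (il a). split; [now split|apply wk0].
    + destruct (classic (spread Y Ga a)) as [ta0|ta0]; [auto|].
      destruct (IH hz) as (t & ht' & w). exists t. split; [assumption|].
      apply (wkS _ (il b)); [|assumption]. split.
      * split; [assumption|]. intros [[g [i _]] _]. apply ta0. now exists g.
      * now rewrite !star_stb_il.
  - intros u. destruct (star_case u) as [[a ->]|[g ->]].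
    + rewrite star_stb_il. apply h3.
    + rewrite star_stb. now apply KKcj.
Qed.

Definition remE (e : Y * Y) := rem (fst e) (snd e).
Definition gen (x : Y) := (rt x /\ spread Y Ga x) /\ ~ Zt x.
Definition RTr := filter (dec rt) RT.
Definition RTn := filter (dec (fun x => ~ rt x)) RT.

Lemma Zt_inv : inv vorb Zt. Proof. apply inv_ac, Zt_ac. Qed.
Lemma rttr_inv : inv vorb (fun x => rt x /\ spread Y Ga x).
Proof. apply inv_ac. intros g x [a b]. split; [now apply rt_ac|now apply spread_ac]. Qed.
Lemma remE_inv : inv aorb remE.
Proof.
  apply (inv_aorb rem).
  - intros g a b (p & q & r). split; [now apply adj_ac|split; [now apply inside_ac|]].
    intros k. apply r. apply (ta_ac (iv g)) in k. now rewrite !acK in k.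
  - intros a b (p & q & r). split; [now apply adj_sym|split; [now apply inside_sym|]].
    intros k. now apply r, tarc_flip.
Qed.

Lemma roots_spread : exists GL, reps vorb gen GL /\ forall F, finv vorb F ->
  osum vorb (fun x => rt x /\ spread Y Ga x) F = (sm F RTr + sm F GL)%R.
Proof.
  destruct (osum_list vorb vorb_equiv gen) as (GL & a & b).
  { apply inv_and; [apply rttr_inv|]. apply (inv_not _ vorb_equiv), Zt_inv. }
  { apply vfin_sub. }
  exists GL. split; [assumption|]. intros F hF.
  rewrite (osum_split vorb vorb_equiv _ Zt F hF rttr_inv Zt_inv (vfin_sub Y _)).
  f_equal; [|apply b]. apply (osum_reps vorb vorb_equiv); [assumption|]. split; [|split].
  - intros t h. apply filter_dec in h. destruct h as [h k]. split; [split; [assumption|]|].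
    + now apply spread_in, hRT.
    + exists t, e1. now rewrite ac1.
  - intros x [[h1 h2] (t & g & i & ->)]. exists t. split; [|now exists g].
    apply filter_dec. split; [assumption|]. rewrite <- (acK g t). now apply rt_ac.
  - apply FOP_filter. apply (FOP_impl _ _ _) with (2 := RT_fop).
    intros x y hx hy h [g e]. apply (h g); [|now symmetry].
    apply (region_setstab Y Ga g x hr); [now apply hRT|]. rewrite <- e. now apply hRT.
Qed.

Lemma osum_star F : finv aorb F -> (osum aorb (adjE star) F =
  osum aorb (fun e => keep (fst e) (snd e)) (fun e => F (il (fst e), il (snd e))) +
  sm (fun n => F (il n, hb)) RT)%R.
Proof.
  intros hF. replace (adjE star) with (fun e => adjE star e /\ True) by (apply pred_ext; tauto).
  refine (eq_trans (osum_ext_e Y H (setstab_sub Y Ga) keep RT rlT True keep_sym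
    (fun a b h => proj1 h) keep_ac rlT_ac RT_fop (fun _ _ => True) F hF _ _) _); [now intros ? ?|easy|].
  do 2 f_equal. apply pred_ext. tauto.
Qed.
Lemma osum_star_v (P : star -> Prop) F : finv vorb F -> inv vorb P -> P hb ->
  osum vorb P F = (osum vorb (fun a => P (il a)) (fun a => F (il a)) + F hb)%R.
Proof.
  exact (osum_hub Y H keep RT rlT True keep_sym (fun a b h => proj1 h) keep_ac rlT_ac P F).
Qed.
Lemma osum_star_nv (P : star -> Prop) F : finv vorb F -> inv vorb P -> ~ P hb ->
  osum vorb P F = osum vorb (fun a => P (il a)) (fun a => F (il a)).
Proof.
  exact (osum_nohub Y H keep RT rlT True keep_sym (fun a b h => proj1 h) keep_ac rlT_ac P F).
Qed.

Lemma esum_star w : clw w ->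
  (esum star (adjE star) w + esum Y remE w = esum Y (adjE Y) w + sm w (map stb RT))%R.
Proof.
  intros hw. unfold esum.
  assert (HI : inv aorb (fun e : Y * Y => inside Y Ga (fst e) (snd e) /\ ~ ta e)).
  { apply inv_and; [apply inside_inv|]. apply (inv_not _ aorb_equiv), ta_inv. }
  rewrite osum_star by now apply est_finv.
  rewrite (osum_split aorb aorb_equiv (adjE Y) _ _ (est_finv w hw) (adjE_inv Y) HI (efin G Y)).
  replace (fun e : Y * Y => adjE Y e /\ inside Y Ga (fst e) (snd e) /\ ~ ta e) with remE
    by (apply pred_ext; intros [a b]; reflexivity).
  replace (fun e : Y * Y => adjE Y e /\ ~ (inside Y Ga (fst e) (snd e) /\ ~ ta e))
    with (fun e : Y * Y => keep (fst e) (snd e)) by (apply pred_ext; intros [a b]; reflexivity).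
  rewrite sm_map.
  replace (sm (fun n => w (@est G star (il n, hb))) RT) with (sm (fun b => w (stb b)) RT).
  - replace (osum aorb (fun e => keep (fst e) (snd e)) (fun e => w (@est G star (il (fst e), il (snd e)))))
      with (osum aorb (fun e => keep (fst e) (snd e)) (fun e => w (est e))); [lra|].
    apply osum_ext; [apply aorb_equiv|tauto|apply (inv_aorb keep); [apply keep_ac|apply keep_sym]| |].
    + apply efin_sub. now intros e [h _].
    + intros [a b] _. unfold est. simpl. now rewrite !star_stb_il.
  - apply sm_ext. intros n hn. f_equal. unfold est. simpl. rewrite star_stb_il.
    symmetry. apply cap_l. rewrite <- (ac1 _ hb), star_stb, cj1.
    apply stb_setstab; [assumption|]. now apply hRT.
Qed.

Lemma star_nrt w GL : clw w -> (forall F, finv vorb F ->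
  osum vorb (fun x => rt x /\ spread Y Ga x) F = (sm F RTr + sm F GL)%R) ->
  (vsum star (fun x => ~ rt x) w =
   vsum Y (fun x => ~ rt x) w + sm w (map stb RTr) + sm w (map stb GL))%R.
Proof.
  intros hw hG. unfold vsum.
  assert (i0 : inv vorb (@rt G Y)) by apply inv_ac, rt_ac.
  assert (i1 : inv vorb (fun x : Y => ~ rlT x)).
  { apply (inv_not _ vorb_equiv), inv_ac, rlT_ac. }
  rewrite osum_star_nv; [|now apply stb_finv| |simpl; tauto].
  2:{ apply inv_ac. intros g x. apply (nrt_ac star). }
  rewrite !sm_map, Rplus_assoc, <- (hG _ (stb_finv w hw)), Rplus_comm.
  transitivity (osum vorb (fun x => ~ rlT x) (fun x => w (stb x))).
  - apply osum_ext; [apply vorb_equiv|reflexivity|exact i1|apply vfin_sub|].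
    intros a _. now rewrite star_stb_il.
  - rewrite (osum_split vorb vorb_equiv _ rt _ (stb_finv w hw) i1 i0 (vfin_sub Y _)).
    f_equal; f_equal; apply pred_ext; unfold rlT; intros x.
    + split; [|tauto]. intros [a b]. split; [assumption|]. apply NNPP. tauto.
    + tauto.
Qed.

Lemma star_nroots GL : (forall F, finv vorb F ->
  osum vorb (fun x => rt x /\ spread Y Ga x) F = (sm F RTr + sm F GL)%R) ->
  nroots star = (r0 + 1 - INR (length RTr) - INR (length GL))%R.
Proof.
  intros hG. destruct hY as (_ & _ & h). rewrite <- h. unfold nroots.
  rewrite osum_star_v; [|now intros ? ? ?|apply inv_ac, (rt_ac G star)|exact I].
  assert (i0 : inv vorb (@rt G Y)) by apply inv_ac, rt_ac.
  rewrite (osum_split vorb vorb_equiv (@rt G Y) (spread Y Ga)); auto;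
    [|now intros ? ? ?|apply spread_inv|apply vfin_sub].
  rewrite hG by now intros ? ? ?. rewrite !sm_one.
  assert (e : osum vorb (fun a => @rt G star (il a)) (fun _ => 1%R) =
    osum vorb (fun x => rt x /\ ~ spread Y Ga x) (fun _ => 1%R)) by reflexivity.
  rewrite e. lra.
Qed.

(** The balance of coning. Removed arcs and demoted roots are gains, hub arcs are expenses; at a top
    that was a root, the hub arc cancels with its demotion, so only the nonroot tops [RTn] have to
    be paid for. *)
Lemma star_cost RL GL w : clw w -> reps aorb remE RL -> (forall F, finv vorb F ->
  osum vorb (fun x => rt x /\ spread Y Ga x) F = (sm F RTr + sm F GL)%R) ->
  (esum star (adjE star) w + sm w (map est RL) + sm w (map stb GL) =
   vsum star (fun x => ~ rt x) w + sm w L0 + sm w (map stb RTn))%R.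
Proof.
  intros hw hR hG. rewrite (star_nrt w GL hw hG). pose proof (esum_star w hw) as h.
  destruct hY as (_ & hc & _). specialize (hc w hw).
  assert (e : esum Y remE w = sm w (map est RL)).
  { unfold esum. rewrite sm_map. apply (osum_reps aorb aorb_equiv); [now apply est_finv|assumption]. }
  pose proof (sm_filter rt (fun b => w (stb b)) RT) as k. fold RTr RTn in k.
  rewrite <- !(sm_map stb) in k. lra.
Qed.

(* Leaving the part of [Ga] that flows to translates of [t] uses a removed arc; if its
   stabilizer were as large as that of [t], the flow could be reversed. *)
Lemma removed_subconj t : In t RT -> fin (stb t) -> (exists t', In t' RT /\ t' <> t) ->
  exists e, remE e /\ subconj (est e) (stb t).
Proof.
  intros it ft (t' & it' & ne).
  set (W := fun x => Ga x /\ exists h, H h /\ ch x (ac h t)).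
  assert (gt : forall t, In t RT -> Ga t) by apply hRT.
  assert (zt : forall t h, In t RT -> Zt (ac h t)) by (intros u h i; now exists u, h).
  destruct hr as (_ & h2 & _ & _).
  destruct (wk_exit _ W _ _ (h2 t t' (gt t it) (gt t' it'))) as (x & y & (a & gx & gy) & [_ (h & hh & wx)] & ny).
  - split; [auto|]. exists e1. split; [apply sub1, setstab_sub|]. rewrite ac1. apply wk0.
  - intros [_ (h & hh & w)]. apply ne. apply (RT_uniq t t' (iv h) it it').
    + apply subV; [apply setstab_sub|assumption].
    + apply (chain_Z (spread Y Ga) Zt sg) in w; [|rewrite <- (ac1 _ t'); auto]. rewrite <- w, acK. apply wk0.
  - exists (x, y). assert (hrem : rem x y).
    { split; [assumption|split; [now apply inside_in|]]. intros c. apply ny. split; [assumption|].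
      exists h. split; [assumption|]. apply ta_char in c. destruct c as [(p & q & ->)|c].
      - apply (chain_hd (spread Y Ga) Zt sg) in wx; auto.
      - now apply (wkS _ x). }
    split; [exact hrem|]. destruct (ch_dG _ _ gx wx) as [gz wz].
    pose proof (dG_adj _ _ wz) as sz.
    assert (fz : fin (stb (ac h t))) by (rewrite stb_ac; now apply cj_fin).
    assert (iE : incl (est (x, y)) (stb (ac h t))) by (intros g [k _]; auto).
    destruct (incl_subconj _ _ (est_sub (x, y)) (stb_sub (ac h t)) (fin_incl _ _ iE fz) iE) as [u|u].
    + apply (subconj_same_r _ (stb (ac h t))); [apply stb_sub| |assumption].
      right. exists (iv h). now rewrite stb_ac, cjK.
    + exfalso. apply ny. split; [assumption|].
      destruct (chain_ex _ _ _ sg ht HS y (spread_in Y Ga y gy)) as (z & _ & zz & w).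
      destruct (ch_dG _ _ gy w) as [gz' wz']. destruct (Zt_in z gz' zz) as (t2 & g & i & hg & ->).
      assert (L : wk dG (ac h t) (ac g t2)).
      { apply (wk_trans _ _ x).
        - apply ch_back; auto. rewrite u. now intros k [].
        - apply (wkS _ y); [|assumption]. split; [split; [assumption|]|now split].
          intros k hk. apply sz in hk. rewrite u in hk. apply hk. }
      apply (dG_ac (iv h)) in L; [|apply subV; [apply setstab_sub|assumption]].
      rewrite acK, <- acM in L. apply RT_uniq in L; auto.
      * subst t2. now exists g.
      * apply subM; [apply setstab_sub| |assumption]. apply subV; [apply setstab_sub|assumption].
Qed.

(** If nothing is removed, all arcs of the region are parent arcs, and connectedness makes every
    chain end at one vertex [z]. It is the only point of [Zt] in the region, hence fixed by
    [setstab], and chains are dead paths, hence fixed by whatever fixes their origin. *)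
Lemma hub_fixconn : (forall e, ~ remE e) -> fixconn Y Ga.
Proof.
  intros nroots B sB fB hB. destruct hr as ([x0 gx0] & h2 & _ & _).
  destruct (chain_ex _ _ _ sg ht HS x0 (spread_in Y Ga x0 gx0)) as (z & _ & zz & w0).
  destruct (ch_dG _ _ gx0 w0) as [gz _].
  assert (all : forall x, Ga x -> ch x z).
  { intros x gx. apply NNPP. intros n.
    destruct (wk_exit _ (fun x => Ga x /\ ch x z) _ _ (h2 x0 x gx0 gx)) as
      (a & b & (p & ga & gb) & [_ wa] & nb); [now split|tauto|].
    apply nb. split; [assumption|].
    assert (c : ta (a, b)).
    { apply NNPP. intros c. apply (nroots (a, b)). split; [assumption|split; [|assumption]].
      now apply inside_in. }
    apply ta_char in c. destruct c as [(q & r & ->)|c].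
    - now apply (chain_hd (spread Y Ga) Zt sg).
    - now apply (wkS _ a). }
  exists z. split; [assumption|split].
  - intros g hg. unfold stb.
    assert (zg : Zt (ac g z)) by now apply Zt_ac.
    symmetry. apply (chain_Z (spread Y Ga) Zt sg _ _ (all _ (proj1 (hB g hg z) gz)) zg).
  - intros x E gx sE hE hx. destruct (ch_dG _ _ gx (all x gx)) as [_ w].
    clear - w hx. induction w as [x|x y z ([p q] & r) w IH]; [apply wk0|].
    assert (hy : incl E (stb y)) by (intros g hg; auto).
    apply (wkS _ y); [|auto]. split; [assumption|]. tauto.
Qed.

Lemma hub_minimal_fixconn : KK H -> fixconn Y Ga.
Proof.
  intros hK. pose proof (star_good hK) as hg.
  destruct (classic (exists e, remE e)) as [[e0 he0]|n]; [|apply hub_fixconn; intros e he; apply n; now exists e].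
  exfalso.
  destruct (osum_list aorb aorb_equiv remE remE_inv) as (RL & hRL & _).
  { apply efin_sub. now intros e [h _]. }
  destruct roots_spread as (GL & hGL & hF).
  assert (hc : forall w, clw w -> (esum star (adjE star) w + sm w (map est RL) + sm w (map stb GL) =
     vsum star (fun x => ~ rt x) w + sm w L0 + sm w (map stb RTn))%R).
  { intros w hw. now apply star_cost. }
  destruct hRL as (r1 & r2 & _).
  assert (rin : forall e K, remE e -> subconj (est e) K -> exists x, In x (map est RL) /\ subconj x K).
  { intros [a b] K he hu. destruct (r2 _ he) as ([c d] & i & j). exists (est (c, d)).
    split; [now apply in_map|]. apply (subconj_same_l (est (a, b))); [apply est_sub| |assumption].
    apply same_sym. right. now apply ar_same. }
  assert (rne : map est RL <> []).
  { destruct (r2 _ he0) as (e & i & _). destruct RL; easy. }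
  assert (fn : forall t, In t RTn -> In t RT /\ ~ rt t /\ fin (stb t)).
  { intros t h. apply filter_dec in h. destruct h as [h k]. split; [assumption|split; [assumption|]].
    apply NNPP. intros c. now apply k, RTinf. }
  (* If every nonroot top lies above some removed arc group, the gains outweigh the expenses and
     coning lowers the cost. *)
  destruct (classic (forall t, In t RTn -> exists e, remE e /\ subconj (est e) (stb t))) as [c|c].
  - apply (minimal_no_gain KK L0 minL star (map est RL ++ map stb GL) (map stb RTn) hg).
    + intros e. apply app_eq_nil in e. now destruct e.
    + intros K hKi. apply in_map_iff in hKi. destruct hKi as (t & <- & i).
      destruct (c t i) as (e & he & hu). destruct (rin e _ he hu) as (x & ix & ux).
      exists x. split; [apply in_app_iff; now left|assumption].
    + intros w hw. rewrite sm_app, <- Rplus_assoc. now apply hc.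
  (* Otherwise [removed_subconj] makes [t] the only top. Everything then flows to translates of [t],
     so each removed group is subconjugate to that of [t], and not being smaller it is equal up to
     [same]. *)
  - apply not_all_ex_not in c. destruct c as [t c]. apply imply_to_and in c. destruct c as [it c].
    destruct (fn t it) as (iR & nroots & ft).
    assert (ut : forall t', In t' RT -> t' = t).
    { intros t' i'. apply NNPP. intros ne. apply c. apply removed_subconj; auto. now exists t'. }
    assert (eR : RT = [t]).
    { assert (f := RT_fop). destruct RT as [|a [|b l]].
      - destruct iR.
      - f_equal. apply ut. now left.
      - exfalso. inversion f as [|? ? f1 f2]; subst. rewrite Forall_forall in f1.
        apply (f1 b (or_introl eq_refl) e1); [apply sub1, setstab_sub|].
        rewrite ac1, (ut a), (ut b); simpl; auto. }
    assert (en : RTn = [t]).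
    { unfold RTn in *. rewrite eR in *. simpl in *.
      destruct (dec (fun x : Y => ~ rt x) t); [reflexivity|easy]. }
    assert (er : RTr = []).
    { unfold RTr. rewrite eR. simpl. destruct (dec rt t) eqn:e; [|reflexivity].
      apply (proj1 (dec_true _ _)) in e. easy. }
    assert (sm1 : forall e, remE e -> same (est e) (stb t)).
    { intros [a b] (p & (g & ga & gb) & q). simpl in *.
      destruct hRT as [_ k]. destruct (k _ ga) as (t' & h & i & hh & w).
      rewrite (ut t' i) in w. apply dG_adj in w.
      assert (i1 : incl (cj (iv h ** g) (est (a, b))) (stb t)).
      { rewrite cjM. apply cj_incl_iff. rewrite ivK, <- stb_ac, <- est_ac. intros m [hm _]. auto. }
      destruct (incl_cj_subconj (est (a, b)) (stb t) _ (est_sub _) (stb_sub t)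
        (proj1 (cj_fin _ _) (fin_incl _ _ i1 ft)) i1) as [u|u].
      - exfalso. apply c. exists (a, b). split; [|assumption]. split; [assumption|split; [|assumption]].
        now exists g.
      - right. now exists (iv h ** g). }
    destruct RL as [|e RL]; [now apply rne|].
    assert (se : same (est e) (stb t)) by (apply sm1, r1; now left).
    (* One removed arc has paid for the hub arc at [t]. Any further gain contradicts [minL]; without
       one the cost is still [L0], but the hub is an additional root, against [minr]. *)
    destruct (classic (map est RL ++ map stb GL = [])) as [z|z].
    + apply app_eq_nil in z. destruct z as [z1 z2]. apply map_eq_nil in z1, z2. subst RL GL.
      assert (hcost : costeq star L0).
      { intros w hw. specialize (hc w hw). rewrite en in hc.
        cbn [map sm fold_right] in hc. rewrite (hw _ _ se) in hc. lra. }
      pose proof (minr star hg hcost) as hm. rewrite (star_nroots [] hF), er in hm. simpl in hm. lra.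
    + apply (minimal_no_gain KK L0 minL star (map est RL ++ map stb GL) [] hg z); [easy|].
      intros w hw. specialize (hc w hw). rewrite en in hc. rewrite sm_app.
      change (sm w (map est (e :: RL))) with (w (est e) + sm w (map est RL))%R in hc.
      change (sm w (map stb [t])) with (w (stb t) + 0)%R in hc. change (sm w []) with 0%R.
      rewrite (hw _ _ se) in hc. lra.
Qed.
End HubRegion.

Section HubLemma.
Context {G : Group} (KK : (G -> Prop) -> Prop) (L0 : list (G -> Prop)) (r0 : R).
Hypothesis KKcj : forall g K, KK K -> KK (cj g K).
Hypothesis minL : forall Y L, good KK Y -> costeq Y L -> ~ mless L L0.
Hypothesis minr : forall Y, good KK Y -> costeq Y L0 -> (nroots Y <= r0)%R.

Lemma elliptic_fixconn (Y : gr G) (Ga : Y -> Prop) : minimal KK L0 r0 Y -> region Y Ga ->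
  KK (setstab Y Ga) -> fixconn Y Ga.
Proof.
  intros hY hr hK. destruct (tops_exist KK L0 r0 Y Ga hY hr) as (RT & h1 & h2 & h3).
  destruct (hub_select Y Ga RT h1) as (sg & ht & hs).
  eapply hub_minimal_fixconn; eauto.
Qed.
End HubLemma.

(** * Descent on [chi] *)

Section Reals.
Local Open Scope R_scope.
(** Well-ordering of [S] by the reversed order. The values of [- chi] have this property, and that
    is what provides a least [chi]. *)
Definition has_maxima (S : R -> Prop) := forall S' : R -> Prop, (forall x, S' x -> S x) ->
  (exists x, S' x) -> exists x, S' x /\ forall y, S' y -> y <= x.

Lemma has_maxima_shift S c : has_maxima S -> has_maxima (fun x => exists u, S u /\ x = c + u).
Proof.
  intros h S' hs [x hx]. destruct (h (fun u => S' (c + u))) as (u & a & b).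
  - intros u hu. destruct (hs _ hu) as (v & hv & e). now replace u with v by lra.
  - exists (x - c). now replace (c + (x - c)) with x by lra.
  - exists (c + u). split; [assumption|]. intros y hy.
    assert (y - c <= u); [|lra]. apply b. now replace (c + (y - c)) with y by lra.
Qed.
Lemma has_maxima_union {A} (l : list A) (F : A -> R -> Prop) : (forall k, In k l -> has_maxima (F k)) ->
  has_maxima (fun x => exists k, In k l /\ F k x).
Proof.
  induction l as [|a l IH]; intros h S' hs hne.
  - destruct hne as [x hx]. destruct (hs x hx) as (k & [] & _).
  - set (S1 := fun x => S' x /\ F a x).
    set (S2 := fun x => S' x /\ exists k, In k l /\ F k x).
    assert (cov : forall x, S' x -> S1 x \/ S2 x).
    { intros x hx. destruct (hs x hx) as (k & [<-|i] & f); [left|right]; split; auto. now exists k. }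
    assert (m1 : (exists x, S1 x) -> exists x, S1 x /\ forall y, S1 y -> y <= x).
    { apply (h a (or_introl eq_refl)). now intros x []. }
    assert (m2 : (exists x, S2 x) -> exists x, S2 x /\ forall y, S2 y -> y <= x).
    { apply IH; [intros k i; apply h; now right|]. now intros x []. }
    destruct (classic (exists x, S1 x)) as [c1|c1], (classic (exists x, S2 x)) as [c2|c2].
    + destruct (m1 c1) as (x1 & p1 & q1), (m2 c2) as (x2 & p2 & q2).
      destruct (Rle_lt_dec x1 x2).
      * exists x2. split; [apply p2|]. intros y hy.
        destruct (cov y hy) as [i|i]; [apply q1 in i|apply q2 in i]; lra.
      * exists x1. split; [apply p1|]. intros y hy.
        destruct (cov y hy) as [i|i]; [apply q1 in i|apply q2 in i]; lra.
    + destruct (m1 c1) as (x1 & p1 & q1). exists x1. split; [apply p1|]. intros y hy.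
      destruct (cov y hy) as [i|i]; [now apply q1|]. exfalso. apply c2. now exists y.
    + destruct (m2 c2) as (x1 & p1 & q1). exists x1. split; [apply p1|]. intros y hy.
      destruct (cov y hy) as [i|i]; [|now apply q1]. exfalso. apply c1. now exists y.
    + destruct hne as [x hx]. exfalso. destruct (cov x hx); [apply c1|apply c2]; now exists x.
Qed.
(** An entry [0] contributes [/ 0 = 0], in accordance with [size] being [0] for infinite groups. *)
Definition inv_sum (l : list nat) := sm (fun k => / INR k) l.
Definition unit_sum (n : nat) (x : R) := exists l, (length l <= n)%nat /\ x = inv_sum l.

Lemma inv_sum_ge0 l : 0 <= inv_sum l.
Proof.
  induction l as [|k l IH]; unfold inv_sum in *; simpl; [lra|].
  assert (0 <= / INR k); [|lra]. destruct k; [simpl; rewrite Rinv_0; lra|].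
  left. apply Rinv_0_lt_compat, lt_0_INR. lia.
Qed.
Lemma inv_sum_big l c : 0 <= c -> (forall k, In k l -> / INR k <= c) -> inv_sum l <= INR (length l) * c.
Proof.
  intros hc h. induction l as [|k l IH]; unfold inv_sum in *; [simpl; lra|].
  change (sm (fun k => / INR k) (k :: l)) with (/ INR k + sm (fun k => / INR k) l).
  simpl length. rewrite S_INR. assert (/ INR k <= c) by (apply h; now left).
  assert (sm (fun k => / INR k) l <= INR (length l) * c) by (apply IH; intros; apply h; now right).
  lra.
Qed.

(* A sum that is at least [s0 > 0] has a term at least [s0 / n], for which there
   are finitely many values; so sets of such sums are well ordered by [>=]. *)
Lemma unit_sums_have_maxima n : has_maxima (unit_sum n).
Proof.
  induction n as [|n IH]; intros S' hs [s0 h0].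
  - assert (z : forall x, S' x -> x = 0).
    { intros x hx. destruct (hs x hx) as (l & a & ->). now destruct l; [|simpl in a; lia]. }
    exists s0. split; [assumption|]. intros y hy. rewrite (z y hy), (z s0 h0). lra.
  - destruct (classic (exists s, S' s /\ 0 < s)) as [(s & hs1 & hs2)|c].
    2:{ exists s0. split; [assumption|]. intros y hy.
        destruct (hs s0 h0) as (l & _ & e). pose proof (inv_sum_ge0 l).
        destruct (Rle_lt_dec y s0); [assumption|]. exfalso. apply c. exists y. split; [assumption|lra]. }
    (* If all of the at most [S n] terms were at most [c], the sum would be at most [s / 2]. So a
       sum that is at least [s] has a term above [c], whose denominator is below [N]. *)
    set (c := s / (2 * INR (S n))).
    assert (hn : 0 < INR (S n)) by (apply lt_0_INR; lia).
    assert (hc : 0 < c) by (apply Rdiv_lt_0_compat; lra).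
    destruct (INR_unbounded (/ c)) as [N hN].
    destruct (has_maxima_union (seq 0 N) (fun k x => exists u, unit_sum n u /\ x = / INR k + u)) with
      (S' := fun x => S' x /\ s <= x) as (x & [hx1 hx2] & hx3).
    + intros k _. now apply has_maxima_shift.
    + intros x [hx hx']. destruct (hs x hx) as (l & hl & ->).
      destruct (classic (exists k, In k l /\ c < / INR k)) as [(k & hk & hk')|no].
      * exists k. split.
        -- apply in_seq. split; [lia|]. simpl. destruct (le_lt_dec N k); [|assumption].
           exfalso. assert (INR N <= INR k) by now apply le_INR.
           assert (0 < / c) by now apply Rinv_0_lt_compat.
           assert (/ INR k <= / / c); [apply Rinv_le_contravar; lra|]. rewrite Rinv_inv in *. lra.
        -- apply in_split in hk. destruct hk as (l1 & l2 & ->). exists (inv_sum (l1 ++ l2)). split.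
           ++ exists (l1 ++ l2). split; [|reflexivity]. rewrite length_app in *. simpl in hl. lia.
           ++ unfold inv_sum. rewrite !sm_app. simpl. lra.
      * exfalso. assert (h : inv_sum l <= INR (length l) * c).
        { apply inv_sum_big; [lra|]. intros k hk. destruct (Rle_lt_dec (/ INR k) c); [assumption|].
          exfalso. apply no. now exists k. }
        assert (INR (length l) <= INR (S n)) by now apply le_INR.
        assert (e : INR (S n) * c = s / 2) by (unfold c; field; lra).
        assert (INR (length l) * c <= INR (S n) * c) by (apply Rmult_le_compat_r; lra). lra.
    + exists s. split; [assumption|lra].
    + exists x. split; [assumption|]. intros y hy. destruct (Rle_lt_dec s y); [auto|lra].
Qed.

Fixpoint sums (vals : list R) (n : nat) : list R :=
  match n with
  | O => [0]
  | S n => sums vals n ++ flat_map (fun v => map (Rplus v) (sums vals n)) vals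
  end.
Lemma sums_0 vals n : In 0 (sums vals n).
Proof. induction n; simpl; auto. apply in_app_iff. auto. Qed.
Lemma sums_in vals n l : (length l <= n)%nat -> (forall v, In v l -> In v vals) ->
  In (sm (fun v => v) l) (sums vals n).
Proof.
  revert l. induction n as [|n IH]; intros l hl hv.
  - destruct l; [now left|simpl in hl; lia].
  - destruct l as [|v l]; [apply sums_0|]. simpl. apply in_app_iff. right.
    apply in_flat_map. exists v. split; [apply hv; now left|].
    apply (in_map (Rplus v)). apply IH; [simpl in hl; lia|]. intros u hu. apply hv. now right.
Qed.
End Reals.

(** * Orbit counts and strict monotonicity of [chi] *)

Section Count.
Context {G : Group} (Y : gr G).
Local Open Scope R_scope.

Lemma sel_est_finv (A : gset G) D dom Z sg ht (HS : @selects G A D dom Z sg ht) w : clw w ->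
  finv vorb (fun x => w (est (x, sg x))).
Proof.
  intros hw x y [g ->]. destruct HS as (_ & _ & h). destruct (h g x) as (k & e & ->).
  rewrite <- e, est_ac. apply hw. right. now exists k.
Qed.

Lemma osum_mono {A} (Rq : A -> A -> Prop) (E : equivalence A Rq) P Q f : finv Rq f ->
  inv Rq P -> inv Rq Q -> ofin Rq Q -> (forall x, P x -> Q x) -> (forall x, Q x -> 0 <= f x) ->
  osum Rq P f <= osum Rq Q f.
Proof.
  intros hf hP hQ hfin hi h0. rewrite (osum_split Rq E Q P f hf hQ hP hfin).
  replace (fun x => Q x /\ P x) with P by (apply pred_ext; intros x; split; [auto|tauto]).
  assert (0 <= osum Rq (fun x => Q x /\ ~ P x) f); [|lra].
  apply (osum_ge0 Rq E).
  - now apply inv_and, inv_not.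
  - apply (ofin_sub Rq _ Q); [tauto|assumption].
  - intros x [a _]. auto.
Qed.

Lemma adj_select (Ga : Y -> Prop) (Z : Y -> Prop) : region Y Ga ->
  (forall g x, Z x -> Z (ac g x)) -> (exists z, Ga z /\ Z z) ->
  exists sg ht, selects (fun a b => adj a b /\ inside Y Ga a b) (spread Y Ga) Z sg ht.
Proof.
  intros hr hZ (z & gz & zz). apply select; auto.
  - intros g x y [a b]. split; [now apply adj_ac|now apply inside_ac].
  - apply spread_ac.
  - intros x [g hg]. exists (ac (iv g) z). split; [auto|]. destruct hr as (_ & h2 & _).
    specialize (h2 _ _ hg gz). rewrite <- (acK g x). revert h2. apply wk_map.
    intros a b (p & q & r). apply wk1. split; [split; [now apply adj_ac|now apply inside_ac, inside_in]|].
    now apply spread_ac, spread_in.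
Qed.

(** By connectedness, every orbit of vertices other than that of [x0] selects an arc towards it, and
    different orbits select different arc orbits. *)
Lemma region_count (Ga : Y -> Prop) : region Y Ga ->
  osum vorb (spread Y Ga) (fun _ => 1) <= osum aorb (arcs_in Y Ga) (fun _ => 1) + 1.
Proof.
  intros hr. pose proof hr as ([x0 h0] & _).
  assert (zac : forall g x, vorb x0 x -> vorb x0 (ac g x)).
  { intros g x [h ->]. exists (g ** h). now rewrite acM. }
  destruct (adj_select Ga (vorb x0) hr zac) as (sg & ht & HS).
  { exists x0. split; [assumption|]. apply vorb_equiv. }
  assert (f1 : forall (A : Type) (Rq : A -> A -> Prop), finv Rq (fun _ => 1)) by (now intros ? ? ? ? ?).
  rewrite (osum_split vorb vorb_equiv (spread Y Ga) (vorb x0) _ (f1 _ _) (spread_inv Y Ga)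
    (inv_ac _ zac) (vfin_sub Y _)).
  rewrite (osum_one vorb vorb_equiv _ x0); [|apply f1| |tauto].
  2:{ split; [now apply spread_in|apply vorb_equiv]. }
  rewrite <- (tarc_sum (fun a b => adj a b /\ inside Y Ga a b) (spread Y Ga) (vorb x0) (spread_ac Y Ga) zac
    sg ht HS (fun _ => 1) (f1 _ _) (vfin G Y)).
  assert (osum aorb (tarc (spread Y Ga) (vorb x0) sg) (fun _ => 1) <= osum aorb (arcs_in Y Ga) (fun _ => 1));
    [|lra].
  apply (osum_mono aorb aorb_equiv); auto.
  - apply tarc_inv.
  - apply arcs_in_inv.
  - apply arcs_in_fin.
  - intros [a b] (x & p & q & r). apply (arcs_in_inv Y Ga (x, sg x)); [exact r|].
    destruct HS as (h & _). now destruct (h x p q).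
  - intros; lra.
Qed.

Lemma whole_region : (forall x y : Y, wk adj x y) -> region Y (fun _ => True).
Proof.
  intros h. destruct (ginh G Y) as [x0]. split; [now exists x0|split; [|split; auto]].
  intros x x' _ _. apply (wk_mono adj); [|apply h]. now intros a b.
Qed.

(** The cost identity for the weight 1 cancels nonroots in the count for the whole graph. For a
    fixed cost the number of roots is thus bounded, so it can be maximised. *)
Lemma nroots_bound KK L : good KK Y -> costeq Y L -> nroots Y <= INR (length L) + 1.
Proof.
  intros (h1 & h2 & _) hc. pose proof (region_count _ (whole_region h1)) as h.
    specialize (hc _ one_clw). rewrite sm_one in hc. unfold esum, vsum in hc. unfold nroots.
    replace (arcs_in Y (fun _ => True)) with (adjE Y) in h.
    2:{ apply pred_ext. intros x. unfold arcs_in. split; [|tauto]. intros k. split; [assumption|]. now exists e1. }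
    rewrite (osum_split vorb vorb_equiv (spread Y (fun _ => True)) rt) in h;
      [|now intros ? ? ?|apply spread_inv|apply inv_ac, rt_ac|apply vfin_sub].
    replace (fun x : Y => spread Y (fun _ => True) x /\ rt x) with (@rt G Y) in h.
    2:{ apply pred_ext. intros x. split; [|tauto]. intros k. split; [now exists e1|assumption]. }
    replace (fun x : Y => spread Y (fun _ => True) x /\ ~ rt x) with (fun x : Y => ~ rt x) in h.
    2:{ apply pred_ext. intros x. split; [|tauto]. intros k. split; [now exists e1|assumption]. }
    lra.
Qed.

(* Vertices of [Ga] outside [De] are matched with outgoing arcs; equality of the sums
   would force everything outside [De] to flow into [De]. *)
Lemma chi_lt (Ga De : Y -> Prop) : region Y Ga -> region Y De -> incl De Ga ->
  ~ incl (setstab Y Ga) (setstab Y De) -> chi Y De < chi Y Ga.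
Proof.
  intros hG hD hi hH. apply Rnot_le_lt. intros le. apply hH. clear hH.
  pose proof hD as ([d0 hd0] & _ & _ & hDinf).
  destruct (adj_select Ga (spread Y De) hG (spread_ac Y De)) as (sg & ht & HS).
  { exists d0. split; [auto|now apply spread_in]. }
  set (out := fun x => spread Y Ga x /\ ~ spread Y De x).
  set (ta := tarc (spread Y Ga) (spread Y De) sg).
  set (oth := fun e => (arcs_in Y Ga e /\ ~ inside Y De (fst e) (snd e)) /\ ~ ta e).
  assert (i1 : inv aorb (fun e => arcs_in Y Ga e /\ ~ inside Y De (fst e) (snd e))).
  { apply inv_and; [apply arcs_in_inv|]. apply (inv_not _ aorb_equiv), inside_inv. }
  assert (i2 : inv aorb oth).
  { apply inv_and; [assumption|]. apply (inv_not _ aorb_equiv), tarc_inv. }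
  assert (i3 : inv vorb out).
  { apply inv_and; [apply spread_inv|]. apply (inv_not _ vorb_equiv), spread_inv. }
  assert (f2 : ofin aorb oth) by (apply efin_sub; now intros e [[[? _] _] _]).
  assert (sgD : forall x, out x -> adj x (sg x) /\ inside Y Ga x (sg x) /\ spread Y Ga (sg x) /\ ht x = S (ht (sg x))).
  { intros x [a b]. destruct HS as (h & _). destruct (h x a b) as ([p q] & r & s). auto. }
  (* The excess of [chi] is a difference of sums that is nonnegative term by term, plus a sum of
     nonnegative weights; under [le] all these terms vanish. *)
  assert (E : chi Y Ga = chi Y De + (osum vorb out (fun x => wt (est (x, sg x))) -
     osum vorb out (fun x => wt (stb x))) + osum aorb oth (fun e => wt (est e))).
  { unfold chi, esum, vsum.
    rewrite (osum_split aorb aorb_equiv (arcs_in Y Ga) (fun e => inside Y De (fst e) (snd e)) _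
      (est_finv wt wt_clw) (arcs_in_inv Y Ga) (inside_inv Y De) (arcs_in_fin Y Ga)).
    rewrite (osum_split aorb aorb_equiv (fun e => arcs_in Y Ga e /\ ~ inside Y De (fst e) (snd e)) ta _
      (est_finv wt wt_clw) i1 (tarc_inv _ _ _)); [|apply efin_sub; now intros e [[? _] _]].
    rewrite (osum_split vorb vorb_equiv (spread Y Ga) (spread Y De) _ (stb_finv wt wt_clw) (spread_inv Y Ga)
      (spread_inv Y De) (vfin_sub Y _)).
    fold oth out.
    replace (fun e => arcs_in Y Ga e /\ inside Y De (fst e) (snd e)) with (arcs_in Y De).
    2:{ apply pred_ext. intros e. unfold arcs_in. split; [|tauto]. intros [a (g & b & c)].
        split; [split; [assumption|]|]; exists g; auto. }
    replace (fun x => spread Y Ga x /\ spread Y De x) with (spread Y De).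
    2:{ apply pred_ext. intros x. split; [|tauto]. intros [g hg]. split; exists g; auto. }
    replace (fun e => (arcs_in Y Ga e /\ ~ inside Y De (fst e) (snd e)) /\ ta e) with ta.
    - unfold ta. rewrite (tarc_sum _ (spread Y Ga) (spread Y De) (spread_ac Y Ga) (spread_ac Y De) sg ht HS
        _ (est_finv wt wt_clw) (vfin G Y)). fold out. lra.
    - apply pred_ext. intros [a b]. split; [|tauto]. intros k. split; [|assumption].
      destruct k as (x & p & q & r). apply (i1 (x, sg x)); [exact r|].
      destruct (sgD x (conj p q)) as (a1 & a2 & _). split; [split; assumption|].
      intros (g & c & _). apply q. now exists g. }
  assert (le1 : forall x, out x -> wt (stb x) <= wt (est (x, sg x))).
  { intros x _. apply wt_le; [apply est_sub|apply stb_sub|]. now intros g []. }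
  assert (S0 : 0 <= osum aorb oth (fun e => wt (est e))).
  { apply (osum_ge0 aorb aorb_equiv); auto. intros e _. apply wt_ge0, est_sub. }
  assert (S1 : osum vorb out (fun x => wt (stb x)) <= osum vorb out (fun x => wt (est (x, sg x)))).
  { apply (osum_le vorb vorb_equiv); auto. apply vfin_sub. }
  assert (eq1 : forall x, out x -> wt (stb x) = wt (est (x, sg x))).
  { intros x hx. destruct (Rle_lt_or_eq_dec _ _ (le1 x hx)) as [l|e]; [|assumption]. exfalso.
    assert (osum vorb out (fun x => wt (stb x)) < osum vorb out (fun x => wt (est (x, sg x)))); [|lra].
    apply (osum_lt vorb vorb_equiv out _ _ x); auto; [apply vfin_sub|apply stb_finv, wt_clw|].
    apply (sel_est_finv _ _ _ _ _ _ HS), wt_clw. }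
  assert (inf1 : forall e, oth e -> ~ fin (est e)).
  { intros e he f. assert (0 < osum aorb oth (fun e => wt (est e))); [|lra].
    rewrite <- (osum_zero aorb aorb_equiv oth i2 f2).
    apply (osum_lt aorb aorb_equiv oth _ _ e); auto.
    - now intros ? ? ?.
    - apply est_finv, wt_clw.
    - intros; apply wt_ge0, est_sub.
    - apply wt_pos; [apply est_sub|assumption]. }
  (* The arc from [x] to [sg x] has a finite group: if [sg x] lies in a translate of [De], an
     infinite arc would pull [x] into that translate; if not, [stb (sg x)] is finite by induction.
     Equal weights then force [stb x] to be finite. *)
  assert (fout : forall n x, ht x = n -> out x -> fin (stb x)).
  { intros n. induction n as [n IH] using lt_wf_ind. intros x hn hx.
    assert (fe : fin (est (x, sg x))).
    { destruct (sgD x hx) as (a & b & c & d). apply NNPP. intros f.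
      destruct (classic (spread Y De (sg x))) as [[g hg]|no].
      - apply (proj2 hx). exists g. apply (hDinf (ac g (sg x)) (ac g x) hg).
        + apply adj_ac. now apply adj_sym.
        + rewrite est_ac, est_flip. now rewrite cj_fin.
      - apply f. apply (fin_incl _ (stb (sg x))); [now intros k []|].
        apply (IH (ht (sg x))); [lia|reflexivity|]. now split. }
    apply NNPP. intros f. pose proof (wt_pos _ (est_sub (x, sg x)) fe) as h.
    rewrite <- (eq1 x hx), (wt_inf _ f) in h. lra. }
  assert (dd : forall x, spread Y Ga x -> ~ spread Y De x -> incl (stb x) (stb (sg x))).
  { intros x a b. pose proof (eq1 x (conj a b)) as e. unfold wt in e. apply Rinv_eq_reg, INR_eq in e.
    assert (h : incl (stb x) (est (x, sg x))).
    { apply size_ge_incl; [now intros g []|eapply fout; [reflexivity|now split]|lia]. }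
    intros g hg. now destruct (h g hg). }
  assert (arcs : forall a b, adj a b -> Ga a -> Ga b -> ~ inside Y De a b -> ta (a, b)).
  { intros a b p ga gb no. apply NNPP. intros nt.
    assert (ho : oth (a, b)) by (split; [split; [split; [assumption|now apply inside_in]|assumption]|assumption]).
    pose proof (inf1 _ ho) as f.
    assert (ka : spread Y De a).
    { apply NNPP. intros c. apply f. apply (fin_incl _ (stb a)); [now intros k []|].
      eapply fout; [reflexivity|]. split; [now apply spread_in|assumption]. }
    destruct ka as [g hg]. apply no. exists g. split; [assumption|].
    apply (hDinf _ _ hg); [now apply adj_ac|]. rewrite est_ac. now rewrite cj_fin. }
  (* All arcs of [Ga] that lie in no translate of [De] are dead parent arcs by now, so connectedness
     sends every vertex into [De] itself and not merely into some translate. *)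
  assert (all : forall x, Ga x -> exists z, De z /\ wk (cstep (spread Y Ga) (spread Y De) sg) x z).
  { intros x gx. apply NNPP. intros no. pose proof hG as (_ & hc & _).
    destruct (wk_exit _ (fun x => exists z, De z /\ wk (cstep (spread Y Ga) (spread Y De) sg) x z)
      _ _ (hc d0 x (hi _ hd0) gx)) as (a & b & (p & ga & gb) & (z & dz & w) & nb);
      [exists d0; split; [assumption|apply wk0]|assumption|].
    apply nb. destruct (classic (inside Y De a b)) as [i|i].
    - assert (e : z = a).
      { apply (chain_Z _ _ _ _ _ w). destruct i as (g & k & _). now exists g. }
      subst z. exists b. split; [now apply (inside_r Y De a)|apply wk0].
    - exists z. split; [assumption|]. pose proof (arcs a b p ga gb i) as c.
      apply (tarc_dead _ (spread Y Ga) (spread Y De) (spread_ac Y Ga) (spread_ac Y De) sg ht HS dd) in c.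
      destruct c as [(q & r & ->)|c]; [|now apply (wkS _ a)].
      apply (chain_hd (spread Y Ga) (spread Y De) sg); auto. now apply spread_in. }
  (* The vertex [ac h d0] lies in a translate of [De], where chains stop, and yet flows into [De];
     so it is in [De] already. *)
  intros h hh. apply (region_setstab Y De h d0 hD hd0).
  destruct (all (ac h d0)) as (z & dz & w); [apply (proj1 (hh d0)); auto|].
  rewrite <- (chain_Z _ _ _ _ _ w); [assumption|]. now apply spread_ac, spread_in.
Qed.
End Count.

Section ChiValues.
Context {G : Group} (KK : (G -> Prop) -> Prop) (L0 : list (G -> Prop)) (r0 : R).
Local Open Scope R_scope.

(** A vertex whose parent arc stays inside cancels with that arc. What remains are leftover arcs,
    with groups from [L0], and top vertices, of which [region_count] allows at most one more than
    there are such arcs. *)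
Lemma chi_form (Y : gr G) (Ga : Y -> Prop) : minimal KK L0 r0 Y -> region Y Ga ->
  exists p q, chi Y Ga = p - q /\ In p (sums (map wt L0) (length L0)) /\
    unit_sum (S (length L0)) q.
Proof.
  intros (hg & hc & _) hr. destruct (parents KK Y hg) as (sg & ht & HS).
  destruct (links_list _ _ _ HS) as (l & hl & hl').
  set (ta := tarc (fun _ : Y => True) rt sg) in *.
  assert (meL : meq (map est l) L0).
  { intros w hw. specialize (hc w hw). specialize (hl' w hw). lra. }
  assert (dd : forall x : Y, True -> ~ rt x -> incl (stb x) (stb (sg x))).
  { intros x a b. destruct HS as (h & _). now destruct (h x a b) as ([_ k] & _). }
  assert (iT : inv aorb ta) by apply tarc_inv.
  set (lnk := fun e => adjE Y e /\ ~ ta e).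
  assert (iL : inv aorb lnk) by (apply inv_and; [apply adjE_inv|now apply (inv_not _ aorb_equiv)]).
  set (rest := fun e => arcs_in Y Ga e /\ ~ ta e).
  assert (iR : inv aorb rest) by (apply inv_and; [apply arcs_in_inv|now apply (inv_not _ aorb_equiv)]).
  assert (fR : ofin aorb rest) by (apply efin_sub; now intros e [[? _] _]).
  set (Tn := fun x => ~ rt x /\ inside Y Ga x (sg x)).
  assert (iTn : inv vorb Tn).
  { apply inv_ac. intros g x [a b]. split; [now apply nrt_ac|].
    rewrite (sg_ac _ (fun _ => True) rt sg ht HS dd); auto. now apply inside_ac. }
  set (top := fun x => spread Y Ga x /\ ~ Tn x).
  assert (iTop : inv vorb top) by (apply inv_and; [apply spread_inv|now apply (inv_not _ vorb_equiv)]).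
  assert (trT : forall x, Tn x -> spread Y Ga x) by (intros x [_ (g & a & _)]; now exists g).
  assert (sumA : forall F, finv aorb F -> osum aorb (arcs_in Y Ga) F =
    osum vorb Tn (fun x => F (x, sg x)) + osum aorb rest F).
  { intros F hF. rewrite (osum_split aorb aorb_equiv (arcs_in Y Ga) ta F hF (arcs_in_inv Y Ga) iT
      (arcs_in_fin Y Ga)). f_equal. symmetry.
    apply (osum_map vorb aorb vorb_equiv aorb_equiv _ _ (fun x => (x, sg x))); auto; [apply vfin_sub| |].
    - intros x y [a _] [b _]. now apply (sel_vorb _ (fun _ => True) rt sg ht HS).
    - intros e. split.
      + intros [[a b] (x & _ & c & d)]. exists x. split; [|exact d]. split; [assumption|].
        apply (inside_inv Y Ga e (x, sg x)); [|assumption]. now apply (equiv_sym _ _ aorb_equiv).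
      + intros (x & [a b] & d). split.
        * apply (arcs_in_inv Y Ga (x, sg x)); [assumption|]. split; [|assumption].
          destruct HS as (h & _). now destruct (h x I a) as ([k _] & _).
        * exists x. split; [exact I|split; [assumption|exact d]]. }
  assert (sumV : forall F, finv vorb F -> osum vorb (spread Y Ga) F = osum vorb Tn F + osum vorb top F).
  { intros F hF. rewrite (osum_split vorb vorb_equiv (spread Y Ga) Tn F hF (spread_inv Y Ga) iTn (vfin_sub Y _)).
    f_equal. f_equal. apply pred_ext. intros x. split; [tauto|auto]. }
  destruct (osum_list aorb aorb_equiv rest iR fR) as (RL & (a1 & a2 & a3) & sR).
  destruct (osum_list vorb vorb_equiv top iTop (vfin_sub Y _)) as (TL & _ & sT).
  assert (f1 : forall (A : Type) (Rq : A -> A -> Prop), finv Rq (fun _ => 1)) by (now intros ? ? ? ? ?).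
  assert (nL : length l = length L0).
  { specialize (meL _ one_clw). rewrite !sm_one in meL. apply INR_eq in meL. now rewrite length_map in meL. }
  assert (nR : (length RL <= length L0)%nat).
  { rewrite <- nL. apply INR_le. rewrite <- !sm_one, <- sR.
    rewrite <- (osum_reps aorb aorb_equiv lnk (fun _ => 1) l (f1 _ _) hl).
    apply (osum_mono aorb aorb_equiv); auto.
    - apply efin_sub. now intros e [].
    - intros e [[a _] b]. now split.
    - intros; lra. }
  assert (nT : (length TL <= S (length L0))%nat).
  { apply INR_le. rewrite S_INR. pose proof (region_count Y Ga hr) as h.
    rewrite (sumA _ (f1 _ _)), (sumV _ (f1 _ _)), sR, sT, !sm_one in h.
    apply le_INR in nR. lra. }
  exists (sm (fun v => v) (map (fun e => wt (est e)) RL)), (inv_sum (map (fun x => size (stb x)) TL)).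
  split; [|split].
  - unfold chi, esum, vsum. rewrite (sumA _ (est_finv wt wt_clw)), (sumV _ (stb_finv wt wt_clw)).
    rewrite sR, sT. unfold inv_sum. rewrite !sm_map. unfold wt at 3. unfold wt at 4.
    replace (osum vorb Tn (fun x => wt (est (x, sg x)))) with (osum vorb Tn (fun x => wt (stb x))).
    + unfold wt. lra.
    + apply osum_ext; [apply vorb_equiv|tauto|assumption|apply vfin_sub|].
      intros x [a _]. unfold est. simpl. now rewrite cap_l by now apply dd.
  - apply sums_in; [now rewrite length_map|]. intros v hv. apply in_map_iff in hv.
    destruct hv as (e & <- & he). apply a1 in he.
    destruct hl as (b1 & b2 & _). destruct (b2 e) as (e' & ie' & oe).
    { destruct he as [[c _] d]. now split. }
    assert (se : same (est e) (est e')).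
    { apply same_sym. right. destruct e, e'. now apply ar_same. }
    destruct (ind_pos (est e) L0) as (K & iK & sK).
    { rewrite <- (meL _ (ind_clw (est e))). apply (ind_in _ (est e')); [now apply in_map|assumption]. }
    rewrite (wt_clw _ _ sK). now apply in_map.
  - exists (map (fun x => size (stb x)) TL). split; [now rewrite length_map|reflexivity].
Qed.

Lemma chi_min (Bad : forall Y : gr G, (Y -> Prop) -> Prop) :
  (forall Y Ga, Bad Y Ga -> minimal KK L0 r0 Y /\ region Y Ga) ->
  (exists Y Ga, Bad Y Ga) ->
  exists Y Ga, Bad Y Ga /\ forall Y' Ga', Bad Y' Ga' -> chi Y Ga <= chi Y' Ga'.
Proof.
  intros h (Y0 & G0 & hb).
  destruct (has_maxima_union (sums (map wt L0) (length L0))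
    (fun p x => exists q, unit_sum (S (length L0)) q /\ x = - p + q)) with
    (S' := fun x => exists Y Ga, Bad Y Ga /\ x = - chi Y Ga) as (x & (Y & Ga & hY & ->) & hx).
  - intros p _. apply has_maxima_shift, unit_sums_have_maxima.
  - intros x (Y & Ga & hY & ->). destruct (h Y Ga hY) as [a b].
    destruct (chi_form Y Ga a b) as (p & q & e & i & u). exists p. split; [assumption|].
    exists q. split; [assumption|]. lra.
  - now exists (- chi Y0 G0), Y0, G0.
  - exists Y, Ga. split; [assumption|]. intros Y' Ga' hb'.
    assert (- chi Y' Ga' <= - chi Y Ga) by (apply hx; now exists Y', Ga'). lra.
Qed.
End ChiValues.

(** * Normalising over a tree *)

Section Potential.
Context {G : Group} (T : GTree G).

(** For [E] fixing the edges, each term is at least 2, so [pred] in [phi] really subtracts one from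
    every arc that crosses an edge: cutting an arc in two saves one even if no group grows, and
    dropping an edge always saves something. Enlarging [E] lowers each term. *)
Definition esize (E : G -> Prop) (p : list (egs T)) : nat :=
  list_sum (map (fun q => 4 * size (stb q) - 2 * size E) p).
(* Every orbit of arcs pays for the edges crossed by its image, counted with weights that
   make arcs of length one with large stabilizers cheapest. *)
Definition phi {A : gset G} (f : A -> vgs T) (e : A * A) : nat :=
  pred (esize (est e) (gp T (f (fst e)) (f (snd e)))).

Lemma stb_rv q : stb (rv T q) = stb q.
Proof.
  apply pred_ext. intros g. unfold stb. rewrite <- (rv_ac T g q). split; intros h; [|now rewrite h].
  rewrite <- (rvK T (ac g q)), h. apply rvK.
Qed.
Lemma esize_rpath E p : esize E (rpath T p) = esize E p.
Proof.
  induction p as [|q p IH]; [reflexivity|]. rewrite rpath_cons. unfold esize in *.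
  rewrite map_app, list_sum_app, IH. simpl. rewrite stb_rv. lia.
Qed.
Lemma phi_flip {A : gset G} (f : A -> vgs T) x y : phi f (y, x) = phi f (x, y).
Proof. unfold phi. simpl. now rewrite (gp_rev T (f x) (f y)), esize_rpath, est_flip. Qed.
Lemma phi_ac {A : gset G} (f : A -> vgs T) g x y : equi f ->
  phi f (ac g x, ac g y) = phi f (x, y).
Proof.
  intros hf. unfold phi. simpl. rewrite !hf, gp_ac, est_ac. f_equal. unfold esize.
  rewrite map_map. f_equal. apply map_ext. intros q. rewrite (stb_ac (A := egs T)). now rewrite !cj_size.
Qed.
Lemma phi_finv {A : gset G} (f : A -> vgs T) : equi f -> finv aorb (fun e => INR (phi f e)).
Proof.
  intros hf [x y] [a b] [g [[e e']|[e e']]]; simpl in *; subst; f_equal; symmetry.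
  - now apply phi_ac.
  - rewrite <- (phi_flip f x y). now apply phi_ac.
Qed.

Lemma est_gp {A : gset G} (f : A -> vgs T) x y q : equi f -> In q (gp T (f x) (f y)) ->
  incl (est (x, y)) (stb q).
Proof.
  intros hf hq g [h1 h2]. apply (gp_fix T g (f x) (f y)); [|apply (equi_stb f y hf g h2)|assumption].
  apply (equi_stb f x hf g h1).
Qed.
End Potential.

Section ZeroComponents.
Context {G : Group} (T : GTree G) (hT : forall q : egs T, fin (stb q)).
Context (Y : gr G) (Ga : Y -> Prop) (f : Y -> vgs T) (hr : region Y Ga) (hf : equi f).

(* [zc x] is the component of [x] under the arcs that collapse in the tree. *)
Definition zadj (a b : Y) := adj a b /\ f a = f b.
Definition zc (x : Y) : Y -> Prop := wk (rs zadj Ga) x.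

Lemma zc_refl x : zc x x. Proof. apply wk0. Qed.
Lemma zc_sym x y : zc x y -> zc y x.
Proof.
  apply wk_sym. intros a b ([p q] & r & s). repeat split; auto. now apply adj_sym.
Qed.
Lemma zc_trans x y z : zc x y -> zc y z -> zc x z.
Proof. apply wk_trans. Qed.
Lemma zc_in x y : Ga x -> zc x y -> Ga y.
Proof. intros h k. now apply (wk_in zadj Ga x y). Qed.
Lemma zc_f x y : zc x y -> f y = f x.
Proof. induction 1 as [|x y z ([_ h] & _) _ IH]; congruence. Qed.
Lemma zc_ac g x y : setstab Y Ga g -> zc x y -> zc (ac g x) (ac g y).
Proof.
  intros hg. apply wk_map. intros a b ([p q] & r & s). apply wk1. split; [split|split].
  - now apply adj_ac.
  - now rewrite !hf, q.
  - now apply (proj1 (hg a)).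
  - now apply (proj1 (hg b)).
Qed.
Lemma est_fin x y : f x <> f y -> fin (est (x, y)).
Proof.
  intros h. destruct (gp T (f x) (f y)) as [|q p] eqn:e; [now apply gp_nil in e|].
  apply (fin_incl _ (stb q)); [|apply hT]. apply (est_gp T f x y q hf). rewrite e. now left.
Qed.
(** Edge groups of the tree are finite, so an arc with infinite group crosses no edge and stays
    within its component. *)
Lemma zc_region x : Ga x -> region Y (zc x).
Proof.
  intros hx. split; [|split; [|split]].
  - exists x. apply zc_refl.
  - intros a b ha hb. assert (h : zc a b) by (apply (zc_trans _ x); [now apply zc_sym|assumption]).
    clear hb. induction h as [a|a c b (p & q & r) _ IH]; [apply wk0|].
    assert (hc : zc x c) by (apply (zc_trans _ a); [assumption|now apply wk1]).
    apply (wkS _ c); [|auto]. split; [apply p|now split].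
  - intros g a ha hga u hu. assert (hg : setstab Y Ga g).
    { apply (region_setstab Y Ga g a hr); eapply zc_in; eauto. }
    apply (zc_trans _ (ac g a)); [assumption|]. apply zc_ac; [assumption|].
    apply (zc_trans _ x); [now apply zc_sym|assumption].
  - intros a b ha hab hi. assert (ga : Ga a) by (eapply zc_in; eauto).
    apply (zc_trans _ a); [assumption|]. apply wk1. split; [split; [assumption|]|split; [assumption|]].
    + apply NNPP. intros c. now apply hi, est_fin.
    + destruct hr as (_ & _ & _ & h4). now apply (h4 a b).
Qed.
Lemma zc_setstab x g : Ga x -> zc x (ac g x) -> setstab Y (zc x) g.
Proof. intros hx h. apply (region_setstab Y (zc x) g x (zc_region x hx) (zc_refl x) h). Qed.
Lemma zc_setstab_f x : incl (setstab Y (zc x)) (stb (f x)).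
Proof.
  intros g hg. unfold stb. rewrite <- hf. apply zc_f. apply (proj1 (hg x)), zc_refl.
Qed.
(** The stabilizer of the component fixes [f x], while that of [Ga] fixes no vertex; so the
    hypothesis of [chi_lt] on stabilizers holds. *)
Lemma zc_chi x : Ga x -> (~ exists v : vgs T, incl (setstab Y Ga) (stb v)) ->
  (chi Y (zc x) < chi Y Ga)%R.
Proof.
  intros hx hn. apply chi_lt; [assumption|now apply zc_region| |].
  - intros y. now apply zc_in.
  - intros c. apply hn. exists (f x). intros g hg. now apply zc_setstab_f, c.
Qed.
End ZeroComponents.

(** * Lowering the potential by slides *)

Section Normal.
Context {G : Group} (KK : (G -> Prop) -> Prop) (L0 : list (G -> Prop)) (r0 : R).
Hypothesis KKfin : forall K, sub K -> fin K -> KK K.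
Hypothesis wf_subconj : well_founded (fun K' K : G -> Prop => subconj K K').
Hypothesis minL : forall Y L, good KK Y -> costeq Y L -> ~ mless L L0.
Context (T : GTree G) (hT : forall q : egs T, fin (stb q)).
Context (c : R).
Hypothesis smallQ : forall Y De, minimal KK L0 r0 Y -> region Y De -> (chi Y De < c)%R -> fixconn Y De.

(** The modifications keep [chi] equal to [c] and the region nonelliptic, so at every stage the
    collapsed components lie below [c] and [smallQ] applies to them. *)
Record state := mkstate {
  sY : gr G; sG : sY -> Prop; sf : sY -> vgs T;
  s_minimal : minimal KK L0 r0 sY; s_reg : region sY sG; s_equi : equi sf; s_chi : chi sY sG = c;
  s_ell : ~ exists v : vgs T, incl (setstab sY sG) (stb v) }.

Definition Phi (s : state) := osum aorb (arcs_in (sY s) (sG s)) (fun e => INR (phi T (sf s) e)).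
Definition leads (s s' : state) := (fixconn (sY s') (sG s') -> fixconn (sY s) (sG s)) /\
  ((forall x, sG s x) -> forall x, sG s' x).

Lemma Phi_nat s : exists n, Phi s = INR n.
Proof.
  destruct (osum_list aorb aorb_equiv _ (arcs_in_inv (sY s) (sG s)) (arcs_in_fin (sY s) (sG s))) as (l & _ & e).
  unfold Phi. rewrite e. apply sm_INR.
Qed.
Lemma state_fixconn s x : sG s x -> fixconn (sY s) (zc T (sY s) (sG s) (sf s) x).
Proof.
  intros hx. apply smallQ; [apply s_minimal|apply zc_region; auto using s_reg, s_equi|].
  rewrite <- (s_chi s). apply zc_chi; auto using s_reg, s_equi, s_ell.
Qed.

(** Arcs cross at most one edge, and the group of a crossing arc is the largest that the edge and
    the component of its origin permit. *)
Definition norm1 (s : state) := forall (x y : sY s) q p, sG s x -> sG s y -> adj x y ->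
  gp T (sf s x) (sf s y) = q :: p ->
  p = [] /\ forall g, ac g q = q -> zc T (sY s) (sG s) (sf s) x (ac g x) -> est (x, y) g.
(** Local injectivity after collapsing the components: no two arcs leave a component over the same
    edge, so nothing is left to fold. *)
Definition norm2 (s : state) := forall (x y z b : sY s) q p p', sG s x -> sG s y -> adj x y ->
  sG s z -> sG s b -> adj z b -> zc T (sY s) (sG s) (sf s) z x ->
  gp T (sf s x) (sf s y) = q :: p -> gp T (sf s z) (sf s b) = q :: p' -> x = z /\ y = b.

Lemma esize_ge (E : G -> Prop) p : 1 <= size E -> (forall q, In q p -> size E <= size (stb q)) ->
  p = [] \/ 2 <= esize T E p.
Proof.
  destruct p as [|q p]; [now left|]. intros h k. right. unfold esize. simpl.
  pose proof (k q (or_introl eq_refl)). lia.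
Qed.

(* The first edge [q] of a long or too small arc is split off: a pendant vertex with group
   [B], the stabilizer of [q] in the component, is added and the arc slides over it. *)
Section Step1.
Context (s : state) (x y : sY s) (q : egs T) (p : list (egs T)).
Context (gx : sG s x) (gy : sG s y) (hxy : adj x y) (hgp : gp T (sf s x) (sf s y) = q :: p).
Local Notation Y := (sY s).
Local Notation D := (zc T Y (sG s) (sf s) x).
Local Notation B := (cap (stb q) (setstab Y D)).
Local Notation E := (est (x, y)).
Hypothesis bad : ~ (p = [] /\ forall g, ac g q = q -> D (ac g x) -> E g).

Lemma step1 : exists s', leads s s' /\ (Phi s' < Phi s)%R.
Proof.
  assert (sB : sub B) by (apply sub_cap; [apply stb_sub|apply setstab_sub]).
  assert (fB : fin B) by (apply (fin_incl _ (stb q)); [now intros g []|apply hT]).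
  assert (hq : incl E (stb q)).
  { apply (est_gp T (sf s) x y q (s_equi s)). rewrite hgp. now left. }
  assert (fE : fin E) by (apply (fin_incl _ _ hq), hT).
  pose proof (zc_region T hT Y (sG s) (sf s) (s_reg s) (s_equi s) x gx) as rD.
  assert (hEB : incl E B).
  { intros g hg. split; [now apply hq|]. apply (stb_setstab Y D x rD (zc_refl _ _ _ _ _)). apply hg. }
  (* [B] preserves the component of [x], whose fixed connectivity yields a vertex [z] fixed by [B]
     and a path from [x] to [z] fixed by [E]. *)
  destruct (state_fixconn s x gx B sB fB) as (z & hz & hBz & hpath); [now intros g []|].
  assert (gz : sG s z) by (apply (zc_in T Y (sG s) (sf s) x z gx hz)).
  destruct (gp_cons T _ _ _ _ hgp) as [hog htm].
  assert (fz : sf s z = og T q) by (rewrite hog; now apply zc_f in hz).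
  (* The pendant vertex is mapped to the far end of [q]: its arc crosses exactly [q], and the slid
     arc has only [p] left to cross. *)
  destruct (pend_map Y z B sB (V := vgs T) (sf s) (tm T q) (s_equi s)) as (f1 & ef & f1il & f1hb).
  { intros g [hg _]. now apply (edge_fix T g q). }
  set (Y1 := pend Y z B) in *. set (hb := hub Y B : Y1).
  pose proof (pend_minimal KK L0 r0 KKfin Y z B sB fB hBz (s_minimal s)) as M1. fold Y1 in M1.
  set (G1 := pGa Y z B (sG s) : Y1 -> Prop).
  pose proof (pend_region Y z B sB fB hBz (sG s) (s_reg s) : region Y1 G1) as R1.
  assert (G1hb : G1 hb).
  { rewrite <- (ac1 _ hb). apply (pGa_hub Y z B sB hBz (sG s)). now rewrite ac1. }
  set (x1 := il x : Y1). set (y1 := il y : Y1).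
  assert (e1E : est (x1, y1) = E) by apply est_pend_il.
  assert (fne : f1 x1 <> f1 y1).
  { unfold x1, y1. rewrite !f1il. intros c0. apply (gp_nil T) in c0. rewrite c0 in hgp. easy. }
  assert (noO : forall a b : Y1, f1 a = f1 b -> ~ ar x1 y1 a b).
  { intros a b e [g [[h k]|[h k]]]; subst; rewrite !ef in e; apply ac_inj in e; congruence. }
  assert (fE1 : fin (est (x1, y1))) by now rewrite e1E.
  assert (hw : wk (rs (drop Y1 x1 y1) (fun v => incl (est (x1, y1)) (stb v) /\ G1 v)) x1 hb).
  { apply (wk_trans _ _ (il z : Y1)).
    - rewrite e1E. specialize (hpath x E (zc_refl _ _ _ _ _) (est_sub _) hEB).
      assert (hEx : incl E (stb x)) by now intros g [].
      specialize (hpath hEx). revert hpath.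
      apply (wk_map _ (rs (drop Y1 x1 y1) (fun v => incl E (stb v) /\ G1 v)) (il : Y -> Y1)).
      intros a b (i & [j j'] & [k k']). apply wk1.
      split; [split; [exact i|]|].
      + apply noO. rewrite !f1il. apply zc_f in j, k. congruence.
      + rewrite !(stb_il Y (cgs B)). split; (split; [assumption|]);
          apply (zc_in T Y (sG s) (sf s) x); assumption.
    - apply wk1. rewrite e1E.
      assert (shb : stb hb = B).
      { rewrite <- (ac1 _ hb). exact (eq_trans (pend_stb_hub Y B sB e1) (cj1 B)). }
      split; [split|split].
      + pose proof (pend_adj Y z B e1) as h. now rewrite !ac1 in h.
      + intros [g [[_ h]|[_ h]]]; easy.
      + rewrite (stb_il Y (cgs B)). split; [|exact gz]. intros g hg. auto.
      + rewrite shb. now split. }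
  assert (hn : ~ ar x1 y1 hb y1) by (intros [g [[h _]|[h _]]]; easy).
  assert (hxy1 : @adj G Y1 x1 y1) by exact hxy.
  set (Y2 := slidr KK L0 r0 wf_subconj minL Y1 x1 y1 M1 hxy1 fE1 hb G1 hw).
  assert (R2 : region Y2 G1) by (apply (slid_region KK L0 r0 wf_subconj minL); auto).
  assert (ch2 : chi Y2 G1 = c).
  { unfold Y2. rewrite slid_chi; auto. rewrite <- (s_chi s). now apply pend_chi. }
  assert (M2 : minimal KK L0 r0 Y2) by (now apply slid_minimal).
  assert (hell : ~ exists v : vgs T, incl (setstab Y2 G1) (stb v)).
  { intros [v hv]. apply (s_ell s). exists v. intros g hg. apply hv.
    apply (pend_setstab Y z B sB hBz (sG s) g hg). }
  exists (mkstate Y2 G1 f1 M2 R2 ef ch2 hell). split; [split|]; simpl.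
  - intros hQ. apply (pend_fixconn Y z B sB hBz (sG s)). apply slid_fixconn in hQ; auto.
  - intros hall u. destruct (pend_case Y z B u) as [[a ->]|[g ->]]; [apply hall|].
    apply (pGa_hub Y z B sB hBz (sG s)). apply hall.
  - pose proof (osum_slid_region KK L0 r0 wf_subconj minL Y1 x1 y1 M1 hxy1 fE1 hb G1 gx gy hw hn
      _ (phi_finv T f1 ef)) as h1.
    pose proof (osum_pend_region Y z B sB hBz (sG s) gz _ (phi_finv T f1 ef)) as h2.
    assert (p0 : phi T f1 (x1, y1) = pred (4 * size (stb q) - 2 * size E + esize T E p)).
    { unfold phi. rewrite e1E. unfold x1, y1. simpl. now rewrite !f1il, hgp. }
    assert (p1 : phi T f1 (il z : Y1, hb) = pred (4 * size (stb q) - 2 * size B)).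
    { unfold phi. assert (e2 : est (il z : Y1, hb) = B) by exact (est_pend_hub Y z B sB hBz).
      rewrite e2. simpl. unfold hb. rewrite f1il, f1hb, fz, gp_edge. unfold esize. simpl. f_equal. lia. }
    assert (p2 : phi T f1 (hb, y1) = pred (esize T E p)).
    { unfold phi. rewrite (slid_est KK L0 r0 wf_subconj minL Y1 x1 y1 M1 hxy1 fE1 hb
        (slid_hw Y1 x1 y1 hb G1 hw) hn).
      rewrite e1E. simpl. unfold hb, y1. now rewrite f1hb, f1il, htm. }
    assert (pe : osum aorb (arcs_in Y (sG s)) (fun e => INR (phi T f1 (il (fst e) : Y1, il (snd e)))) =
      osum aorb (arcs_in Y (sG s)) (fun e => INR (phi T (sf s) e))).
    { apply osum_ext; [apply aorb_equiv|tauto|apply arcs_in_inv|apply arcs_in_fin|].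
      intros [a b] _. f_equal.
      assert (e2 : est (il a : Y1, il b : Y1) = est (a, b)) by apply est_pend_il.
      transitivity (pred (esize T (est (il a : Y1, il b : Y1)) (gp T (f1 (il a)) (f1 (il b)))));
        [reflexivity|]. now rewrite e2, !f1il. }
    (* If [p] is nonempty, the second [pred] makes the difference. If [p] is empty, the gain must
       come from [B] being strictly larger than [E], and this is what [bad] then says. *)
    assert (lt : phi T f1 (il z : Y1, hb) + phi T f1 (hb, y1) < phi T f1 (x1, y1)).
    { rewrite p0, p1, p2.
      pose proof (size_le _ _ hEB fB). assert (size B <= size (stb q)).
      { apply size_le; [now intros g []|apply hT]. }
      pose proof (sub_pos _ (est_sub (x, y)) fE) as e0.
      destruct (esize_ge E p e0) as [->|h].
      - intros q' hq'. apply size_le; [|apply hT]. apply (est_gp T (sf s) x y q' (s_equi s)).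
        rewrite hgp. now right.
      - simpl. assert (size E < size B); [|lia].
        destruct (le_lt_dec (size B) (size E)) as [l|l]; [|assumption]. exfalso. apply bad.
        split; [reflexivity|]. intros g h1' h2'. apply (size_ge_incl E B hEB fB l).
        split; [exact h1'|]. now apply (zc_setstab T hT Y (sG s) (sf s) (s_reg s) (s_equi s)).
      - lia. }
    apply lt_INR in lt. rewrite plus_INR in lt.
    assert (h3 : (osum aorb (arcs_in Y1 G1) (fun e => INR (phi T f1 e)) =
      Phi s + INR (phi T f1 (il z : Y1, hb)))%R) by exact (eq_trans h2 (f_equal2 Rplus pe eq_refl)).
    assert (h4 : (osum aorb (arcs_in Y2 G1) (fun e => INR (phi T f1 e)) + INR (phi T f1 (x1, y1)) =
      osum aorb (arcs_in Y1 G1) (fun e => INR (phi T f1 e)) + INR (phi T f1 (hb, y1)))%R) by exact h1.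
    change (osum aorb (arcs_in Y2 G1) (fun e => INR (phi T f1 e)) < Phi s)%R. lra.
Qed.
End Step1.

(* Two arcs leaving one component over the same edge [q]: one slides along the other. *)
Section Step2.
Context (s : state) (x y z b : sY s) (q : egs T) (p p' : list (egs T)).
Local Notation Y := (sY s).
Local Notation f := (sf s).
Context (gx : sG s x) (gy : sG s y) (hxy : adj x y) (gz : sG s z) (gb : sG s b) (hzb : adj z b).
Local Notation D := (zc T Y (sG s) f z).
Context (hzx : D x) (hgp : gp T (f x) (f y) = q :: p) (hgp' : gp T (f z) (f b) = q :: p').
Hypothesis n1 : norm1 s.
Hypothesis bad : ~ (x = z /\ y = b).
Local Notation E := (est (x, y)).

Lemma step2 : exists s', leads s s' /\ (Phi s' < Phi s)%R.
Proof.
  destruct (n1 z b q p' gz gb hzb hgp') as [-> hN].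
  pose proof (s_equi s) as ef.
  assert (hq : incl E (stb q)).
  { apply (est_gp T f x y q ef). rewrite hgp. now left. }
  assert (fE : fin E) by (apply (fin_incl _ _ hq), hT).
  pose proof (zc_region T hT Y (sG s) f (s_reg s) ef z gz) as rD.
  assert (hED : incl E (setstab Y D)).
  { intros g hg. apply (stb_setstab Y D x rD hzx). apply hg. }
  (* [E] fixes [q] and preserves the component, so by [norm1] it fixes the other arc over [q], along
     which the slide can pass. *)
  assert (hEzb : incl E (est (z, b))).
  { intros g hg. apply hN; [now apply hq|]. apply (proj1 (hED g hg z)), zc_refl. }
  destruct (state_fixconn s z gz E (est_sub _) fE hED) as (t & ht & _ & hpath).
  pose proof (hpath x E hzx (est_sub _) (fun g h => h) (fun g h => proj1 h)) as w1.
  pose proof (hpath z E (zc_refl _ _ _ _ _) (est_sub _) (fun g h => h)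
    (fun g h => proj1 (hEzb g h))) as w2.
  assert (fx : f x = f z) by now apply zc_f in hzx.
  destruct (gp_cons T _ _ _ _ hgp) as [hog htm].
  destruct (gp_cons T _ _ _ _ hgp') as [hog' htm']. apply (gp_nil T) in htm'.
  assert (fne : f x <> f y) by (intros e; apply (gp_nil T) in e; rewrite e in hgp; easy).
  assert (noO : forall u v : Y, f u = f v -> ~ ar x y u v).
  { intros u v e [g [[h k]|[h k]]]; subst; rewrite !ef in e; apply ac_inj in e; congruence. }
  assert (len : forall u v : Y, ar x y u v -> length (gp T (f u) (f v)) = S (length p)).
  { intros u v [g [[h k]|[h k]]]; subst; rewrite !ef, gp_ac, length_map.
    - now rewrite hgp.
    - now rewrite gp_rev, length_rpath, hgp. }
  (* An element carrying one arc to the other either fixes [q] and preserves the component, hence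
     fixes [z] and [b] by [norm1], or carries [q] to its reverse. *)
  assert (nzb : ~ ar x y z b).
  { intros [g [[h k]|[h k]]].
    - assert (hgq : ac g q = q).
      { pose proof hgp' as e. rewrite h, k, !ef, gp_ac, hgp in e. now injection e. }
      assert (hgz : D (ac g z)).
      { apply (proj1 (region_setstab Y D g x rD hzx (eq_ind z D (zc_refl _ _ _ _ _) _ h) z)), zc_refl. }
      destruct (hN g hgq hgz) as [i j]. apply bad. unfold stb in i, j. simpl in i, j.
      split; apply (ac_inj g); congruence.
    - pose proof hgp' as e. rewrite h, k, !ef, gp_ac, (gp_rev T (f x) (f y)), hgp, rpath_cons, map_app in e.
      apply app_eq_unit in e. destruct e as [[_ e]|[_ e]]; [|easy]. injection e as e.
      apply (noinv T (iv g) q). now rewrite <- e at 1; rewrite acK. }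
  assert (hw : wk (rs (drop Y x y) (fun v => incl E (stb v) /\ sG s v)) x b).
  { assert (hm : forall u v, wk (rs adj (fun v => D v /\ incl E (stb v))) u v ->
      wk (rs (drop Y x y) (fun v => incl E (stb v) /\ sG s v)) u v).
    { intros u v. apply wk_mono. intros a d (i & [j j'] & [k k']). split; [split; [assumption|]|].
      - apply noO. apply zc_f in j, k. congruence.
      - split; (split; [assumption|]); apply (zc_in T Y (sG s) f z); assumption. }
    apply (wk_trans _ _ t); [now apply hm|]. apply (wk_trans _ _ z).
    - apply hm. apply wk_rs_sym; [apply adj_sym|assumption].
    - apply wk1. split; [now split|]. split; (split; [|assumption]); intros g hg; now apply hEzb. }
  assert (hn : ~ ar x y b y).
  { intros h. apply len in h. rewrite <- htm', htm in h. lia. }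
  set (Y2 := slidr KK L0 r0 wf_subconj minL Y x y (s_minimal s) hxy fE b (sG s) hw).
  assert (R2 : region Y2 (sG s)) by (apply (slid_region KK L0 r0 wf_subconj minL); auto using s_reg).
  assert (ch2 : chi Y2 (sG s) = c).
  { unfold Y2. rewrite slid_chi; auto; apply s_chi. }
  assert (M2 : minimal KK L0 r0 Y2) by (now apply slid_minimal).
  exists (mkstate Y2 (sG s) f M2 R2 ef ch2 (s_ell s)). split; [split|]; simpl.
  - intros hQ. apply slid_fixconn in hQ; auto using s_reg.
  - auto.
  - unfold Phi. simpl.
    pose proof (osum_slid_region KK L0 r0 wf_subconj minL Y x y (s_minimal s) hxy fE b (sG s)
      gx gy hw hn _ (phi_finv T f ef)) as h1.
    assert (p0 : phi T f (x, y) = pred (4 * size (stb q) - 2 * size E + esize T E p)).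
    { unfold phi. simpl. now rewrite hgp. }
    assert (p2 : phi T f (b, y) = pred (esize T E p)).
    { unfold phi. rewrite (slid_est KK L0 r0 wf_subconj minL Y x y (s_minimal s) hxy fE b
        (slid_hw Y x y b (sG s) hw) hn). simpl. now rewrite <- htm', htm. }
    assert (lt : phi T f (b, y) < phi T f (x, y)).
    { rewrite p0, p2. pose proof (size_le _ _ hq (hT q)).
      pose proof (sub_pos _ (est_sub (x, y)) fE). lia. }
    apply lt_INR in lt.
    assert (h4 : (osum aorb (arcs_in Y2 (sG s)) (fun e => INR (phi T f e)) + INR (phi T f (x, y)) =
      Phi s + INR (phi T f (b, y)))%R) by exact h1.
    change (osum aorb (arcs_in Y2 (sG s)) (fun e => INR (phi T f e)) < Phi s)%R. lra.
Qed.
End Step2.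

Lemma normalise s : exists s', leads s s' /\ norm1 s' /\ norm2 s'.
Proof.
  destruct (least (fun n => exists s', leads s s' /\ Phi s' = INR n)) as (n & (s' & hl & hn) & hmin).
  { destruct (Phi_nat s) as [n hn]. exists n, s. split; [|assumption]. split; auto. }
  assert (no : ~ exists s2, leads s' s2 /\ (Phi s2 < Phi s')%R).
  { intros (s2 & [l1 l2] & lt). destruct (Phi_nat s2) as [m hm].
    assert (n <= m).
    { apply hmin. exists s2. split; [|assumption]. destruct hl as [k1 k2]. split; auto. }
    rewrite hm, hn in lt. apply INR_lt in lt. lia. }
  assert (N1 : norm1 s').
  { intros x y q p gx gy a e. apply NNPP. intros b. apply no. exact (step1 s' x y q p gx gy a e b). }
  exists s'. split; [assumption|split; [assumption|]].
  intros x y z b q p p' gx gy a gz gb a' h e e'. apply NNPP. intros bad. apply no.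
  exact (step2 s' x y z b q p p' gx gy a gz gb a' h e e' N1 bad).
Qed.
End Normal.

(** * The normal form *)

Section NormalForm.
Context {G : Group} (T : GTree G) (hT : forall q : egs T, fin (stb q)).
Context (Y : gr G) (Ga : Y -> Prop) (f : Y -> vgs T) (hr : region Y Ga) (hf : equi f).
Local Notation zc := (zc T Y Ga f).
Hypothesis zQ : forall x, Ga x -> fixconn Y (zc x).
Hypothesis N1 : forall (x y : Y) q p, Ga x -> Ga y -> adj x y -> gp T (f x) (f y) = q :: p ->
  p = [] /\ forall g, ac g q = q -> zc x (ac g x) -> est (x, y) g.
Hypothesis N2 : forall (x y z b : Y) q p p', Ga x -> Ga y -> adj x y -> Ga z -> Ga b -> adj z b ->
  zc z x -> gp T (f x) (f y) = q :: p -> gp T (f z) (f b) = q :: p' -> x = z /\ y = b.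

(** A walk in the region of which only the crossed tree edges are recorded; moves inside collapsed
    components leave no trace. *)
Fixpoint over (x : Y) (p : list (egs T)) (z : Y) : Prop :=
  match p with
  | [] => zc x z
  | q :: p => exists a b, zc x a /\ Ga b /\ adj a b /\ gp T (f a) (f b) = [q] /\ over b p z
  end.

Lemma over_zc x y p z : zc x y -> over y p z -> over x p z.
Proof.
  destruct p as [|q p]; simpl; intros h; [now apply zc_trans|].
  intros (a & b & i & j). exists a, b. split; [|assumption]. now apply (zc_trans _ _ _ _ _ y).
Qed.

(** By [N2] a walk that turns back over [q] uses the very arc it came by, so the backtrack can be
    cancelled. *)
Lemma over_ex x z : Ga x -> Ga z -> exists p, tred T p /\ over x p z.
Proof.
  intros gx gz. destruct hr as (_ & hc & _). specialize (hc x z gx gz). clear gx gz.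
  induction hc as [x|x y z (a & gx & gy) _ (p & hp & hover)].
  - exists []. split; [exact I|apply zc_refl].
  - destruct (gp T (f x) (f y)) as [|q p0] eqn:e.
    + apply (gp_nil T) in e. exists p. split; [assumption|]. apply (over_zc x y); [|assumption].
      apply wk1. split; [now split|now split].
    + destruct (N1 x y q p0 gx gy a e) as [-> _].
      destruct (classic (exists p', p = rv T q :: p')) as [[p' ->]|n].
      * destruct hover as (c & d & i & gd & k & l & m). exists p'. split; [now apply tred_tl in hp|].
        assert (er : gp T (f y) (f x) = [rv T q]) by now rewrite gp_rev, e.
        destruct (N2 c d y x (rv T q) [] []) as [-> ->]; auto.
        -- apply (zc_in T Y Ga f y c gy i).
        -- now apply adj_sym.
      * exists (q :: p). split.
        -- apply tred_cons; [assumption|]. intros p' ->. apply n. now exists p'.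
        -- exists x, y. split; [apply zc_refl|]. now repeat split.
Qed.

Lemma over_path x p z : over x p z -> tpath T (f x) p (f z).
Proof.
  revert x. induction p as [|q p IH]; simpl; intros x.
  - intros h. symmetry. now apply zc_f in h.
  - intros (a & b & i & gb & k & l & m). destruct (gp_cons T _ _ _ _ l) as [h1 h2].
    apply (gp_nil T) in h2. apply zc_f in i. split; [congruence|]. rewrite h2. auto.
Qed.
Lemma over_image x p z q : over x p z -> In q p -> exists y, Ga y /\ f y = tm T q.
Proof.
  revert x. induction p as [|q' p IH]; simpl; intros x; [easy|].
  intros (a & b & i & gb & k & l & m) [<-|h]; [|eauto].
  destruct (gp_cons T _ _ _ _ l) as [_ h2]. apply (gp_nil T) in h2. now exists b.
Qed.
(** A reduced record is the geodesic between the images of the ends, so its vertices are images. *)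
Lemma image_convex : tconvex T (fun u => exists x, Ga x /\ f x = u).
Proof.
  intros u v q (x & gx & <-) (y & gy & <-) hq.
  destruct (over_ex x y gx gy) as (p & hp & h).
  rewrite (gp_uniq T _ p _ (over_path _ _ _ h) hp) in hq. now apply (over_image x p y).
Qed.
(** A reduced record between points of one fibre is a reduced closed path in the tree, hence
    empty. *)
Lemma fiber_zc x y : Ga x -> Ga y -> f x = f y -> zc x y.
Proof.
  intros gx gy e. destruct (over_ex x y gx gy) as (p & hp & h).
  pose proof (over_path _ _ _ h) as k. rewrite e in k.
  now rewrite (t_acyc T _ _ k hp) in h.
Qed.

Section Fixed.
Context (E : G -> Prop) (sE : sub E) (fE : fin E).
Local Notation fw := (wk (rs adj (fun v => Ga v /\ incl E (stb v)))).

Lemma zc_fixed x a : Ga x -> zc x a -> incl E (stb x) -> incl E (stb a) -> fw x a.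
Proof.
  intros gx h hx ha. pose proof (zc_region T hT Y Ga f hr hf x gx) as rD.
  destruct (zQ x gx E sE fE) as (t & ht & _ & hp).
  { intros g hg. apply (stb_setstab Y (zc x) x rD (zc_refl _ _ _ _ _)). auto. }
  assert (hm : forall u v, wk (rs adj (fun v => zc x v /\ incl E (stb v))) u v -> fw u v).
  { intros u v. apply wk_mono. intros c d (i & [j j'] & [k k']). split; [assumption|].
    split; (split; [|assumption]); apply (zc_in T Y Ga f x); assumption. }
  apply (wk_trans _ _ t); [apply hm, hp; auto; [apply zc_refl|now intros g]|].
  apply wk_rs_sym; [apply adj_sym|]. apply hm, hp; auto. now intros g.
Qed.

(** [E] fixes the crossed edges and preserves the components on the way, so [N1] makes it fix the
    crossing arcs; in between, [zc_fixed] supplies fixed paths. *)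
Lemma over_fixed x p z : over x p z -> Ga x -> incl E (stb x) -> incl E (stb z) ->
  (forall q, In q p -> incl E (stb q)) -> fw x z.
Proof.
  revert x. induction p as [|q p IH]; simpl; intros x h gx hx hz hq.
  - now apply zc_fixed.
  - destruct h as (a & b & i & gb & k & l & m). assert (ga : Ga a) by (apply (zc_in T Y Ga f x); assumption).
    destruct (N1 a b q [] ga gb k l) as [_ hN].
    assert (hab : incl E (est (a, b))).
    { intros g hg. apply hN; [apply (hq q); auto|].
      assert (hg' : setstab Y Ga g) by (apply (stb_setstab Y Ga x hr gx); auto).
      apply (zc_trans _ _ _ _ _ x); [now apply zc_sym|].
      assert (e : ac g x = x) by (apply hx; assumption). rewrite <- e at 1. now apply zc_ac. }
    apply (wk_trans _ _ a); [apply zc_fixed; auto; intros g hg; now apply hab|].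
    apply (wkS _ b).
    + split; [assumption|]. split; (split; [assumption|]); intros g hg; now apply hab.
    + apply IH; auto. intros g hg. now apply hab.
Qed.
End Fixed.

(** [B] fixes a vertex of the convex image. The fibre over it is a single component preserved by
    [B], and the property of that component yields the fixed vertex. *)
Lemma normal_fixconn : fixconn Y Ga.
Proof.
  intros B sB fB hB. destruct hr as ([x0 g0] & _).
  destruct (finite_fixes T B (fun u => exists x, Ga x /\ f x = u) sB fB) as (u & (x & gx & <-) & hu).
  - now exists (f x0), x0.
  - apply image_convex.
  - intros b u hb (x & gx & <-). exists (ac b x). split; [|apply hf].
    apply (proj1 (hB b hb x) gx).
  - destruct (zQ x gx B sB fB) as (z & hz & hBz & _).
    { intros g hg. apply (zc_setstab T hT Y Ga f hr hf x g gx). apply fiber_zc; auto.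
      - apply (proj1 (hB g hg x) gx).
      - rewrite hf. symmetry. now apply hu. }
    assert (gz : Ga z) by (apply (zc_in T Y Ga f x); assumption).
    exists z. split; [assumption|split; [assumption|]]. intros y E gy sE hE hEy.
    destruct (over_ex y z gy gz) as (p & hp & h).
    apply (over_fixed E sE (fin_incl _ _ hE fB) y p z); auto.
    + intros g hg. auto.
    + intros q hq g hg. pose proof (gp_uniq T _ _ _ (over_path _ _ _ h) hp) as e.
      apply (gp_fix T g (f y) (f z)); [| |now rewrite e].
      * apply (equi_stb f y hf). auto.
      * apply (equi_stb f z hf). auto.
Qed.
End NormalForm.

Lemma equi_ex {G : Group} {A V : gset G} : (forall x : A, exists v : V, incl (stb x) (stb v)) ->
  exists f : A -> V, equi f.
Proof.
  intros h.
  destruct (orbit_rep A) as (rp & mv & hmv & rpac). destruct (choice _ h) as [c hc].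
  exists (fun x => ac (mv x) (c (rp x))). intros g x. rewrite rpac.
  assert (hs : stb (rp x) (iv (g ** mv x) ** mv (ac g x))).
  { pose proof (hmv (ac g x)) as e. rewrite rpac in e. unfold stb. rewrite acM, <- e.
    symmetry. apply ac_eq. now rewrite acM, <- hmv. }
  apply hc in hs. unfold stb in hs. rewrite acM in hs. symmetry in hs.
  apply (proj2 (ac_eq _ _ _)) in hs. now rewrite <- acM.
Qed.

(** * Fixed connectivity of all regions *)

Section AllRegions.
Context {G : Group} (T : nat -> GTree G) (hT : forall n (q : egs (T n)), fin (stb q)).
Definition KK (K : G -> Prop) := forall n, exists v : vgs (T n), incl K (stb v).
Context (L0 : list (G -> Prop)) (r0 : R).
Hypothesis wf_subconj : well_founded (fun K' K : G -> Prop => subconj K K').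
Hypothesis minL : forall Y L, good KK Y -> costeq Y L -> ~ mless L L0.
Hypothesis minr : forall Y, good KK Y -> costeq Y L0 -> (nroots Y <= r0)%R.
Hypothesis hne : forall n, exists v : vgs (T n), True.

Lemma KK_fin K : sub K -> fin K -> KK K.
Proof.
  intros sK fK n. destruct (finite_fixes (T n) K (fun _ => True) sK fK) as (u & _ & h).
  - destruct (hne n) as [v _]. now exists v.
  - now intros u v q.
  - auto.
  - now exists u.
Qed.
Lemma KK_cj g K : KK K -> KK (cj g K).
Proof.
  intros h n. destruct (h n) as [v hv]. exists (ac g v). rewrite stb_ac. now apply cj_incl.
Qed.

Lemma start Y Ga n : minimal KK L0 r0 Y -> region Y Ga ->
  (~ exists v : vgs (T n), incl (setstab Y Ga) (stb v)) ->
  exists s : state KK L0 r0 (T n) (chi Y Ga), sY _ _ _ _ _ s = Y /\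
    (fixconn (sY _ _ _ _ _ s) (sG _ _ _ _ _ s) -> fixconn Y Ga) /\
    ((forall x, Ga x) -> forall x, sG _ _ _ _ _ s x).
Proof.
  intros hY hr hn. destruct hY as ((h1 & h2 & h3) & h4).
  destruct (equi_ex (A := Y) (V := vgs (T n))) as [f hf]; [intros x; apply h3|].
  exists (mkstate KK L0 r0 (T n) (chi Y Ga) Y Ga f (conj (conj h1 (conj h2 h3)) h4) hr hf eq_refl hn).
  simpl. auto.
Qed.

Lemma all_fixconn Y Ga : minimal KK L0 r0 Y -> region Y Ga -> fixconn Y Ga.
Proof.
  intros hY0 hr0. apply NNPP. intros hQ0.
  destruct (chi_min KK L0 r0 (fun Y Ga => minimal KK L0 r0 Y /\ region Y Ga /\ ~ fixconn Y Ga))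
    as (Y1 & G1 & (hY & hr & hQ) & hmin); [tauto|now exists Y, Ga|]. clear Y Ga hY0 hr0 hQ0.
  assert (small : forall Y De, minimal KK L0 r0 Y -> region Y De -> (chi Y De < chi Y1 G1)%R -> fixconn Y De).
  { intros Y De a b lt. apply NNPP. intros nq. specialize (hmin Y De (conj a (conj b nq))). lra. }
  apply hQ. destruct (classic (KK (setstab Y1 G1))) as [k|k].
  - apply (elliptic_fixconn KK L0 r0 KK_cj minL minr); assumption.
  - apply not_all_ex_not in k. destruct k as [n hn].
    destruct (start Y1 G1 n hY hr hn) as (s & _ & hs & _). apply hs.
    destruct (normalise KK L0 r0 KK_fin wf_subconj minL (T n) (hT n) _ small s) as (s' & [l _] & n1 & n2).
    apply l. apply (normal_fixconn (T n) (hT n) _ _ (sf _ _ _ _ _ s')).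
    + apply s_reg.
    + apply s_equi.
    + intros x gx. now apply (state_fixconn KK L0 r0 (T n) (hT n) _ small).
    + exact n1.
    + exact n2.
Qed.
End AllRegions.

(** * Minimal graphs exist and bound the number of orbits *)

Section Cayley.
Context {G : Group} (S : list G) (hS : forall x : G, generated (fun y => In y S) x).
Definition regular : gset G := mkgset G (gmul G) mul1g mulA.
Definition cadj (x y : regular) := x <> y /\ exists s, In s S /\ (y = x ** s \/ x = y ** s).

Lemma cadj_sym x y : cadj x y -> cadj y x.
Proof. intros [n (s & i & h)]. split; [auto|]. exists s. tauto. Qed.
Lemma cadj_irr x : ~ cadj x x.
Proof. now intros [h _]. Qed.
Lemma cadj_ac g x y : cadj x y -> cadj (ac g x) (ac g y).
Proof.
  intros [n (s & i & h)]. split; [intros e; now apply ac_inj in e|]. exists s.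
  split; [assumption|]. unfold ac. simpl. rewrite !mulA. destruct h as [->| ->]; auto.
Qed.
Lemma cay_vfin : ofin (@vorb G regular) (fun _ => True).
Proof.
  exists [e1 : regular]. intros x _. exists e1. split; [now left|]. exists x. symmetry.
  apply (mulg1 x).
Qed.
Lemma cay_efin : ofin (@aorb G regular) (fun e => cadj (fst e) (snd e)).
Proof.
  exists (map (fun s => (e1 : regular, s : regular)) S). intros [x y] [_ (s & i & h)].
  exists (e1, s). split; [now apply (in_map (fun s => (e1 : regular, s : regular)))|]. simpl in h.
  destruct h as [->| ->].
  - exists x. left. split; [symmetry; apply (mulg1 x)|reflexivity].
  - exists y. right. split; [reflexivity|symmetry; apply (mulg1 y)].
Qed.
(** The Cayley graph with all vertices as roots: stabilizers are trivial, so it starts the search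
    for a minimum. *)
Definition cayley : gr G := mkgr regular cadj (fun _ => True) cadj_sym cadj_irr cadj_ac
  (fun _ _ h => h) cay_vfin cay_efin (inhabits (e1 : regular)).

Lemma cayley_good KK : (forall K, sub K -> fin K -> KK K) -> good KK cayley.
Proof.
  intros hK.
  assert (hc : forall h x : G, wk (@adj G cayley) x (x ** h)).
  { intros h. apply (hS h (fun h => forall x, wk (@adj G cayley) x (x ** h))).
    - split; [|split].
      + intros x. rewrite mulg1. apply wk0.
      + intros a b p q x. rewrite <- mulA. now apply (wk_trans _ _ (x ** a)).
      + intros a p x. apply wk_sym; [apply cadj_sym|]. specialize (p (x ** iv a)).
        now rewrite mulA, mulVg, mulg1 in p.
    - intros s i x. destruct (classic (x = x ** s)) as [e|n]; [rewrite <- e; apply wk0|].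
      apply wk1. split; [assumption|]. exists s. auto. }
  split; [|split].
  - intros x y. replace y with (x ** (iv x ** y)) by (now gs). apply hc.
  - intros x. exists x. split; [exact I|apply wk0].
  - intros x. apply hK; [apply stb_sub|]. exists [e1]. intros g hg. left.
    unfold stb, ac in hg. simpl in hg. apply (f_equal (fun y => y ** iv x)) in hg.
    now gs in hg.
Qed.
End Cayley.

Section ExistMinimal.
Context {G : Group} (KK : (G -> Prop) -> Prop).
Hypothesis wf_subconj : well_founded (fun K' K : G -> Prop => subconj K K').

Lemma nroots_nat (Y : gr G) : exists l, reps vorb (@rt G Y) l /\ nroots Y = INR (length l).
Proof.
  destruct (osum_list vorb vorb_equiv (@rt G Y)) as (l & a & b).
  - apply inv_ac, rt_ac.
  - apply vfin_sub.
  - exists l. split; [assumption|]. unfold nroots. now rewrite b, sm_one.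
Qed.

Lemma minimal_exists : (exists Y, good KK Y) -> exists Y L0 r0,
  (forall Y L, good KK Y -> costeq Y L -> ~ mless L L0) /\
  (forall Y, good KK Y -> costeq Y L0 -> (nroots Y <= r0)%R) /\ minimal KK L0 r0 Y.
Proof.
  intros [Y0 h0]. destruct (cost_ex KK Y0 h0) as [L hL].
  assert (H : exists L0, (exists Y, good KK Y /\ costeq Y L0) /\
    forall Y L, good KK Y -> costeq Y L -> ~ mless L L0).
  { assert (hE : exists Y, good KK Y /\ costeq Y L) by now exists Y0. clear Y0 h0 hL.
    induction (mless_wf wf_subconj L) as [L _ IH].
    destruct (classic (exists L', mless L' L /\ exists Y, good KK Y /\ costeq Y L')) as [(L' & a & b)|n].
    - exact (IH L' a b).
    - exists L. split; [assumption|]. intros Y L' a b c. apply n. exists L'. split; [assumption|now exists Y]. }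
  destruct H as (L0 & (Y1 & g1 & c1) & hm).
  destruct (greatest (fun n => exists Y, good KK Y /\ costeq Y L0 /\ nroots Y = INR n) (length L0 + 1))
    as (n & (Y & a & b & e) & hn).
  - destruct (nroots_nat Y1) as (l & _ & e). exists (length l), Y1. auto.
  - intros n (Y & a & b & e). apply INR_le. rewrite <- e, plus_INR. simpl.
    apply (nroots_bound Y KK L0 a b).
  - exists Y, L0, (INR n). split; [assumption|split; [|now split]].
    intros Y' a' b'. destruct (nroots_nat Y') as (l & _ & e'). rewrite e'. apply le_INR, hn.
    exists Y'. auto.
Qed.
End ExistMinimal.

(** * Consequences of reducedness and the orbit count *)

Section ReducedTree.
Context {G : Group} (T : GTree G) (hred : reduced_tree T).

Lemma not_compressible (q : egs T) : incl (stb (og T q)) (stb q) ->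
  (forall g, ac g (og T q) <> tm T q) -> False.
Proof.
  intros h k. apply (hred q). split.
  - intros g. split; [|apply h]. intros e. apply (edge_fix T g q e).
  - intros [g hg]. now apply (k g).
Qed.

(** A first edge leaving [v] would be compressible from its far end: what fixes that end also fixes
    [v], hence the edge, and the far end is not a translate of [v]. *)
Lemma elliptic_one (v u : vgs T) : (forall g, ac g v = v) -> u = v.
Proof.
  intros hv. apply NNPP. intros ne.
  destruct (gp T v u) as [|q p] eqn:e; [apply (gp_nil T) in e; congruence|].
  destruct (gp_cons T _ _ _ _ e) as [ho _]. apply (not_compressible (rv T q)).
  - rewrite og_rv. intros g hg. unfold stb. rewrite <- rv_ac. f_equal.
    apply (gp_fix T g (og T q) (tm T q)); [now rewrite ho|assumption|].
    rewrite gp_edge. now left.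
  - intros g hg. rewrite og_rv, tm_rv, ho in hg.
    assert (e' : tm T q = v) by (rewrite <- (acK g (tm T q)), hg; apply hv).
    pose proof (gp_edge T q) as h. rewrite ho, e', gp_refl in h. easy.
Qed.

Lemma path_exit (C : vgs T -> Prop) v p w : tpath T v p w -> C v -> ~ C w ->
  exists q, C (og T q) /\ ~ C (tm T q).
Proof.
  revert v. induction p as [|q p IH]; simpl; intros v; [now intros ->|].
  intros [<- h] hv hw. destruct (classic (C (tm T q))) as [c|c]; [eauto|now exists q].
Qed.

(** Let an edge [q] leave [C]. If some [g] fixed its outer end but not [q], the path from [og T q]
    to its translate would pass through the outer end, against convexity; so [rv T q] would be
    compressible. *)
Lemma convex_all (C : vgs T -> Prop) : tconvex T C -> (forall g u, C u -> C (ac g u)) ->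
  (exists u, C u) -> forall u, C u.
Proof.
  intros hC hG [u0 h0] u. apply NNPP. intros hu.
  destruct (path_exit C u0 _ u (proj1 (gp_spec T u0 u)) h0 hu) as (q & a & b).
  apply (not_compressible (rv T q)).
  - rewrite og_rv. intros g hg. unfold stb. apply NNPP. intros ne. apply b.
    assert (e : gp T (og T q) (ac g (og T q)) = [q; ac g (rv T q)]).
    { apply gp_uniq.
      - simpl. rewrite og_ac, tm_ac, og_rv, tm_rv. auto.
      - simpl. auto. }
    apply (hC (og T q) (ac g (og T q))); auto. rewrite e. now left.
  - intros g hg. rewrite og_rv, tm_rv in hg. apply b.
    rewrite <- (acK g (tm T q)), hg. auto.
Qed.
End ReducedTree.

Section CountOrbits.
Context {G : Group} (T : GTree G) (hT : forall q : egs T, fin (stb q)) (hred : reduced_tree T).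
Context (Y : gr G) (Ga : Y -> Prop) (all : forall x, Ga x).
Context (f : Y -> vgs T) (hr : region Y Ga) (hf : equi f).
Local Notation zc := (zc T Y Ga f).
Hypothesis N1 : forall (x y : Y) q p, Ga x -> Ga y -> adj x y -> gp T (f x) (f y) = q :: p ->
  p = [] /\ forall g, ac g q = q -> zc x (ac g x) -> est (x, y) g.
Hypothesis N2 : forall (x y z b : Y) q p p', Ga x -> Ga y -> adj x y -> Ga z -> Ga b -> adj z b ->
  zc z x -> gp T (f x) (f y) = q :: p -> gp T (f z) (f b) = q :: p' -> x = z /\ y = b.
Context (sg : Y -> Y) (ht : Y -> nat) (HS : selects (@dead G Y) (fun _ => True) rt sg ht).

Lemma f_onto u : exists x, f x = u.
Proof.
  destruct (convex_all T hred (fun u => exists x, Ga x /\ f x = u)) with (u := u) as (x & _ & e).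
  - exact (image_convex T Y Ga f hr N1 N2).
  - intros g v (x & _ & <-). exists (ac g x). split; [apply all|apply hf].
  - destruct (ginh G Y) as [x]. now exists (f x), x.
  - now exists x.
Qed.

(* Otherwise the fibre over [u] flows to a single vertex [t] fixed by [G_u], and the edge
   below the parent arc of [t] is compressible. *)
Lemma fibre_marked u : (exists x, rt x /\ f x = u) \/
  exists a b, adj a b /\ ~ tarc (fun _ => True) rt sg (a, b) /\ f a = u.
Proof.
  apply NNPP. intros no.
  assert (nrt : forall x, f x = u -> ~ rt x) by (intros x e c; apply no; left; now exists x).
  pose proof HS as (h1 & h2 & _).
  assert (dd : forall x : Y, True -> ~ rt x -> incl (stb x) (stb (sg x))).
  { intros x a b. now destruct (h1 x a b) as ([_ k] & _). }
  assert (par : forall a b, adj a b -> f a = u ->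
     (~ rt a /\ b = sg a) \/ (~ rt b /\ a = sg b)).
  { intros a b p e. assert (ta : tarc (fun _ => True) rt sg (a, b)).
    { apply NNPP. intros c. apply no. right. now exists a, b. }
    apply (tarc_dead _ (fun _ => True) rt (fun _ _ h => h) (rt_ac G Y) sg ht HS dd) in ta. tauto. }
  destruct (f_onto u) as [x0 e0].
  assert (ext : exists t, f t = u /\ f (sg t) <> u).
  { remember (ht x0) as n eqn:en. revert x0 e0 en. induction n as [n IH] using lt_wf_ind.
    intros x e en. destruct (classic (f (sg x) = u)) as [c|c]; [|now exists x].
    destruct (h1 x I (nrt x e)) as (_ & _ & h). apply (IH (ht (sg x))) with (x0 := sg x); auto. lia. }
  destruct ext as (t & et & nt).
  set (cs := fun a b => b = sg a /\ f a = u /\ f b = u).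
  (* The fibre is connected and every arc at it is a parent arc. As the parent of [t] lies outside,
     a neighbour of a point flowing to [t] flows to [t] as well. *)
  assert (flow : forall y, f y = u -> wk cs y t).
  { intros y ey. apply NNPP. intros nw.
    assert (z : zc t y) by (apply (fiber_zc T Y Ga f hr N1 N2); auto; congruence).
    destruct (wk_exit _ (fun a => f a = u /\ wk cs a t) _ _ z) as
      (a & b & ([p q] & _) & [ea wa] & nb); [split; [assumption|apply wk0]|tauto|].
    apply nb. assert (eb : f b = u) by congruence. split; [assumption|].
    destruct (par a b p ea) as [[_ ->]|[_ e]].
    - apply wk_cases in wa. destruct wa as [->|(c & (-> & _) & w)]; [easy|assumption].
    - apply (wkS _ a); [now repeat split|assumption]. }
  assert (mono : forall a b, wk cs a b -> ht b <= ht a).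
  { induction 1 as [a|a b c (-> & ea & _) _ IH]; [lia|].
    destruct (h1 a I (nrt a ea)) as (_ & _ & h). lia. }
  (* [ac g t] flows to [t]. A nontrivial flow would begin with [ac g (sg t)] in the fibre, whereas
     [sg t] is outside it. *)
  assert (state : incl (stb u) (stb t)).
  { intros g hg. assert (eg : f (ac g t) = u) by (rewrite hf, et; exact hg).
    pose proof (flow _ eg) as w. apply wk_cases in w.
    destruct w as [w|(b & (-> & _ & k) & _)]; [exact w|]. exfalso. apply nt.
    rewrite (sg_ac _ (fun _ => True) rt sg ht HS dd), hf in k; auto.
    rewrite <- (acK g (f (sg t))), k. unfold stb in hg. rewrite <- hg at 1. apply acK. }
  destruct (h1 t I (nrt t et)) as ([ad di] & _ & hht).
  destruct (gp T (f t) (f (sg t))) as [|q p] eqn:e; [apply (gp_nil T) in e; congruence|].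
  destruct (N1 t (sg t) q p (all t) (all (sg t)) ad e) as [-> _].
  destruct (gp_cons T _ _ _ _ e) as [ho hm]. apply (gp_nil T) in hm.
  apply (not_compressible T hred q).
  - rewrite ho, et. intros g hg. apply (gp_fix T g (f t) (f (sg t))).
    + now rewrite et.
    + apply (equi_stb f (sg t) hf). auto.
    + rewrite e. now left.
  (* If the ends of [q] were equivalent, a translate of [sg t] would lie in the fibre and flow to
     [t]; but the flow never raises the height, and [sg t] is one lower than [t]. *)
  - intros g hg. rewrite ho, et, hm in hg.
    assert (ew : f (ac (iv g) (sg t)) = u) by (rewrite hf, <- hg; apply acK).
    apply flow, mono in ew. rewrite h2 in ew. lia.
Qed.

(** Every orbit of tree vertices is hit by a root or by an end of a leftover arc; the two ends
    account for the factor 2. *)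
Lemma orbits_bound n rl ll : at_least_vertex_orbits T n -> reps vorb (@rt G Y) rl ->
  reps aorb (fun e => adjE Y e /\ ~ tarc (fun _ => True) rt sg e) ll ->
  n <= length rl + 2 * length ll.
Proof.
  intros (l & <- & hnd & hl) (_ & r2 & _) (_ & l2 & _).
  set (K := map f rl ++ map (fun e => f (fst e)) ll ++ map (fun e => f (snd e)) ll : list (vgs T)).
  assert (hK : forall u : vgs T, exists k, In k K /\ vorb k u).
  { intros u. unfold K. destruct (fibre_marked u) as [(x & rx & <-)|(a & b & p & q & <-)].
    - destruct (r2 x rx) as (y & i & [g ->]). exists (f y). split.
      + apply in_app_iff. left. now apply in_map.
      + exists g. apply hf.
    - destruct (l2 (a, b)) as (e & i & [g h]); [now split|]. simpl in h.
      destruct h as [[-> _]|[-> _]].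
      + exists (f (fst e)). split; [|exists g; apply hf].
        apply in_app_iff. right. apply in_app_iff. left. now apply (in_map (fun e => f (fst e))).
      + exists (f (snd e)). split; [|exists g; apply hf].
        apply in_app_iff. right. apply in_app_iff. right. now apply (in_map (fun e => f (snd e))). }
  destruct (choice _ hK) as [c hc].
  replace (length rl + 2 * length ll) with (length K).
  - assert (hle : length (map c l) <= length K); [|now rewrite length_map in hle].
    apply NoDup_incl_length.
    + clear - hnd hl hc. induction hnd as [|u l h _ IH]; simpl; constructor.
      * intros i. apply in_map_iff in i. destruct i as (v & e & i). apply h.
        destruct (hc u) as [_ [g hg]], (hc v) as [_ [k hk]].
        assert (E : u = v); [|now rewrite E].
        apply (hl u v (or_introl eq_refl) (or_intror i) (k ** iv g)).
        rewrite e in hk. rewrite hk. rewrite hg at 1.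
        exact (eq_trans (acM (vgs T) k (iv g) _) (f_equal (ac k) (acK g (c u)))).
      * apply IH. intros u' v' i j. apply hl; now right.
    + intros k i. apply in_map_iff in i. destruct i as (u & <- & _). apply hc.
  - unfold K. rewrite !length_app, !length_map. lia.
Qed.
End CountOrbits.

Lemma orbit_bound {G : Group} (T : nat -> GTree G) : finitely_generated G ->
  well_founded (fun K' K : G -> Prop => subconj K K') ->
  (forall n, reduced_tree (T n) /\ finite_edge_stabilizers (T n)) ->
  (forall n, at_least_vertex_orbits (T n) 1) ->
  exists b, forall n N, at_least_vertex_orbits (T n) N -> N <= b.
Proof.
  intros [gens hS] wf_subconj hT hne1.
  assert (hne : forall n, exists v : vgs (T n), True).
  { intros n. destruct (hne1 n) as ([|v l] & e & _); [easy|]. now exists v. }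
  assert (setstab : forall n (q : egs (T n)), fin (stb q)) by (intros n q; apply (hT n)).
  set (K := KK T).
  assert (kf : forall H, sub H -> fin H -> K H) by (apply KK_fin; assumption).
  destruct (minimal_exists K wf_subconj) as (Y & L0 & r0 & minL & minr & hY).
  { exists (cayley gens). now apply cayley_good. }
  destruct hY as (hg & hc & hr0). destruct (nroots_nat Y) as (rl0 & _ & er0).
  (* The successor covers the trees with a global fixed vertex, which consist of that vertex
     alone. *)
  exists (S (length rl0 + 2 * length L0)). intros n N hN.
  destruct (classic (exists v : vgs (T n), forall g, ac g v = v)) as [[v hv]|hnell].
  - destruct hN as (l & <- & hnd & _).
    destruct l as [|a [|b l]]; simpl; try lia. exfalso.
    inversion hnd as [|? ? h _]. apply h. left.
    rewrite (elliptic_one (T n) (proj1 (hT n)) v a hv).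
    apply (elliptic_one (T n) (proj1 (hT n)) v b hv).
  - assert (reg : region Y (fun _ => True)) by apply whole_region, hg.
    destruct (start T L0 r0 Y (fun _ => True) n) as (s & _ & _ & hall); auto.
    { now split. }
    { intros [v hv]. apply hnell. exists v. intros g. now apply hv. }
    set (c := chi Y (fun _ => True)) in *.
    assert (small : forall Y De, minimal K L0 r0 Y -> region Y De -> (chi Y De < c)%R -> fixconn Y De).
    { intros Y' De a b _. apply (all_fixconn T setstab L0 r0 wf_subconj minL minr hne); assumption. }
    destruct (normalise K L0 r0 kf wf_subconj minL (T n) (setstab n) c small s) as (s' & [_ l] & n1 & n2).
    assert (all : forall x, sG K L0 r0 (T n) c s' x) by (apply l, hall; auto).
    destruct (s_minimal K L0 r0 (T n) c s') as (hg' & hc' & hr').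
    destruct (parents K _ hg') as (sg & ht & HS).
    destruct (links_list _ _ _ HS) as (ll & hll & cl). destruct (nroots_nat (sY K L0 r0 (T n) c s')) as (rl & hrl & er).
    assert (lr : length rl = length rl0) by (apply INR_eq; congruence).
    assert (le : length ll = length L0).
    { apply INR_eq. specialize (cl _ one_clw). specialize (hc' _ one_clw).
      rewrite sm_one in *. rewrite length_map in cl. lra. }
    pose proof (orbits_bound (T n) (proj1 (hT n)) _ _ all (sf K L0 r0 (T n) c s')
      (s_reg K L0 r0 (T n) c s') (s_equi K L0 r0 (T n) c s') n1 n2 sg ht HS N rl ll hN hrl hll). lia.
Qed.

Theorem theorem3p5 (G : Group) :
  finitely_generated G -> inaccessible G ->
  exists H : G -> Prop,
    is_subgroup H /\ ~ finite_set H /\ locally_finite H.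
Proof.
  intros hG (_ & T & hT & _ & hN). apply NNPP. intros no.
  pose proof (wf_subconj_of_no_locally_finite no) as wf_subconj.
  destruct (hN 1) as [n0 h0].
  (* The sequence is shifted to make every tree in it nonempty. *)
  destruct (orbit_bound (fun n => T (n0 + n)) hG wf_subconj) as [b hb].
  - intros n. split; apply hT.
  - intros n. apply h0. lia.
  - destruct (hN (S b)) as [n1 h1]. specialize (hb n1 (S b) (h1 (n0 + n1) ltac:(lia))). lia.
Qed.
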